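(* Let $G$ be a second countable locally compact Hausdorff groupoid with Haar system $\{\lambda^u\}_{u\in G^{(0)}}$. Let $u\in G^{(0)}$ and suppose that $L$ is an irreducible representation of the stability group $G(u)=\{x\in G: s(x)=u=r(x)\}$ (regarded as an irreducible representation of $C^*(G(u))$). Then the induced representation $\operatorname{Ind}_{G(u)}^{G}L$ is an irreducible representation of $C^*(G)$.
   Context: Groupoid conventions: $G$ has range and source maps $r,s$ and unit space $G^{(0)}$; $\lambda^u$ is supported on $G^u=r^{-1}(u)$; Haar systems are continuous and left invariant; $\lambda_u$ denotes the image of $\lambda^u$ under inversion, supported on $G_u=s^{-1}(u)$. $C^*(G)$ is the (full) groupoid $C^*$-algebra, the universal $C^*$-completion of $C_c(G)$ with $f*g(x)=\int_G f(y)g(y^{-1}x)\,d\lambda^{r(x)}(y)$ and $f^*(x)=\overline{f(x^{-1})}$. Representations of $C^*$-algebras are nondegenerate. The stability group $G(u)$ is a closed subgroupoid of $G$ with unit space $\{u\}$; it is equipped with a (left) Haar measure $\alpha$, and $C^*(G(u))$ is its groupoid $C^*$-algebra (with involution $g^*(h)=\overline{g(h^{-1})}$, no modular function; this is isomorphic to the usual group $C^*$-algebra, and irreducible unitary representations of the group $G(u)$ correspond to irreducible representations of $C^*(G(u))$). Induced representation: for $\phi,\psi\in C_c(G_u)$ define $\langle\phi,\psi\rangle_{*}\in C_c(G(u))$ by $$\langle\phi,\psi\rangle_{*}(h)=\int_G\overline{\phi(y)}\,\psi(yh)\,d\lambda_{u}(y),\qquad h\in G(u).$$ Let $L$ be a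 representation of $C^*(G(u))$ on a Hilbert space $\mathcal H_L$. The space of $\operatorname{Ind}_{G(u)}^GL$ is the Hilbert space completion of the algebraic tensor product $C_c(G_u)\odot\mathcal H_L$ with respect to the pre-inner product determined by $(\phi\otimes h\mid\psi\otimes k)=\bigl(L(\langle\psi,\phi\rangle_{*})h\mid k\bigr)$. Writing $\phi\otimes_{G(u)}h$ for the class of $\phi\otimes h$, the representation $\operatorname{Ind}_{G(u)}^GL$ of $C^*(G)$ is determined by $$(\operatorname{Ind}_{G(u)}^GL)(f)(\phi\otimes_{G(u)}h)=(f*\phi)\otimes_{G(u)}h,\qquad f\in C_c(G),$$ where $f*\phi(z)=\int_G f(y)\phi(y^{-1}z)\,d\lambda^{r(z)}(y)$ for $z\in G_u$. *)

(* Defs.v *)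
From HB Require Import structures.
From mathcomp Require Import all_boot all_order all_algebra.
From mathcomp Require Import complex.
From mathcomp Require Import all_classical all_reals all_analysis.

Set Implicit Arguments.
Unset Strict Implicit.
Unset Printing Implicit Defensive.

Import Order.TTheory GRing.Theory Num.Theory.
Import numFieldNormedType.Exports.

Local Open Scope classical_set_scope.
Local Open Scope ring_scope.
Local Open Scope complex_scope.

(* Naming the structure lets the topology that every [numFieldType] carries be
   found on the complex numbers. *)
Definition cplx (R : realType) : numClosedFieldType := R[i].

(* A groupoid is presented one-sortedly: units are arrows, [grng] and [gsrc]
   are r and s, and [gmul x y] is meaningful only when [gsrc x = grng y]. *)
HB.mixin Record isGroupoid (G : Type) := {
  grng : G -> G;
  gsrc : G -> G;
  gmul : G -> G -> G;
  ginv : G -> G;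
  gsrc_rng : forall x, gsrc (grng x) = grng x;
  grng_src : forall x, grng (gsrc x) = gsrc x;
  grngM : forall x y, gsrc x = grng y -> grng (gmul x y) = grng x;
  gsrcM : forall x y, gsrc x = grng y -> gsrc (gmul x y) = gsrc y;
  gmulA : forall x y z, gsrc x = grng y -> gsrc y = grng z ->
    gmul x (gmul y z) = gmul (gmul x y) z;
  gmul1g : forall x, gmul (grng x) x = x;
  gmulg1 : forall x, gmul x (gsrc x) = x;
  grngV : forall x, grng (ginv x) = gsrc x;
  gsrcV : forall x, gsrc (ginv x) = grng x;
  gmulgV : forall x, gmul x (ginv x) = grng x;
  gmulVg : forall x, gmul (ginv x) x = gsrc x
}.

#[short(type="groupoidType")]
HB.structure Definition Groupoid := {G of isGroupoid G}.

HB.mixin Record Groupoid_isTopological (G : Type) of Groupoid G & Topological G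
    := {
  ginv_continuous : continuous (@ginv G);
  gmul_continuous : {within [set p : G * G | gsrc p.1 = grng p.2],
    continuous (fun p : G * G => gmul p.1 p.2)}
}.

(* The base point is irrelevant: measurable types are required to be pointed. *)
#[short(type="topGroupoidType")]
HB.structure Definition TopGroupoid :=
  {G of Groupoid G & PointedTopological G & Groupoid_isTopological G}.

Notation borel G := (g_sigma_algebraType (@open G)).

Section groupoid_sets.
Context {G : groupoidType}.
Implicit Types (D : set G) (u : G).

Definition units : set G := range (@grng G).

Definition rfiber D u : set G := D `&` [set x | grng x = u].

Definition sfiber D u : set G := D `&` [set x | gsrc x = u].

Definition stability u : set G := [set x | gsrc x = u /\ grng x = u].

End groupoid_sets.

Section functions.
Context {R : realType} {G : topGroupoidType}.
Local Notation C := (cplx R).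
Implicit Types (D : set G) (u : G) (f g phi psi : G -> C)
  (lam : G -> {measure set (borel G) -> \bar R}).

(* C_c(D) for a closed set D, its elements being extended by 0 off D. Maps on
   C_c(D) are total on [G -> C]; their values outside [Cc D] carry no meaning. *)
Definition Cc D f := {within D, continuous f} /\
  exists K : set G, [/\ compact K, K `<=` D & forall x, ~ K x -> f x = 0].

Definition cintegral (mu : set (borel G) -> \bar R) D f : C :=
  fine (\int[mu]_(x in D) (complex.Re (f x))%:E)%E
  +i* fine (\int[mu]_(x in D) (complex.Im (f x))%:E)%E.

Definition source_measure lam u : set (borel G) -> \bar R :=
  pushforward (lam u) (@ginv G : borel G -> borel G).

(* Left invariant continuous Haar system on a closed subgroupoid D. Only the
   measures [lam u] at units u of D matter. As G is second countable, locally
   compact and Hausdorff, a Borel measure finite on compact sets is Radon. *)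
Record haar_system D lam : Prop := {
  haar_compact : forall u K, (D `&` units) u -> compact K -> (lam u K < +oo)%E;
  haar_concentrated : forall u, (D `&` units) u -> lam u (~` rfiber D u) = 0%E;
  haar_full : forall u U, (D `&` units) u -> open U ->
    U `&` rfiber D u !=set0 -> (0 < lam u U)%E;
  haar_continuous : forall f, Cc D f ->
    {within D `&` units, continuous (fun u => cintegral (lam u) (rfiber D u) f)};
  haar_invariant : forall f x, Cc D f -> D x ->
    cintegral (lam (gsrc x)) (rfiber D (gsrc x)) (fun y => f (gmul x y)) =
    cintegral (lam (grng x)) (rfiber D (grng x)) f
}.

(* On a closed subgroupoid D, this vanishes off D when f and g do. It also gives
   the action of C_c(G) on C_c(G_u), with D the whole groupoid. *)
Definition convolution D lam f g : G -> C := fun x =>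
  cintegral (lam (grng x)) (rfiber D (grng x))
    (fun y => f y * g (gmul (ginv y) x)).

Definition involution f : G -> C := fun x => (f (ginv x))^*.

Definition Inorm D lam f : \bar R := ereal_sup
  ([set (\int[lam u]_(x in rfiber D u) (complex.Re `|f x|)%:E)%E
     | u in D `&` units] `|`
   [set (\int[source_measure lam u]_(x in sfiber D u) (complex.Re `|f x|)%:E)%E
     | u in D `&` units]).

End functions.

(* Hilbert spaces; the inner product is linear in its first variable. *)
HB.mixin Record CompleteNormedModule_isHilbert (C : numClosedFieldType) H
    of CompleteNormedModule C H := {
  hdot : {dot H for Num.conj};
  hdot_norm : forall x : H, hdot x x = `|x| ^+ 2
}.

#[short(type="hilbertType")]
HB.structure Definition Hilbert (C : numClosedFieldType) :=
  {H of CompleteNormedModule C H & CompleteNormedModule_isHilbert C H}.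

(* C*-algebras, not necessarily unital. *)
HB.mixin Record CompleteNormedModule_isCstarAlgebra (C : numClosedFieldType) A
    of CompleteNormedModule C A := {
  cmul : A -> A -> A;
  cstar : A -> A;
  cmulA : associative cmul;
  cmul_linearl : forall k a b c,
    cmul (k *: a + b) c = k *: cmul a c + cmul b c;
  cmul_linearr : forall k a b c,
    cmul a (k *: b + c) = k *: cmul a b + cmul a c;
  cmul_norm : forall a b, `|cmul a b| <= `|a| * `|b|;
  cstarK : involutive cstar;
  cstar_linear : forall k a b, cstar (k *: a + b) = k^* *: cstar a + cstar b;
  cstarM : forall a b, cstar (cmul a b) = cmul (cstar b) (cstar a);
  cstar_norm : forall a, `|cmul (cstar a) a| = `|a| ^+ 2
}.

#[short(type="cstarAlgType")]
HB.structure Definition CstarAlgebra (C : numClosedFieldType) :=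
  {A of CompleteNormedModule C A & CompleteNormedModule_isCstarAlgebra C A}.

Section representations.
Context {C : numClosedFieldType}.

Definition linear_subspace (V : lmodType C) (M : set V) :=
  M 0 /\ forall k x y, M x -> M y -> M (k *: x + y).

Definition linear_span (V : lmodType C) (S : set V) : set V := smallest (@linear_subspace V) S.

Context {A : cstarAlgType C} {H : hilbertType C}.

Record representation (pi : A -> {linear H -> H}) : Prop := {
  rep_bounded : forall a, continuous (pi a);
  rep_linear : forall k a b x, pi (k *: a + b) x = k *: pi a x + pi b x;
  rep_mul : forall a b x, pi (cmul a b) x = pi a (pi b x);
  rep_star : forall a x y, hdot (pi (cstar a) x) y = hdot x (pi a y);
  rep_nondegenerate : dense (linear_span [set pi a x | a in setT & x in setT])
}.

Definition irreducible (pi : A -> {linear H -> H}) :=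
  [/\ representation pi, exists x : H, x != 0 &
    forall M : set H, linear_subspace M -> closed M ->
      (forall a x, M x -> M (pi a x)) -> M = [set 0] \/ M = setT].

End representations.

Section groupoid_algebra.
Context {R : realType} {G : topGroupoidType}.
Local Notation C := (cplx R).
Variables (D : set G) (lam : G -> {measure set (borel G) -> \bar R}).

Record Cc_representation (H : hilbertType C)
    (pi : (G -> C) -> {linear H -> H}) : Prop := {
  Cc_rep_linear : forall (k : C) f g x, Cc D f -> Cc D g ->
    pi (fun y => k * f y + g y) x = k *: pi f x + pi g x;
  Cc_rep_mul : forall f g x, Cc D f -> Cc D g ->
    pi (convolution D lam f g) x = pi f (pi g x);
  Cc_rep_star : forall f x y, Cc D f ->
    hdot (pi (involution f) x) y = hdot x (pi f y);
  Cc_rep_Inorm : forall f x, Cc D f ->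
    `|pi f x| <= (fine (Inorm D lam f))%:C * `|x|
}.

(* The greatest C*-seminorm on C_c(D): the supremum of the operator norms of f
   over the *-representations of C_c(D) on Hilbert spaces that are decreasing for
   the I-norm. *)
Definition universal_norm (f : G -> C) : R :=
  sup [set t : R | exists (H : hilbertType C) (pi : (G -> C) -> {linear H -> H})
    (x : H), [/\ Cc_representation pi, `|x| <= 1 & t%:C = `|pi f x|]].

(* [iota : C_c(D) -> A] exhibits A as the C*-algebra of the groupoid D. *)
Record groupoid_cstar_algebra (A : cstarAlgType C) (iota : (G -> C) -> A)
    : Prop := {
  gca_linear : forall (k : C) f g, Cc D f -> Cc D g ->
    iota (fun y => k * f y + g y) = k *: iota f + iota g;
  gca_mul : forall f g, Cc D f -> Cc D g ->
    iota (convolution D lam f g) = cmul (iota f) (iota g);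
  gca_star : forall f, Cc D f -> iota (involution f) = cstar (iota f);
  gca_norm : forall f, Cc D f -> `|iota f| = (universal_norm f)%:C;
  gca_dense : dense [set iota f | f in Cc D]
}.

End groupoid_algebra.

Section induction.
Context {R : realType} {G : topGroupoidType}.
Local Notation C := (cplx R).
Variables (lam : G -> {measure set (borel G) -> \bar R}) (u : G).

Definition source_fiber : set G := sfiber setT u.

(* <phi, psi>_* *)
Definition stab_product (phi psi : G -> C) : G -> C :=
  patch (fun=> 0) (stability u) (fun h =>
    cintegral (source_measure lam u) source_fiber
      (fun y => (phi y)^* * psi (gmul y h))).

(* [Ind] on [H] is the representation of A = C*(G) induced from L: the map
   [tensor] sends (phi, h) to the class of phi (x) h, and exhibits H as the
   Hilbert space completion of the algebraic tensor product of C_c(G_u) and HL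
   for the pre-inner product given by L. *)
Record induced_representation (A B : cstarAlgType C)
    (iota : (G -> C) -> A) (iota_u : (G -> C) -> B)
    (HL : hilbertType C) (L : B -> {linear HL -> HL})
    (H : hilbertType C) (tensor : (G -> C) -> HL -> H)
    (Ind : A -> {linear H -> H}) : Prop := {
  ind_tensor_linearl : forall (k : C) phi psi h,
    Cc source_fiber phi -> Cc source_fiber psi ->
    tensor (fun x => k * phi x + psi x) h = k *: tensor phi h + tensor psi h;
  ind_tensor_linearr : forall (k : C) phi h h', Cc source_fiber phi ->
    tensor phi (k *: h + h') = k *: tensor phi h + tensor phi h';
  ind_dot : forall phi psi h h',
    Cc source_fiber phi -> Cc source_fiber psi ->
    hdot (tensor phi h) (tensor psi h') =
    hdot (L (iota_u (stab_product psi phi)) h) h';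
  ind_dense : dense (linear_span [set tensor phi h | phi in Cc source_fiber & h in setT]);
  ind_representation : representation Ind;
  ind_action : forall f phi h, Cc setT f -> Cc source_fiber phi ->
    Ind (iota f) (tensor phi h) = tensor (convolution setT lam f phi) h
}.

End induction.

(* Main.v *)
Require Import Defs.
From mathcomp Require Import all_boot all_order all_algebra.
From mathcomp Require Import complex.
From mathcomp Require Import all_classical all_reals all_analysis.
From mathcomp Require Import measurable_realfun.
From mathcomp Require Import ring.

(** Write X for the fiber G_u, S for the stability group G(u), and T_phi h for
   the class of phi (x) h. Let M be a closed subspace of the induced space that
   is invariant under C*(G). The point is that M is also invariant under all
   operators T_phi T_psi^*, the rank one operators of the module C_c(X) over
   C_c(S). This is proved in three steps.

   - A continuous S-invariant function b from X to [0, 1] acts on the induced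
     space by multiplication, M_b (phi (x) h) = b phi (x) h. This is a
     contraction because |M_b x|^2 + |M_c x|^2 = |x|^2 for c = sqrt (1 - b^2)
     (mult_graph_bounded). If b is of the form b' o r with b' on the unit space,
     then Ind(f) M_b = Ind(f (b' o s)) for f in C_c(G), and M_b preserves M by
     nondegeneracy (mult_range_invariant).

   - In general b need not be of this form, because the injection of X/S into
     the unit space induced by r need not be a homeomorphism onto its image.
     However, it is one on compact sets (stab_invariant_factor), and a vector of
     the algebraic tensor product only sees a compact set. Hence M_b preserves M
     for all b (mult_invariant).

   - The operator T_phi T_psi^* is given by the kernel K(x, y) = \int_S phi(x t)
     conj(psi(y t)) dt on X x X, which is invariant under the diagonal action of
     S. Since (x, y) |-> x y^-1 is injective modulo this action, and again a
     homeomorphism on compact sets, one finds K(x, y) = b(x) f(x y^-1) b(y) with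
     f in C_c(G) and b invariant (kernel_realization). In other terms T_phi
     T_psi^* = M_b Ind(f) M_b, which preserves M (theta_invariant).

   Now let N be the space of all k such that phi (x) k is in M for all phi. It
   is closed and invariant under L, and it contains T_psi^* M for all psi. As L
   is irreducible, N is 0 or everything. In the first case M is orthogonal to
   all tensors, so M = 0; in the second case M contains all tensors
   (invariant_subspace_trivial).

   It remains to see that the induced space is not 0. The functions <psi, phi>_*
   are dense in C_c(S) for the I-norm (stab_product_approx), so they cannot all
   be annihilated by L (induced_nontrivial).

   Passing from C_c(G) and C_c(S) to the C*-algebras requires that
   representations are bounded for the norm. This is elementary: a self-adjoint
   a of norm at most 3/4 satisfies 1 - a = (1 - b)^2 with b self-adjoint, hence
   <pi(a) x, x> is at most |x|^2 (cstar_sqrt, rep_norm_le). *)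

Set Implicit Arguments.
Unset Strict Implicit.
Unset Printing Implicit Defensive.

Import Order.TTheory GRing.Theory Num.Theory.
Import numFieldNormedType.Exports.

Local Open Scope classical_set_scope.
Local Open Scope ring_scope.

(** * Normed and Hilbert spaces *)

Section metric.
Context {C : numClosedFieldType}.

Lemma approx_closed (V : normedModType C) (M : set V) (x : V) : closed M ->
  (forall e : C, 0 < e -> exists2 y, M y & `|x - y| < e) -> M x.
Proof.
move=> cM h; apply: cM => U; move=> /nbhs_normP[e /= e0 xU].
by have [y My xy] := h _ e0; exists y; split=> //; apply: xU.
Qed.

Lemma dense_approx (V : normedModType C) (M : set V) : dense M ->
  forall (x : V) (e : C), 0 < e -> exists2 y, M y & `|x - y| < e.
Proof.
move=> dM x e e0; have [|y [/= xy My]] := dM (ball x e)° _ (open_interior _).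
  by exists x; apply: nbhsx_ballx.
by exists y => //; move/interior_subset: xy; rewrite -ball_normE.
Qed.

Lemma linear_span_subspace (V : lmodType C) (S : set V) :
  linear_subspace (linear_span S).
Proof.
split=> [T [[]]//|k x y xS yS T [TV ST]].
by apply: TV.2; [apply: xS | apply: yS].
Qed.

Lemma sub_linear_span (V : lmodType C) (S : set V) : S `<=` linear_span S.
Proof. by move=> x Sx T [_]; apply. Qed.

Lemma linear_span_ind (V : lmodType C) (S P : set V) :
  linear_subspace P -> S `<=` P -> linear_span S `<=` P.
Proof. by move=> sP SP x; apply. Qed.

Lemma subspaceD (V : lmodType C) (M : set V) x y :
  linear_subspace M -> M x -> M y -> M (x + y).
Proof. by move=> [_ h] Mx My; rewrite -[x]scale1r; apply: h. Qed.

Lemma subspaceZ (V : lmodType C) (M : set V) k x :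
  linear_subspace M -> M x -> M (k *: x).
Proof. by move=> [M0 h] Mx; rewrite -[_ *: x]addr0; apply: h. Qed.

Lemma subspaceB (V : lmodType C) (M : set V) x y :
  linear_subspace M -> M x -> M y -> M (x - y).
Proof. by move=> sM Mx My; rewrite -scaleN1r addrC; apply: sM.2. Qed.

End metric.

Section complete.
Context {R : realType}.
Local Notation C := (cplx R).

Lemma natC_invS (n : nat) : n.+1%:R^-1 = ((n.+1%:R^-1 : R)%:C)%C :> C.
Proof. by rewrite fmorphV; congr (_^-1); rewrite rmorph_nat. Qed.

Lemma Cgt0P (e : C) : 0 < e -> exists2 r : R, 0 < r & e = (r%:C)%C.
Proof.
case: e => r i; rewrite ltcE /= => /andP[/eqP -> r0]; by exists r.
Qed.

Lemma natC_lt (e : C) : 0 < e -> exists N : nat,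
  forall n, (N <= n)%N -> n.+1%:R^-1 < e :> C.
Proof.
move=> /Cgt0P[r r0 ->].
have [N _ hN] := near_infty_natSinv_lt (PosNum r0).
by exists N => n Nn; rewrite natC_invS ltcR; apply: hN.
Qed.

Lemma cauchy_seq_limit (V : completeNormedModType C) (u : nat -> V) :
  (forall e : C, 0 < e -> exists N, forall n m, (N <= n)%N -> (N <= m)%N ->
     `|u n - u m| < e) ->
  exists l, forall e : C, 0 < e -> exists N, forall n, (N <= n)%N ->
     `|l - u n| < e.
Proof.
move=> h.
have : cvg (u @ \oo).
  apply/cauchy_cvgP/cauchy_exP => e e0; have [N hN] := h _ e0.
  exists (u N); exists N => // n /= Nn.
  by rewrite -ball_normE /=; apply: hN.
move=> cu; exists (lim (u @ \oo)) => e e0.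
by have /cvgrPdist_lt/(_ _ e0)[N _ hN] := cu; exists N => n Nn; apply: hN.
Qed.

(** Bounded operators that are known on a span of tensors only are handled
   through their graphs, as subspaces of the product: no choice of
   representatives is then involved. The images of a sequence of the domain that
   converges to x form a Cauchy sequence, whose limit is the value at x. *)
Lemma bounded_graph_extension (V W : completeNormedModType C)
    (Gam : set (V * W)) (c : C) : 0 <= c -> linear_subspace Gam ->
  (forall p, Gam p -> `|p.2| <= c * `|p.1|) ->
  (forall x (e : C), 0 < e -> exists2 p, Gam p & `|x - p.1| < e) ->
  forall x, exists y, forall e : C, 0 < e ->
    exists2 p, Gam p & `|x - p.1| < e /\ `|y - p.2| < e.
Proof.
move=> c0 sG bG dG x.
have /choice[p hp] : forall n : nat, exists p : V * W,
    Gam p /\ `|x - p.1| < n.+1%:R^-1.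
  by move=> n; have [|p Gp xp] := dG x (n.+1%:R^-1); [rewrite invr_gt0|exists p].
have c1 : 0 < c + 1 by rewrite ltr_wpDl.
have [|y hy] := @cauchy_seq_limit W (fun n => (p n).2).
  move=> e e0; have [|N hN] := @natC_lt (e / 2 / (c + 1)).
    by rewrite !divr_gt0.
  exists N => n m Nn Nm.
  have := bG _ (subspaceB sG (hp n).1 (hp m).1) => /= /le_lt_trans; apply.
  have -> : (p n).1 - (p m).1 = (x - (p m).1) - (x - (p n).1).
    by rewrite opprB [RHS]addrC addrA subrK.
  apply: (@le_lt_trans _ _ ((c + 1) * (`|x - (p m).1| + `|x - (p n).1|))).
    by apply: ler_pM => //; rewrite ?lerDl ?ler_normB.
  have a j : (N <= j)%N -> (c + 1) * `|x - (p j).1| < e / 2.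
    by move=> Nj; rewrite mulrC -ltr_pdivlMr // (lt_trans (hp j).2) // hN.
  by rewrite [ltRHS]splitr mulrDr ltrD ?a.
exists y => e e0; have [N hN] := hy _ e0; have [N' hN'] := natC_lt e0.
exists (p (maxn N N')); first by case: (hp (maxn N N')).
split; last by apply: hN; rewrite leq_maxl.
by apply: lt_trans (hN' (maxn N N') _); [case: (hp (maxn N N'))|rewrite leq_maxr].
Qed.

End complete.

Section hilbert.
Context {R : realType}.
Local Notation C := (cplx R).
Context {H : hilbertType C}.
Implicit Types x y z : H.

Lemma hdotC x y : hdot x y = (hdot y x)^*.
Proof. by rewrite hermC expr0 mul1r. Qed.

Lemma hdotDl x y z : hdot (x + y) z = hdot x z + hdot y z.
Proof. exact: linearDl. Qed.
Lemma hdotBl x y z : hdot (x - y) z = hdot x z - hdot y z.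
Proof. exact: linearBl. Qed.
Lemma hdotZl k x z : hdot (k *: x) z = k * hdot x z.
Proof. exact: linearZl_LR. Qed.
Lemma hdotDr x y z : hdot z (x + y) = hdot z x + hdot z y.
Proof. exact: linearDr. Qed.
Lemma hdotBr x y z : hdot z (x - y) = hdot z x - hdot z y.
Proof. exact: linearBr. Qed.
Lemma hdotZr k x z : hdot z (k *: x) = k^* * hdot z x.
Proof. exact: linearZr_LR. Qed.
Lemma hdot0l x : hdot 0 x = 0. Proof. exact: linear0l. Qed.
Lemma hdot0r x : hdot x 0 = 0. Proof. exact: linear0r. Qed.

Lemma hdotD x y : `|x + y| ^+ 2 = `|x| ^+ 2 + `|y| ^+ 2 + (hdot x y + (hdot x y)^*).
Proof. by rewrite -!hdot_norm dnormD. Qed.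

Lemma hdotB x y : `|x - y| ^+ 2 = `|x| ^+ 2 + `|y| ^+ 2 - (hdot x y + (hdot x y)^*).
Proof. by rewrite -!hdot_norm dnormB. Qed.

Lemma hdot_cauchy_schwarz x y : `|hdot x y| <= `|x| * `|y|.
Proof.
have [->|y0] := eqVneq y 0; first by rewrite hdot0r !normr0 mulr0.
have ny : `|y| != 0 by rewrite normr_eq0.
have ny0 : 0 < `|y| by rewrite normr_gt0.
set a := hdot x y / `|y| ^+ 2.
have o : hdot (x - a *: y) y = 0.
  by rewrite hdotBl hdotZl hdot_norm divfK ?subrr // expf_neq0.
have -> : x = (x - a *: y) + a *: y by rewrite subrK.
set z := x - _ in o *.
rewrite hdotDl o add0r hdotZl hdot_norm normrM normrX !normr_id expr2 mulrA ler_pM2r //.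
rewrite -(@ler_pXn2r _ 2) ?nnegrE // ?mulr_ge0 //.
rewrite hdotD hdotZr o mulr0 conjC0 addr0 addr0 (normrZ a y) lerDr.
by rewrite exprn_ge0.
Qed.

Lemma parallelogram x y :
  `|x + y| ^+ 2 + `|x - y| ^+ 2 = 2 * `|x| ^+ 2 + 2 * `|y| ^+ 2.
Proof. rewrite hdotD hdotB; ring. Qed.

Lemma dense_orthogonal (S : set H) x : dense (linear_span S) ->
  (forall y, S y -> hdot x y = 0) -> x = 0.
Proof.
move=> dS h.
have h' : linear_span S `<=` [set y | hdot x y = 0].
  apply: linear_span_ind => //; split=> [|k y z /= hy hz]; first exact: hdot0r.
  by rewrite hdotDr hdotZr hy hz mulr0 addr0.
apply: contrapT => /eqP x0; have nx0 : 0 < `|x| by rewrite normr_gt0.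
have [y /h' /= xy0 xy] := dense_approx dS x nx0.
have := hdot_cauchy_schwarz x (x - y).
rewrite hdotBr xy0 subr0 hdot_norm normrX normr_id expr2 ler_pM2l //.
by move=> /le_lt_trans /(_ xy); rewrite ltxx.
Qed.

(** A minimizing sequence for the distance from x to M is Cauchy by the
   parallelogram law. Its limit m is orthogonal to M: if x - m had a nonzero
   inner product with y, moving m along y would decrease the distance. *)
Lemma orthogonal_projection (M : set H) (x : H) :
  linear_subspace M -> closed M -> exists2 m, M m & forall y, M y -> hdot (x - m) y = 0.
Proof.
move=> sM cM.
pose E := [set complex.Re (`|x - m| ^+ 2) | m in M].
have nE m : ((complex.Re (`|x - m| ^+ 2))%:C)%C = `|x - m| ^+ 2.
  by apply: RRe_real; rewrite ger0_real // exprn_ge0.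
have lE : has_lbound E.
  by exists 0 => _ [m _ <-]; rewrite -lecR nE exprn_ge0.
have iE : has_inf E by split=> //; exists (complex.Re (`|x - 0| ^+ 2)), 0 => //; exact: sM.1.
pose d : C := (inf E)%:C%C.
have dM m : M m -> d <= `|x - m| ^+ 2.
  by move=> Mm; rewrite -nE lecR; apply: ge_inf => //; exists m.
have aM (e : C) : 0 < e -> exists2 m, M m & `|x - m| ^+ 2 < d + e.
  move=> /Cgt0P[r r0 ->]; have [_ [m Mm <-] mr] := inf_adherent r0 iE.
  by exists m => //; rewrite -nE -rmorphD ltcR.
have para m n : M m -> M n ->
    `|m - n| ^+ 2 <= 2 * (`|x - m| ^+ 2 - d) + 2 * (`|x - n| ^+ 2 - d).
  move=> Mm Mn; have := parallelogram (x - m) (x - n).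
  have -> : x - m - (x - n) = - (m - n) by rewrite opprB addrC addrA subrK opprB.
  have -> : x - m + (x - n) = 2 *: (x - 2^-1 *: (m + n)).
    rewrite scalerBr scalerA divff ?pnatr_eq0 // scale1r scaler_nat mulr2n.
    by rewrite addrACA opprD.
  rewrite normrN normrZ ger0_norm // exprMn => e.
  have /dM := subspaceZ 2^-1 sM (subspaceD sM Mm Mn).
  set t := `|x - _ *: _| ^+ 2 in e *.
  rewrite -subr_ge0 => td; rewrite -subr_ge0.
  have -> : 2 * (`|x - m| ^+ 2 - d) + 2 * (`|x - n| ^+ 2 - d) - `|m - n| ^+ 2 =
     4 * (t - d) + (2 * `|x - m| ^+ 2 + 2 * `|x - n| ^+ 2 - (2 ^+ 2 * t + `|m - n| ^+ 2)).
    by rewrite expr2; ring.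
  by rewrite e subrr addr0 mulr_ge0.
have /choice[p hp] : forall n : nat, exists m, M m /\ `|x - m| ^+ 2 < d + n.+1%:R^-1.
  by move=> n; have [|p Gp xp] := aM (n.+1%:R^-1); [rewrite invr_gt0|exists p].
have [|m hm] := @cauchy_seq_limit _ H p.
  move=> e e0; have [|N hN] := @natC_lt _ (e ^+ 2 / 4).
    by rewrite !divr_gt0 // exprn_gt0.
  exists N => n k Nn Nk.
  rewrite -(@ltr_pXn2r _ 2) ?nnegrE ?normr_ge0 ?(ltW e0) //.
  apply: (le_lt_trans (para _ _ (hp n).1 (hp k).1)).
  have a j : (N <= j)%N -> 2 * (`|x - p j| ^+ 2 - d) < e ^+ 2 / 2.
    move=> Nj; have -> : e ^+ 2 / 2 = 2 * (e ^+ 2 / 4) by field.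
    rewrite ltr_pM2l // ltrBlDl; apply: lt_trans (hp j).2 _.
    by rewrite ltrD2l hN.
  by rewrite [ltRHS]splitr ltrD ?a.
have Mm : M m.
  by apply: (approx_closed cM) => e e0; have [N /(_ N (leqnn _))] := hm _ e0; exists (p N) => //; case: (hp N).
exists m => // y My; apply: contrapT => /eqP t0.
have [y0|y0] := eqVneq y 0; first by rewrite y0 hdot0r eqxx in t0.
set t := `|hdot (x - m) y|; have {}t0 : 0 < t by rewrite normr_gt0.
have ny0 : 0 < `|y| by rewrite normr_gt0.
have [|N hN] := hm (t / 2 / `|y|); first by rewrite !divr_gt0.
have [|N' hN'] := @natC_lt _ ((t / 2 / `|y|) ^+ 2).
  by rewrite exprn_gt0 // !divr_gt0.
set n := maxn N N'.
have {}hN := hN n (leq_maxl _ _); have {}hN' := hN' n (leq_maxr _ _).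
have [Mn xn] := hp n; set z := p n in hN xn Mn.
set a := hdot (x - z) y / `|y| ^+ 2.
have dz : d <= `|x - (z + a *: y)| ^+ 2 by apply: dM; apply: subspaceD => //; apply: subspaceZ.
have ez : `|x - (z + a *: y)| ^+ 2 = `|x - z| ^+ 2 - (`|hdot (x - z) y| / `|y|) ^+ 2.
  have nyC : `|y|^* = `|y| by apply/CrealP; rewrite ger0_real.
  have ny : `|y| != 0 by rewrite gt_eqF.
  rewrite opprD addrA (hdotB (x - z) (a *: y)) hdotZr (normrZ a y) /a normrM normfV normrX normr_id.
  set w := hdot (x - z) y; rewrite !rmorphM !fmorphV !rmorphXn /= !nyC conjCK.
  set r := `|y| in ny *; rewrite !exprMn normCK.
  by field.
have : `|hdot (x - z) y| / `|y| < t / 2 / `|y|.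
  rewrite -(@ltr_pXn2r _ 2) ?nnegrE // ?divr_ge0 // ?normr_ge0 //.
  apply: le_lt_trans hN'.
  rewrite ez in dz; rewrite -(lerD2l d); apply: le_trans (ltW xn).
  by rewrite -lerBrDr.
rewrite ltr_pM2r ?invr_gt0 // => h1.
have h2 : `|hdot (m - z) y| < t / 2.
  by apply: le_lt_trans (hdot_cauchy_schwarz _ _) _; rewrite -ltr_pdivlMr.
have : t < t.
  rewrite [ltRHS]splitr; apply: le_lt_trans (ltrD h1 h2).
  apply: le_trans (ler_normB _ _); rewrite -hdotBl.
  by rewrite opprB addrA subrK.
by rewrite ltxx.
Qed.
End hilbert.

(** * Representations of C*-algebras *)

Section cstar.
Context {R : realType}.
Local Notation C := (cplx R).
Context {A : cstarAlgType C}.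
Implicit Types a b c : A.

Lemma cmulBl a b c : cmul (a - b) c = cmul a c - cmul b c.
Proof. by rewrite addrC -scaleN1r cmul_linearl scaleN1r addrC. Qed.
Lemma cmulBr a b c : cmul a (b - c) = cmul a b - cmul a c.
Proof. by rewrite addrC -scaleN1r cmul_linearr scaleN1r addrC. Qed.
Lemma cstarB a b : cstar (a - b) = cstar a - cstar b.
Proof. by rewrite addrC -scaleN1r cstar_linear rmorphN1 scaleN1r addrC. Qed.
Lemma cstarD a b : cstar (a + b) = cstar a + cstar b.
Proof. by rewrite -{1}[a]scale1r cstar_linear conjC1 scale1r. Qed.
Lemma cstarZ k a : cstar (k *: a) = k^* *: cstar a.
Proof.
have c0 : cstar (0 : A) = 0.
  by have := cstarB 0 0; rewrite !subrr.
by rewrite -{1}[k *: a]addr0 cstar_linear c0 addr0.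
Qed.

Lemma norm_cstar a : `|cstar a| = `|a|.
Proof.
have le b : `|b| <= `|cstar b|.
  have [->|b0] := eqVneq b 0; first by rewrite normr0.
  have := cmul_norm (cstar b) b; rewrite cstar_norm expr2 ler_pM2r //.
  by rewrite normr_gt0.
by apply/le_anti; rewrite le andbT -{2}[a]cstarK le.
Qed.

(** The element b is 1 - sqrt (1 - a), whose power series in a has no constant
   term, so that no unit is needed. It is obtained as the fixed point of b |->
   (a + b b) / 2, a contraction of the ball of radius 1/2. *)
Lemma cstar_sqrt a : cstar a = a -> `|a| <= 3 / 4 ->
  exists b, cstar b = b /\ a = 2 *: b - cmul b b.
Proof.
move=> sa na.
pose F b := 2^-1 *: (a + cmul b b).
have Fhalf b : `|b| <= 2^-1 -> `|F b| <= 2^-1.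
  move=> b2; rewrite normrZ ger0_norm ?invr_ge0 // ler_piMr ?invr_ge0 //.
  apply: le_trans (ler_normD _ _) _.
  have -> : 1 = 3 / 4 + 2^-1 * 2^-1 :> C by field.
  by rewrite lerD // (le_trans (cmul_norm _ _)) // ler_pM.
have Fcontr b c : `|b| <= 2^-1 -> `|c| <= 2^-1 -> `|F b - F c| <= 2^-1 * `|b - c|.
  move=> b2 c2; rewrite -scalerBr normrZ ger0_norm ?invr_ge0 // ler_pM2l ?invr_gt0 //.
  have -> : a + cmul b b - (a + cmul c c) = cmul b (b - c) + cmul (b - c) c.
    by rewrite cmulBr cmulBl subrKA opprD addrACA subrr add0r.
  apply: le_trans (ler_normD _ _) _.
  apply: (@le_trans _ _ (2^-1 * `|b - c| + `|b - c| * 2^-1)).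
    by rewrite lerD // (le_trans (cmul_norm _ _)) // ler_pM.
  by rewrite [2^-1 * _]mulrC -splitr.
pose u n := iter n F 0.
have u2 n : `|u n| <= 2^-1 by elim: n => [|n ih]; [rewrite normr0 invr_ge0|exact: Fhalf].
have uN N n m : `|u (N + n)%N - u (N + m)%N| <= 2^-1 ^+ N.
  elim: N => [|N ih].
    rewrite !add0n expr0; apply: le_trans (ler_normB _ _) _.
    by rewrite [leRHS](_ : 1 = 2^-1 + 2^-1) ?lerD //; field.
  rewrite !addSn /u !iterS -/(u _) -/(u _) exprS.
  by apply: le_trans (Fcontr _ _ _ _) _; rewrite ?u2 // ler_pM2l ?invr_gt0.
have p2 N : (2^-1 : C) ^+ N <= N.+1%:R^-1.
  rewrite exprVn lef_pV2 ?posrE ?exprn_gt0 ?ltr0n // -natrX ler_nat.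
  exact: ltn_expl.
have [|b hb] := @cauchy_seq_limit _ A u.
  move=> e e0; have [N hN] := natC_lt e0; exists N => n m Nn Nm.
  rewrite -(subnKC Nn) -(subnKC Nm); apply: le_lt_trans (uN _ _ _) _.
  exact: le_lt_trans (p2 _) (hN _ (leqnn _)).
have b2 : `|b| <= 2^-1.
  apply/ler_addgt0Pr => e e0; have [N /(_ _ (leqnn _)) h] := hb _ e0.
  rewrite -[b](subrK (u N)) addrC; apply: le_trans (ler_normD _ _) _.
  by rewrite lerD // ltW.
have Fb : F b = b.
  apply/eqP; rewrite -subr_eq0 -normr_le0; apply/ler_addgt0Pr => e e0; rewrite add0r.
  have e2 : 0 < e / 2 by rewrite divr_gt0.
  have [N h] := hb _ e2.
  rewrite -[F b](subrK (u N.+1)) -addrA; apply: le_trans (ler_normD _ _) _.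
  rewrite [leRHS]splitr lerD //; last by rewrite distrC ltW // h.
  apply: le_trans (Fcontr _ _ _ _) _; rewrite ?u2 //.
  by rewrite (le_trans _ (ltW (h _ (leqnn _)))) // ler_piMl // invf_le1 // ler1n.
exists b; split; last first.
  by rewrite -{1}Fb scalerA divff ?pnatr_eq0 // scale1r addrK.
have Fsb : F (cstar b) = cstar b.
  rewrite -{2}Fb /F cstarZ cstarD cstarM sa; congr (_ *: _).
  by apply/esym/CrealP; rewrite realV realn.
apply/eqP; rewrite -subr_eq0 -normr_le0.
have := Fcontr _ _ (_ : `|cstar b| <= _) b2; rewrite norm_cstar => /(_ b2).
rewrite Fsb Fb -subr_ge0 -[X in _ - X]mul1r -mulrBl.
by rewrite (_ : 2^-1 - 1 = - 2^-1) ?mulNr ?oppr_ge0 ?pmulr_rle0 ?invr_gt0 //; field.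
Qed.

Variables (H : hilbertType C) (pi : A -> {linear H -> H}).
Hypothesis rep_pi : representation pi.

Lemma repB a b x : pi (a - b) x = pi a x - pi b x.
Proof. by rewrite addrC -scaleN1r (rep_linear rep_pi) scaleN1r addrC. Qed.
Lemma rep0 x : pi 0 x = 0.
Proof. by have := repB 0 0 x; rewrite !subrr. Qed.
Lemma repZ k a x : pi (k *: a) x = k *: pi a x.
Proof. by rewrite -{1}[k *: a]addr0 (rep_linear rep_pi) rep0 addr0. Qed.

(** Writing 1 - a = (1 - b)^2 with b self-adjoint, the difference of the two
   sides is the squared norm of x - pi(b) x. *)
Lemma rep_contract_selfadjoint a x : cstar a = a -> `|a| <= 3 / 4 ->
  hdot (pi a x) x <= `|x| ^+ 2.
Proof.
move=> sa na; have [b [sb ->]] := cstar_sqrt sa na.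
have sym : hdot x (pi b x) = hdot (pi b x) x by rewrite -(rep_star rep_pi) sb.
rewrite -subr_ge0.
suff -> : `|x| ^+ 2 - hdot (pi (2 *: b - cmul b b) x) x = `|x - pi b x| ^+ 2.
  exact: exprn_ge0.
rewrite hdotB -hdotC sym -[`|pi b x| ^+ 2]hdot_norm -(rep_star rep_pi) sb.
rewrite -(rep_mul rep_pi) repB repZ hdotBl hdotZl; ring.
Qed.

(** A representation is a contraction, but any constant will do below, and this
   one comes cheaply: apply the bound for self-adjoint elements to the multiple
   of a^* a that has norm 3/4. *)
Lemma rep_norm_le a x : `|pi a x| <= 2 * `|a| * `|x|.
Proof.
have [->|a0] := eqVneq a 0; first by rewrite rep0 !normr0 mulr0 mul0r.
have na0 : 0 < `|a| by rewrite normr_gt0.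
rewrite -(@ler_pXn2r _ 2) ?nnegrE // ?mulr_ge0 //.
pose s : C := 3 / 4 / `|a| ^+ 2.
have s0 : 0 < s by rewrite !divr_gt0 // exprn_gt0.
have := @rep_contract_selfadjoint (s *: cmul (cstar a) a) x.
rewrite cstarZ cstarM cstarK (CrealP (ger0_real (ltW s0))) => /(_ erefl).
rewrite normrZ cstar_norm (ger0_norm (ltW s0)) divfK ?expf_neq0 ?gt_eqF // => /(_ (lexx _)).
rewrite repZ (rep_mul rep_pi) hdotZl (rep_star rep_pi) hdot_norm /s => h.
rewrite !exprMn -(@ler_pM2l _ s) //; apply: le_trans h _.
have -> : s * (2 ^+ 2 * `|a| ^+ 2 * `|x| ^+ 2) = 3 * `|x| ^+ 2.
  by rewrite /s; field; rewrite gt_eqF.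
by rewrite ler_peMl ?exprn_ge0 // ler1n.
Qed.

Lemma rep_dense_invariant (S : set A) (M : set H) x : dense S -> closed M ->
  (forall a, S a -> M (pi a x)) -> forall a, M (pi a x).
Proof.
move=> dS cM h a; apply: (approx_closed cM) => e e0.
have x1 : 0 < 2 * (`|x| + 1) by rewrite mulr_gt0 // ltr_wpDl.
have [|b Sb ab] := dense_approx dS a (e := e / (2 * (`|x| + 1))).
  by rewrite divr_gt0.
exists (pi b x); first exact: h.
rewrite -repB; apply: le_lt_trans (rep_norm_le _ _) _.
rewrite ltr_pdivlMr // mulrCA mulrA in ab.
by apply: le_lt_trans ab; rewrite ler_wpM2l ?mulr_ge0 // lerDl.
Qed.

(** This is nondegeneracy of the quotient of H by M: the component of x
   orthogonal to M is annihilated by pi(A), hence orthogonal to the dense span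
   of pi(A) H. *)
Lemma rep_nondegenerate_mem (M : set H) (x : H) : linear_subspace M ->
  closed M -> (forall a y, M y -> M (pi a y)) -> (forall a, M (pi a x)) -> M x.
Proof.
move=> sM cM iM xM; have [m Mm om] := orthogonal_projection x sM cM.
suff : x - m = 0 by move/eqP; rewrite subr_eq0 => /eqP ->.
apply: (dense_orthogonal (rep_nondegenerate rep_pi)) => _ [a _ [y _ <-]].
rewrite -(rep_star rep_pi).
suff -> : pi (cstar a) (x - m) = 0 by rewrite hdot0l.
apply/eqP; rewrite -normr_eq0 -sqrf_eq0 -hdot_norm (rep_star rep_pi).
apply/eqP/om/iM; rewrite linearB; apply: subspaceB => //; exact: iM.
Qed.

End cstar.

(** * Continuity on subsets and locally compact spaces *)

Section continuity_within.
Context {X Y Z : topologicalType}.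

Lemma within_comp (A : set X) (B : set Y) (p : X -> Y) (f : Y -> Z) :
  {within A, continuous p} -> (forall x, A x -> B (p x)) ->
  {within B, continuous f} -> {within A, continuous (fun x => f (p x))}.
Proof.
move=> /subspace_continuousP cp AB /subspace_continuousP cf.
apply/subspace_continuousP => x Ax.
apply: cvg_trans (cf _ (AB _ Ax)) => U; rewrite /= !nbhs_simpl /= => h.
have := cp _ Ax _ h; rewrite /= !nbhs_simpl /within /=.
by apply: filterS => y /[swap] Ay /(_ Ay); apply; exact: AB.
Qed.

Lemma within_compT (A : set X) (p : X -> Y) (f : Y -> Z) :
  {within A, continuous p} -> continuous f ->
  {within A, continuous (fun x => f (p x))}.
Proof.
by move=> cp cf x; apply: continuous_comp; [exact: cp|exact: cf].
Qed.

Lemma within_pair (A : set X) (f : X -> Y) (g : X -> Z) :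
  {within A, continuous f} -> {within A, continuous g} ->
  {within A, continuous (fun x => (f x, g x))}.
Proof. by move=> cf cg x; apply: cvg_pair; [exact: cf|exact: cg]. Qed.

Lemma within_id (A : set X) : {within A, continuous (fun x : X => x)}.
Proof. by apply: continuous_subspaceT => x; exact: cvg_id. Qed.

Lemma within_cst (A : set X) (y : Y) : {within A, continuous (fun=> y)}.
Proof. by move=> x; exact: cvg_cst. Qed.

Lemma within_eq (A : set X) (f g : X -> Y) : (forall x, A x -> f x = g x) ->
  {within A, continuous f} -> {within A, continuous g}.
Proof.
move=> fg; apply: subspace_eq_continuous => x /set_mem Ax; exact: fg.
Qed.

(** A continuous map from a compact space to a Hausdorff space is closed, hence
   a quotient map onto its image. This is what turns a function that is constant
   on the fibers of p into a continuous function on the image. *)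
Lemma compact_quotient (K : set X) (p : X -> Y) (g : Y -> Z) :
  hausdorff_space Y -> compact K -> {within K, continuous p} ->
  {within K, continuous (fun x => g (p x))} -> {within p @` K, continuous g}.
Proof.
move=> hY cK cp cgp; apply/continuous_closedP => F cF; apply/closed_subspaceP.
have [V cV eV] : exists2 V, closed V & V `&` K = (fun x => g (p x)) @^-1` F `&` K.
  apply/(@closed_subspaceP _ K).
  by move/continuous_closedP : cgp => /(_ F cF).
exists (p @` (V `&` K)).
  apply: compact_closed => //; apply: continuous_compact; last first.
    by rewrite setIC; apply: compact_closedI.
  by apply: continuous_subspaceW cp => x [].
apply/seteqP; split=> [_ [[x Vx <-] [z Kz zx]]|y [Fy [x Kx xy]]].
  by move: Vx; rewrite eV => -[Fx Kx]; split => //; exists x.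
by split; [exists x => //; rewrite eV; split=> //=; rewrite xy|exists x].
Qed.

End continuity_within.

Section locally_compact_spaces.
Context {R : realType} {X : topologicalType}.
Hypothesis hX : hausdorff_space X.
Hypothesis lX : locally_compact [set: X].

Local Notation opc := (one_point_compactification X).

(** Urysohn and Tietze apply to the one-point compactification, which is compact
   and Hausdorff, hence normal. *)
Lemma opc_normal : normal_space opc.
Proof.
apply: compact_normal; first exact: one_point_compactification_hausdorff.
exact: one_point_compactification_compact.
Qed.

(** Each point of K has a compact neighborhood. The passage to finitely many of
   them is made by the filter of all sets that contain a given compact set,
   which is a filter because a union of two compact sets is compact. *)
Lemma compact_interior_neighborhood (K : set X) : compact K ->
  exists2 C, compact C & K `<=` C°.
Proof.
move=> /compact_near_coveringP cK.
pose F : set_system (set X) := filter_from compact (fun C => [set C' | C `<=` C']).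
have FF : Filter F.
  apply: filter_from_filter; first by exists set0; exact: compact0.
  move=> C D cC cD; exists (C `|` D); first exact: compactU.
  by move=> E h; split=> x hx; apply: h; [left|right].
have [x Kx|C cC hC] := cK _ F (fun C x => C° x) FF.
  have [U] := lX I (x := x); rewrite withinET => xU [cU _].
  exists (U°, [set C | U `<=` C]) => /=; first by split; [exact: nbhs_interior|exists U].
  by move=> [y D] /= [Uy UD]; exact: (interiorS UD).
by exists C => //; apply: hC.
Qed.

(** Urysohn in the one-point compactification. The complement of the open set
   contains the point at infinity, and shrinking V to the interior of a compact
   neighborhood of K makes the support compact. *)
Lemma cutoff (K V : set X) : compact K -> open V -> K `<=` V ->
  exists f : X -> R, [/\ continuous f, forall x, 0 <= f x <= 1,
    forall x, K x -> f x = 1, forall x, ~ V x -> f x = 0 &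
    exists2 C, compact C & forall x, ~ C x -> f x = 0].
Proof.
move=> cK oV KV; have [C cC KC] := compact_interior_neighborhood cK.
have [||||f [cf f0 f1 rf]] := @urysohn_ext_itv opc R opc_normal
    (~` (Some @` (V `&` C°))) (Some @` K) 0 1.
- apply/open_closedC/one_point_compactification_open_some.
  by apply: openI => //; exact: open_interior.
- apply: compact_closed; first exact: one_point_compactification_hausdorff.
  apply: continuous_compact => //; apply: continuous_subspaceT.
  exact: one_point_compactification_some_continuous.
- apply/seteqP; split=> // o [h [x Kx xo]]; apply: h; rewrite -xo.
  by exists x => //; split; [exact: KV|exact: KC].
- exact: ltr01.
have z x : ~ (V `&` C°) x -> f (Some x) = 0.
  by move=> h; apply: f0; exists (Some x) => // -[y hy [yx]]; apply: h; rewrite -yx.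
exists (f \o Some); split.
- by move=> x; apply: continuous_comp; [exact: one_point_compactification_some_continuous|exact: cf].
- by move=> x; have := rf (f (Some x)); rewrite /= in_itv; apply; exists (Some x).
- by move=> x Kx; apply: f1; exists (Some x) => //; exists x.
- by move=> x Vx; apply: z => -[].
- by exists C => // x Cx; apply: z => -[_ /interior_subset].
Qed.

(** Q stays compact, hence closed, in the one-point compactification, where
   Tietze applies. *)
Lemma tietze_compact (Q : set X) (k : X -> R) (M : R) : compact Q -> 0 < M ->
  {within Q, continuous k} -> (forall x, Q x -> `|k x| <= M) ->
  exists f : X -> R, [/\ continuous f, forall x, Q x -> f x = k x &
    forall x, `|f x| <= M].
Proof.
move=> cQ M0 ck kM.
pose k' (o : opc) : R := if o is Some x then k x else 0.
have cS : continuous (Some : X -> opc) by exact: one_point_compactification_some_continuous.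
have hO := one_point_compactification_hausdorff lX hX.
have cQ' : compact ((Some : X -> opc) @` Q).
  by apply: continuous_compact => //; apply: continuous_subspaceT.
have [||f [fk cf fM]] := @continuous_bounded_extension opc R opc_normal _ (compact_closed hO cQ') k' M M0.
- by apply: compact_quotient => //; exact: continuous_subspaceT.
- by move=> _ [x Qx <-]; exact: kM.
exists (f \o Some); split => [x|x Qx|x] /=; last exact: fM.
  by apply: continuous_comp; [exact: cS|exact: cf].
by rewrite -fk // inE; exists x.
Qed.

Lemma compact_fun_bounded (Q : set X) (k : X -> R) : compact Q ->
  {within Q, continuous k} -> exists2 M : R, 0 < M & forall x, Q x -> `|k x| <= M.
Proof.
move=> cQ ck; have := continuous_compact ck cQ.
move=> /compact_bounded[M [_ hM]]; exists (`|M| + 1); first by rewrite ltr_wpDl.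
by move=> x Qx; apply: (hM (`|M| + 1)); [rewrite (le_lt_trans (ler_norm _)) // ltrDl|exists x].
Qed.

Lemma within_closed_of_compact {Y : topologicalType} (E : set X) (f : X -> Y) :
  closed E -> (forall Q, compact Q -> Q `<=` E -> {within Q, continuous f}) ->
  {within E, continuous f}.
Proof.
move=> cE h; apply/subspace_continuousP => x Ex.
have [C cC] := compact_interior_neighborhood (@compact_set1 _ x).
move=> /(_ x erefl) Cx.
have /subspace_continuousP/(_ x) := h (C `&` E) (compact_closedI cC cE) (@subIsetr _ _ _).
move=> /(_ (conj (interior_subset Cx) Ex)) fx U /fx.
rewrite /= !nbhs_simpl /within /= => hU.
by apply: filterS2 hU (Cx : nbhs x C) => y hy Cy Ey; exact: hy.
Qed.

End locally_compact_spaces.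

(** * Complex-valued functions *)

Section complex_functions.
Context {R : realType}.
Local Notation C := (cplx R).

Lemma normc_real (r : R) : `|(r%:C)%C : C| = (`|r|%:C)%C.
Proof. by rewrite normc_def /= expr0n addr0 sqrtr_sqr. Qed.

Lemma normc_ge_Im (x : C) : (`|complex.Im x|%:C)%C <= `|x|.
Proof.
by rewrite normc_def lecR -sqrtr_sqr ler_wsqrtr // lerDr sqr_ge0.
Qed.

Lemma normc_le_ReIm (x : C) : `|x| <= ((`|complex.Re x| + `|complex.Im x|)%:C)%C.
Proof.
rewrite normc_def lecR -[leRHS]ger0_norm ?addr_ge0 // -[leRHS]sqrtr_sqr ler_wsqrtr //.
rewrite sqrrD !real_normK ?num_real // -addrA [X in _ <= _ + X]addrC addrA lerDl.
by rewrite mulrn_wge0 // mulr_ge0.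
Qed.

Lemma Re_continuous : continuous (fun x : C => complex.Re x).
Proof.
move=> x; apply/(@cvgrPdist_lt R R _ _ (nbhs_filter (x : C))) => e e0.
have e0' : 0 < (e%:C)%C :> C by rewrite ltcR.
near=> y; rewrite -ltcR -[_ - _](raddfB (@complex.Re R : Rcomplex R -> R)).
apply: le_lt_trans (normc_ge_Re _) _.
by near: y; apply: (@cvgr_dist_lt _ C); [exact: cvg_id|].
Unshelve. all: by end_near. Qed.

Lemma Im_continuous : continuous (fun x : C => complex.Im x).
Proof.
move=> x; apply/(@cvgrPdist_lt R R _ _ (nbhs_filter (x : C))) => e e0.
have e0' : 0 < (e%:C)%C :> C by rewrite ltcR.
near=> y; rewrite -ltcR -[_ - _](raddfB (@complex.Im R : Rcomplex R -> R)).
apply: le_lt_trans (normc_ge_Im _) _.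
by near: y; apply: (@cvgr_dist_lt _ C); [exact: cvg_id|].
Unshelve. all: by end_near. Qed.

Lemma RtoC_continuous : continuous (fun r : R => (r%:C)%C : C).
Proof.
move=> x; apply/(@cvgrPdist_lt C C _ _ (nbhs_filter (x : R))) => e /Cgt0P[r r0 ->].
near=> y; rewrite -rmorphB normc_real ltcR.
by near: y; apply: (@cvgr_dist_lt _ R); [exact: cvg_id|].
Unshelve. all: by end_near. Qed.

Context {X : topologicalType}.
Implicit Types (A : set X) (f g : X -> C).

Lemma within_mulC A f g : {within A, continuous f} -> {within A, continuous g} ->
  {within A, continuous (fun x => f x * g x)}.
Proof. by move=> cf cg x; apply: cvgM; [exact: cf|exact: cg]. Qed.

Lemma within_addC A f g : {within A, continuous f} -> {within A, continuous g} ->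
  {within A, continuous (fun x => f x + g x)}.
Proof. by move=> cf cg x; apply: cvgD; [exact: cf|exact: cg]. Qed.

Lemma within_Re A f : {within A, continuous f} -> {within A, continuous (fun x => complex.Re (f x))}.
Proof. by move=> cf; apply: within_compT cf Re_continuous. Qed.

Lemma within_Im A f : {within A, continuous f} -> {within A, continuous (fun x => complex.Im (f x))}.
Proof. by move=> cf; apply: within_compT cf Im_continuous. Qed.

Lemma within_RtoC A (f : X -> R) : {within A, continuous f} -> {within A, continuous (fun x => (f x)%:C%C : C)}.
Proof. by move=> cf; apply: within_compT cf RtoC_continuous. Qed.

Lemma within_ReIm A (f g : X -> R) : {within A, continuous f} -> {within A, continuous g} ->
  {within A, continuous (fun x => (f x +i* g x)%C : C)}.
Proof.
move=> cf cg; apply: (@within_eq _ _ _ (fun x => (f x)%:C%C + 'i%C * (g x)%:C%C : C)).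
  by move=> x _; rewrite [RHS]complexE.
by apply: within_addC; [|apply: within_mulC; [exact: within_cst|]]; exact: within_RtoC.
Qed.

Lemma within_conj A f : {within A, continuous f} -> {within A, continuous (fun x => (f x)^*)}.
Proof.
move=> cf; apply: (@within_eq _ _ _ (fun x => (complex.Re (f x) +i* - complex.Im (f x))%C : C)).
  by move=> x _; case: (f x).
apply: within_ReIm; first exact: within_Re.
by move=> x; apply: cvgN; exact: within_Im.
Qed.

End complex_functions.

(** * Topological groupoids *)

Section groupoid_algebra.
Context {G : groupoidType}.
Implicit Types x y z : G.

Lemma grng_rng x : grng (grng x) = grng x.
Proof. by rewrite -{1}[grng x]gsrc_rng grng_src gsrc_rng. Qed.
Lemma unit_rng (u : G) : units u -> grng u = u.
Proof. by move=> [x _ <-]; exact: grng_rng. Qed.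
Lemma unit_src (u : G) : units u -> gsrc u = u.
Proof. by move=> [x _ <-]; exact: gsrc_rng. Qed.
Lemma gmulKg x y : gsrc x = grng y -> gmul (ginv x) (gmul x y) = y.
Proof. by move=> xy; rewrite gmulA ?gsrcV // gmulVg xy gmul1g. Qed.
Lemma gmulVKg x y : grng x = grng y -> gmul x (gmul (ginv x) y) = y.
Proof. by move=> xy; rewrite gmulA ?grngV ?gsrcV // gmulgV xy gmul1g. Qed.
Lemma gmulgK x y : gsrc x = grng y -> gmul (gmul x y) (ginv y) = x.
Proof. by move=> xy; rewrite -gmulA ?grngV // gmulgV -xy gmulg1. Qed.
Lemma gmulgVK x y : gsrc x = gsrc y -> gmul (gmul x (ginv y)) y = x.
Proof. by move=> xy; rewrite -gmulA ?grngV ?gsrcV // gmulVg -xy gmulg1. Qed.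
Lemma ginvK x : ginv (ginv x) = x.
Proof.
have := @gmulKg (ginv x) x; rewrite gsrcV gmulVg => /(_ erefl).
by rewrite -grngV -gsrcV gmulg1.
Qed.
Lemma ginv_eq x y : gsrc x = grng y -> gmul x y = gsrc y -> y = ginv x.
Proof.
move=> xy e; rewrite -[LHS](gmulKg xy) e.
have -> : gsrc y = gsrc (ginv x) by rewrite gsrcV -(grngM _ _ xy) e grng_src.
exact: gmulg1.
Qed.
Lemma ginvM x y : gsrc x = grng y -> ginv (gmul x y) = gmul (ginv y) (ginv x).
Proof.
move=> xy.
have yx : gsrc (ginv y) = grng (ginv x) by rewrite gsrcV grngV.
have sM := gsrcM _ _ xy.
apply/esym/ginv_eq; first by rewrite grngM // grngV sM.
rewrite (gmulA (gmul x y)) //; last by rewrite grngV sM.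
by rewrite gmulgK // gmulgV gsrcM // gsrcV.
Qed.

End groupoid_algebra.

Section groupoid_topology.
Context {R : realType} {G : topGroupoidType}.
Hypothesis hG : hausdorff_space G.
Local Notation C := (cplx R).

Lemma within_gmul {P : topologicalType} (A : set P) (p q : P -> G) :
  {within A, continuous p} -> {within A, continuous q} ->
  (forall a, A a -> gsrc (p a) = grng (q a)) ->
  {within A, continuous (fun a => gmul (p a) (q a))}.
Proof.
move=> cp cq pq.
apply: (@within_comp P (G * G)%type G A [set p : G * G | gsrc p.1 = grng p.2] (fun a => (p a, q a)) (fun p : G * G => gmul p.1 p.2)).
- exact: within_pair.
- exact: pq.
- exact: gmul_continuous.
Qed.

Lemma within_ginv {P : topologicalType} (A : set P) (p : P -> G) :
  {within A, continuous p} -> {within A, continuous (fun a => ginv (p a))}.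
Proof. by move=> cp; apply: within_compT cp (@ginv_continuous G). Qed.

Lemma grng_continuous : continuous (@grng G).
Proof.
apply/continuous_subspace_setT.
apply: (@within_eq _ _ _ (fun x : G => gmul x (ginv x))); first by move=> x _; exact: gmulgV.
apply: within_gmul; [exact: within_id|apply: within_ginv; exact: within_id|].
by move=> x _; rewrite grngV.
Qed.

Lemma gsrc_continuous : continuous (@gsrc G).
Proof.
apply/continuous_subspace_setT.
apply: (@within_eq _ _ _ (fun x : G => grng (ginv x))); first by move=> x _; exact: grngV.
by apply: within_compT grng_continuous; apply: within_ginv; exact: within_id.
Qed.

Lemma closed_point (u : G) : closed [set u].
Proof. exact/accessible_closed_set1/hausdorff_accessible. Qed.

Lemma closed_src (u : G) : closed [set x : G | gsrc x = u].
Proof.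
rewrite (_ : [set x | _] = @gsrc G @^-1` [set u]) //.
exact: (proj1 (continuous_closedP _) gsrc_continuous _ (@closed_point u)).
Qed.

Lemma closed_rng (u : G) : closed [set x : G | grng x = u].
Proof.
rewrite (_ : [set x | _] = @grng G @^-1` [set u]) //.
exact: (proj1 (continuous_closedP _) grng_continuous _ (@closed_point u)).
Qed.

Lemma closed_sfiber (u : G) : closed (sfiber [set: G] u).
Proof. by rewrite /sfiber setTI; exact: closed_src. Qed.

Lemma closed_rfiber (u : G) : closed (rfiber [set: G] u).
Proof. by rewrite /rfiber setTI; exact: closed_rng. Qed.

Lemma closed_stability (u : G) : closed (stability u).
Proof. exact: (closedI (@closed_src u) (@closed_rng u)). Qed.

Lemma compact_ginv (K : set G) : compact K -> compact (@ginv G @` K).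
Proof.
by apply: continuous_compact; apply: continuous_subspaceT; exact: ginv_continuous.
Qed.

Definition set_gmul (A B : set G) : set G :=
  [set gmul p.1 p.2 | p in (A `*` B) `&` [set p : G * G | gsrc p.1 = grng p.2]].

Lemma closed_composable : closed [set p : G * G | gsrc p.1 = grng p.2].
Proof.
move=> [a b] ab /=; apply: hG => U V aU bV.
have nU : nbhs (a, b) [set p : G * G | U (gsrc p.1) /\ V (grng p.2)].
  exists (@gsrc G @^-1` U, @grng G @^-1` V) => /=.
    by split; [exact: gsrc_continuous|exact: grng_continuous].
  by move=> [c d].
have [[c d] /= [cd [Uc Vd]]] := ab _ nU.
by exists (gsrc c); split => //; rewrite cd.
Qed.

Lemma compact_gmul (A B : set G) : compact A -> compact B -> compact (set_gmul A B).
Proof.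
move=> cA cB; apply: continuous_compact.
  by apply: continuous_subspaceW (@gmul_continuous G) => p [].
by apply: compact_closedI; [exact: compact_setX|exact: closed_composable].
Qed.

Lemma set_gmul_mem (A B : set G) a b : A a -> B b -> gsrc a = grng b ->
  set_gmul A B (gmul a b).
Proof. by move=> Aa Bb ab; exists (a, b). Qed.

Hypothesis lG : locally_compact [set: G].

Lemma Cc_zero (D : set G) (f : G -> C) x : Cc D f -> ~ D x -> f x = 0.
Proof. by move=> [_ [K [_ KD f0]]] Dx; apply: f0 => /KD. Qed.

Lemma CcTP (f : G -> C) : continuous f ->
  (exists2 K, compact K & forall x, ~ K x -> f x = 0) -> Cc setT f.
Proof.
move=> cf [K cK f0]; split; first exact: continuous_subspaceT.
by exists K; split.
Qed.

Lemma Cc_continuous (f : G -> C) : Cc setT f -> continuous f.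
Proof. by move=> [cf _]; apply/continuous_subspace_setT. Qed.

(** Functions on a closed fiber are restrictions of elements of C_c(G): extend f
   from a compact neighborhood of its support by Tietze, then cut off. *)
Lemma Cc_extend (D : set G) (f : G -> C) : closed D -> Cc D f ->
  exists2 g, Cc setT g & forall x, D x -> g x = f x.
Proof.
move=> cD [cf [K [cK KD f0]]].
have [Q cQ KQ] := compact_interior_neighborhood lG cK.
have cQD : compact (Q `&` D) by exact: compact_closedI.
have cf' : {within Q `&` D, continuous f} by apply: continuous_subspaceW cf; exact: subIsetr.
have [M1 M10 fM1] := compact_fun_bounded cQD (within_Re cf').
have [M2 M20 fM2] := compact_fun_bounded cQD (within_Im cf').
have [g1 [cg1 g1f _]] := tietze_compact hG lG cQD M10 (within_Re cf') fM1.
have [g2 [cg2 g2f _]] := tietze_compact hG lG cQD M20 (within_Im cf') fM2.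
have [chi [cchi _ chi1 chi0 [Q' cQ' chi0']]] := @cutoff R _ hG lG _ _ cK (open_interior Q) KQ.
exists (fun x => (chi x)%:C%C * (g1 x +i* g2 x)%C).
  apply: CcTP; last by exists Q' => // x /chi0' ->; rewrite mul0r.
  apply/continuous_subspace_setT/within_mulC.
    by apply: within_RtoC; exact: continuous_subspaceT.
  by apply: within_ReIm; exact: continuous_subspaceT.
move=> x Dx; have [Kx|Kx] := pselect (K x).
  have QDx : (Q `&` D) x by split => //; apply: interior_subset; exact: KQ.
  by rewrite chi1 // mul1r g1f // g2f //; case: (f x).
rewrite (f0 _ Kx); have [Qx|Qx] := pselect (Q x).
  by rewrite g1f // g2f // f0 // mulr0.
by rewrite chi0 ?mul0r // => /interior_subset.
Qed.

End groupoid_topology.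

(** * Integration of continuous functions *)

Section borel_measures.
Context {R : realType} {G : topGroupoidType}.
Hypothesis hG : hausdorff_space G.
Local Notation C := (cplx R).
Implicit Types (mu : {measure set (borel G) -> \bar R}) (D K : set G).

Lemma open_borel (U : set G) : open U -> measurable (U : set (borel G)).
Proof. by move=> oU; exact: sub_gen_smallest. Qed.

Lemma closed_borel (D : set G) : closed D -> measurable (D : set (borel G)).
Proof.
by move=> cD; rewrite -[D]setCK; apply: measurableC; apply: open_borel; exact: closed_openC.
Qed.

Lemma compact_borel (K : set G) : compact K -> measurable (K : set (borel G)).
Proof. by move=> cK; apply: closed_borel; apply: compact_closed cK. Qed.

Lemma within_measurable (D : set G) (f : G -> R) :
  closed D -> {within D, continuous f} ->
  measurable_fun (D : set (borel G)) (f : borel G -> R).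
Proof.
move=> cD /continuousP cf; apply: (measurability _ (RGenOpens.measurableE R)).
move=> _ [_ [a [b ->] <-]].
have oI : open (`]a, b[%classic : set R) by exact: interval_open.
have /open_subspaceP[V oV eV] := cf _ oI.
rewrite setIC -eV; apply: measurableI; [exact: open_borel|exact: closed_borel].
Qed.

Lemma ginv_measurable : measurable_fun [set: borel G] (@ginv G : borel G -> borel G).
Proof.
apply: (@measurability _ _ (borel G) (borel G) setT (@ginv G) (@open G) erefl).
move=> _ [U oU <-]; rewrite setTI; apply: open_borel.
by move/continuousP : (@ginv_continuous G); apply.
Qed.

(** The integrands that occur below, such as y |-> f (z y) on a fiber, are given
   by formulas that make sense and are continuous on the fiber only. Hence no
   condition is put on their values outside of D, in contrast with Cc. *)
Definition Ccon (D : set G) (f : G -> C) :=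
  {within D, continuous f} /\
  exists K, [/\ compact K, K `<=` D & forall x, D x -> ~ K x -> f x = 0].

Lemma Cc_Ccon D f : Cc D f -> Ccon D f.
Proof. by move=> [cf [K [cK KD f0]]]; split => //; exists K; split => // x _; exact: f0. Qed.

Lemma Ccon_compact K (f : G -> C) : compact K -> {within K, continuous f} -> Ccon K f.
Proof. by move=> cK cf; split => //; exists K; split. Qed.

Lemma Ccon_mull D (f g : G -> C) : {within D, continuous f} -> Ccon D g ->
  Ccon D (fun x => f x * g x).
Proof.
move=> cf [cg [K [cK KD g0]]]; split; first exact: (within_mulC cf cg).
by exists K; split => // x Dx Kx; rewrite g0 // mulr0.
Qed.

Lemma Ccon_mulr D (f g : G -> C) : Ccon D f -> {within D, continuous g} ->
  Ccon D (fun x => f x * g x).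
Proof.
move=> [cf [K [cK KD f0]]] cg; split; first exact: (within_mulC cf cg).
by exists K; split => // x Dx Kx; rewrite f0 // mul0r.
Qed.

Lemma Ccon_linear D k (f g : G -> C) : Ccon D f -> Ccon D g ->
  Ccon D (fun x => k * f x + g x).
Proof.
move=> [cf [K [cK KD f0]]] [cg [L [cL LD g0]]]; split.
  exact: (within_addC (within_mulC (@within_cst _ _ D k) cf) cg).
exists (K `|` L); split; [exact: compactU| by move=> x []; auto|].
by move=> x Dx /not_orP[Kx Lx]; rewrite f0 // g0 // mulr0 addr0.
Qed.

Lemma Ccon_conj D (f : G -> C) : Ccon D f -> Ccon D (fun x => (f x)^*).
Proof.
move=> [cf [K [cK KD f0]]]; split; first exact: (within_conj cf).
by exists K; split => // x Dx Kx; rewrite f0 // conjC0.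
Qed.

Lemma Ccon_Cc D (f : G -> C) : closed D -> Ccon D f -> exists2 g, Cc D g & forall x, D x -> g x = f x.
Proof.
move=> cD [cf [K [cK KD f0]]]; exists (fun x => if pselect (D x) then f x else 0).
  split; last first.
    exists K; split => // x Kx; case: pselect => // Dx; exact: f0.
  by apply: within_eq cf => x Dx; case: pselect.
by move=> x Dx; case: pselect.
Qed.

Lemma within_Cc_comp {P : topologicalType} D (A : set P) (p : P -> G) (f : G -> C) :
  Cc D f -> {within A, continuous p} -> (forall a, A a -> D (p a)) ->
  {within A, continuous (fun a => f (p a))}.
Proof. by move=> [cf _] cp pD; apply: within_comp cp pD cf. Qed.

Lemma Ccon_ginv D D' (f : G -> C) : (forall y, D' y -> D (ginv y)) ->
  (forall x, D x -> D' (ginv x)) -> Cc D f -> Ccon D' (fun y => f (ginv y)).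
Proof.
move=> D'D DD' Cf; split.
  by apply: (within_Cc_comp Cf); [apply: within_ginv; exact: within_id|exact: D'D].
have [_ [K [cK KD f0]]] := Cf.
exists (@ginv G @` K); split; first exact: compact_ginv.
  by move=> _ [x Kx <-]; apply/DD'/KD.
move=> y _ Ky; apply: f0 => Ky'; apply: Ky.
by exists (ginv y) => //; exact: ginvK.
Qed.

Lemma cintegral_eq mu D (f g : G -> C) : (forall x, D x -> f x = g x) ->
  cintegral mu D f = cintegral mu D g.
Proof.
by move=> fg; rewrite /cintegral; congr (fine _ +i* fine _)%C;
  apply: eq_integral => x /set_mem Dx; rewrite fg.
Qed.

Lemma integral_support mu (D K : set (borel G)) (f : G -> R) :
  K `<=` D -> (forall x, D x -> ~ K x -> f x = 0) ->
  (\int[mu]_(x in D) (f x)%:E = \int[mu]_(x in K) (f x)%:E)%E.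
Proof.
move=> KD f0; rewrite integral_mkcond [RHS]integral_mkcond; congr integral.
apply/funext => x; rewrite !patchE; case: ifPn => [/set_mem Dx|xD].
  by case: ifPn => // /negP xK; rewrite f0 // => Kx; apply: xK; rewrite inE.
by case: ifPn => // /set_mem/KD Dx; move: xD; rewrite notin_setE.
Qed.

Lemma cintegral_support mu D K (f : G -> C) :
  K `<=` D -> (forall x, D x -> ~ K x -> f x = 0) ->
  cintegral mu D f = cintegral mu K f.
Proof.
move=> KD f0; rewrite /cintegral; congr (fine _ +i* fine _)%C;
  apply: integral_support => // x Dx Kx; by rewrite f0.
Qed.

Definition compact_finite mu := forall K, compact K -> (mu K < +oo)%E.

Lemma compact_integrable mu (K : set G) (f : G -> R) : compact_finite mu ->
  compact K -> {within K, continuous f} ->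
  mu.-integrable (K : set (borel G)) (EFin \o f).
Proof.
move=> fmu cK cf; apply: measurable_bounded_integrable.
- exact: compact_borel.
- exact: fmu.
- by apply: within_measurable => //; exact: compact_closed.
- have [M M0 hM] := compact_fun_bounded cK cf.
  exists M; split; first exact: num_real.
  by move=> N MN x Kx; apply: le_trans (hM _ Kx) (ltW MN).
Qed.

Lemma integrable_support mu (D K : set (borel G)) (f : G -> R) :
  measurable D -> measurable K -> K `<=` D -> (forall x, D x -> ~ K x -> f x = 0) ->
  mu.-integrable K (EFin \o f) -> mu.-integrable D (EFin \o f).
Proof.
move=> mD mK KD f0 iK.
have iT := (integrable_mkcond _ mK).1 iK.
apply/(integrable_mkcond _ mD).
suff -> : ((EFin \o f) \_ D : borel G -> \bar R) = ((EFin \o f) \_ K) by [].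
apply/funext => x; rewrite !patchE; case: ifPn => [/set_mem Dx|xD].
  by case: ifPn => //= /negP xK; rewrite f0 // => Kx; apply: xK; rewrite inE.
by case: ifPn => // /set_mem/KD Dx; move: xD; rewrite notin_setE.
Qed.

Lemma Ccon_integrable mu D (f : G -> C) : compact_finite mu -> closed D ->
  Ccon D f ->
  mu.-integrable (D : set (borel G)) (EFin \o (fun x => complex.Re (f x))) /\
  mu.-integrable (D : set (borel G)) (EFin \o (fun x => complex.Im (f x))).
Proof.
move=> fmu cD [cf [K [cK KD f0]]].
have cfK : {within K, continuous f} by apply: continuous_subspaceW cf.
split; apply: (@integrable_support _ _ K) => //; try exact: closed_borel; try exact: compact_borel.
- by move=> x Dx Kx; rewrite f0.
- by apply: compact_integrable => //; exact: within_Re.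
- by move=> x Dx Kx; rewrite f0.
- by apply: compact_integrable => //; exact: within_Im.
Qed.

Lemma cintegral_linear mu D k (f g : G -> C) : compact_finite mu -> closed D ->
  Ccon D f -> Ccon D g ->
  cintegral mu D (fun x => k * f x + g x) = k * cintegral mu D f + cintegral mu D g.
Proof.
move=> fmu cD If Ig.
have [f1 f2] := Ccon_integrable fmu cD If.
have [g1 g2] := Ccon_integrable fmu cD Ig.
have mD : measurable (D : set (borel G)) by exact: closed_borel.
case: k => a b; rewrite /cintegral.
have intZ c (h : G -> R) : mu.-integrable (D : set (borel G)) (EFin \o h) ->
    mu.-integrable (D : set (borel G)) (EFin \o (fun x => c * h x)).
  by move=> ih; have := integrableZl mD c ih.
have intD (h h' : G -> R) : mu.-integrable (D : set (borel G)) (EFin \o h) ->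
    mu.-integrable (D : set (borel G)) (EFin \o h') ->
    mu.-integrable (D : set (borel G)) (EFin \o (fun x => h x + h' x)).
  by move=> ih ih'; have := integrableD mD ih ih'.
have key c d (h h' h'' : G -> R) : mu.-integrable (D : set (borel G)) (EFin \o h) ->
    mu.-integrable (D : set (borel G)) (EFin \o h') ->
    mu.-integrable (D : set (borel G)) (EFin \o h'') ->
    Rintegral mu (D : set (borel G)) (fun x => c * h x + d * h' x + h'' x) =
    c * Rintegral mu (D : set (borel G)) h + d * Rintegral mu (D : set (borel G)) h' + Rintegral mu (D : set (borel G)) h''.
  move=> ih ih' ih''; rewrite RintegralD //; last by apply: intD; exact: intZ.
  by rewrite RintegralD ?RintegralZl //; exact: intZ.
have E (z w : C) : (a +i* b)%C * z + w = ((a * complex.Re z + (- b) * complex.Im z + complex.Re w) +i* (a * complex.Im z + b * complex.Re z + complex.Im w))%C.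
  by case: z w => [z1 z2] [w1 w2] /=; congr (_ +i* _)%C => /=; rewrite mulNr.
rewrite [RHS]E /=.
under [X in (fine X +i* _)%C]eq_integral do rewrite E /=.
under [X in (_ +i* fine X)%C]eq_integral do rewrite E /=.
by congr (_ +i* _)%C; [exact: (key a (- b))|exact: (key a b)].
Qed.

Lemma Ccon0 D : Ccon D (fun=> 0).
Proof. by split; [exact: within_cst|exists set0; split => //; exact: compact0]. Qed.

Lemma cintegral0 mu D : cintegral mu D (fun=> 0) = 0.
Proof. by rewrite /cintegral /= integral0. Qed.

Lemma cintegralZ mu D k (f : G -> C) : compact_finite mu -> closed D ->
  Ccon D f -> cintegral mu D (fun x => k * f x) = k * cintegral mu D f.
Proof.
move=> fmu cD If; rewrite -[RHS]addr0 -(cintegral0 mu D).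
rewrite -(cintegral_linear k fmu cD If (@Ccon0 D)).
by apply: cintegral_eq => x _; rewrite addr0.
Qed.

Lemma cintegralD mu D (f g : G -> C) : compact_finite mu -> closed D ->
  Ccon D f -> Ccon D g -> cintegral mu D (fun x => f x + g x) = cintegral mu D f + cintegral mu D g.
Proof.
move=> fmu cD If Ig; rewrite -[cintegral mu D f]mul1r -cintegral_linear //.
by apply: cintegral_eq => x _; rewrite mul1r.
Qed.

Lemma cintegralB mu D (f g : G -> C) : compact_finite mu -> closed D ->
  Ccon D f -> Ccon D g -> cintegral mu D (fun x => f x - g x) = cintegral mu D f - cintegral mu D g.
Proof.
move=> fmu cD If Ig; rewrite addrC -mulN1r -cintegral_linear //.
by apply: cintegral_eq => x _; rewrite mulN1r addrC.
Qed.

(** The constant 2 comes from estimating real and imaginary parts separately,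
   and is harmless. *)
Lemma cintegral_le mu K (f : G -> C) (M : R) : compact_finite mu -> compact K ->
  {within K, continuous f} -> (forall x, K x -> `|f x| <= M%:C%C) ->
  `|cintegral mu K f| <= ((2 * M * fine (mu K))%:C)%C.
Proof.
move=> fmu cK cf fM; apply: le_trans (normc_le_ReIm _) _; rewrite lecR /=.
have mK := compact_borel cK.
have b (h : G -> R) : {within K, continuous h} -> (forall x, K x -> `|h x| <= M) ->
   `|Rintegral mu (K : set (borel G)) h| <= M * fine (mu K).
  move=> ch hM; have ih := compact_integrable fmu cK ch.
  apply: le_trans (le_normr_Rintegral mK ih) _.
  rewrite -(Rintegral_cst mu mK); apply: le_Rintegral => //.
    by apply: compact_integrable => // x; apply: cvg_norm; exact: ch.
  by apply: compact_integrable => //; exact: within_cst.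
rewrite -mulrA mulr2n mulrDl !mul1r lerD //; apply: b; [exact: within_Re| |exact: within_Im|].
  by move=> x Kx; rewrite -lecR; apply: le_trans (normc_ge_Re _) (fM _ Kx).
by move=> x Kx; rewrite -lecR; apply: le_trans (normc_ge_Im _) (fM _ Kx).
Qed.

Lemma cintegral_le_weight mu (D : set G)
    (F : G -> C) (w : G -> R) (M : R) : compact_finite mu -> closed D ->
  Ccon D F -> Ccon D (fun x => (w x)%:C%C) ->
  (forall x, D x -> `|F x| <= (M * w x)%:C%C) ->
  `|cintegral mu D F| <= (2 * (M * Rintegral mu (D : set (borel G)) w))%:C%C.
Proof.
move=> fmu cD IF Iw Fw; apply: le_trans (normc_le_ReIm _) _; rewrite lecR /=.
have [F1 F2] := Ccon_integrable fmu cD IF; have [w1 _] := Ccon_integrable fmu cD Iw.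
have mD : measurable (D : set (borel G)) by exact: closed_borel.
have wM : mu.-integrable (D : set (borel G)) (EFin \o (fun x => M * w x)).
  by have := integrableZl mD M w1.
have b (h : G -> R) : mu.-integrable (D : set (borel G)) (EFin \o h) ->
    (forall x, D x -> `|h x| <= M * w x) ->
    `|Rintegral mu (D : set (borel G)) h| <= M * Rintegral mu (D : set (borel G)) w.
  move=> ih hw; apply: le_trans (le_normr_Rintegral mD ih) _.
  rewrite -RintegralZl //; apply: le_Rintegral => //.
  exact: integrable_norm ih.
rewrite mulr2n mulrDl !mul1r lerD //; apply: b => // x Dx.
  by rewrite -lecR; apply: le_trans (normc_ge_Re _) (Fw _ Dx).
by rewrite -lecR; apply: le_trans (normc_ge_Im _) (Fw _ Dx).
Qed.

Lemma Rintegral_gt0 (mu : {measure set (borel G) -> \bar R}) (D : set G) (f : G -> R) x :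
  closed D -> {within D, continuous f} ->
  mu.-integrable (D : set (borel G)) (EFin \o f) ->
  (forall y, D y -> 0 <= f y) -> D x -> 0 < f x ->
  (forall U, open U -> U x -> (0 < mu (D `&` U))%E) ->
  0 < Rintegral mu (D : set (borel G)) f.
Proof.
move=> cD cf intf f0 Dx fx muU.
have mD : measurable (D : set (borel G)) by exact: closed_borel.
have [V oV eV] : exists2 V, open V & V `&` D = f @^-1` `]f x / 2, +oo[%classic `&` D.
  apply/open_subspaceP; move/continuousP : cf; apply; exact: interval_open.
have mV : measurable (V : set (borel G)) by exact: open_borel.
have Vx : V x.
  have : (f @^-1` `]f x / 2, +oo[%classic `&` D) x.
    by split => //=; rewrite in_itv /= andbT ltr_pdivrMr // ltr_pMr // ltr1n.
  by rewrite -eV => -[].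
have fin := integrable_fin_num mD intf.
rewrite -lte_fin /Rintegral fineK //.
apply: (@lt_le_trans _ _ ((f x / 2)%:E * mu (D `&` V))%E).
  by rewrite mule_gt0 ?lte_fin ?divr_gt0 //; exact: muU.
rewrite -integral_cst; last exact: measurableI.
apply: (@le_trans _ _ (\int[mu]_(y in D `&` V) (f y)%:E)%E).
  have mDV : measurable (D `&` V : set (borel G)) by exact: measurableI.
  apply: ge0_le_integral => //.
  - by move=> y _; rewrite /= lee_fin divr_ge0 // ltW.
  - apply/measurable_EFinP; apply: measurable_funS (within_measurable cD cf) => //.
  - move=> y [Dy Vy]; rewrite /= lee_fin ltW //.
    have : (f @^-1` `]f x / 2, +oo[%classic `&` D) y by rewrite -eV.
    by move=> [/=]; rewrite in_itv /= andbT.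
apply: ge0_subset_integral => //; first exact: measurableI.
  by apply/measurable_EFinP; exact: within_measurable.
Qed.

Lemma concentrated_gt0 (mu : {measure set (borel G) -> \bar R}) (D U : set G) :
  closed D -> open U -> mu (~` D) = 0%E -> (0 < mu U)%E -> (0 < mu (D `&` U))%E.
Proof.
move=> cD oU c0.
have mD : measurable (D : set (borel G)) by exact: closed_borel.
have mU : measurable (U : set (borel G)) by exact: open_borel.
rewrite (measureDI mu mU mD) setIC.
set A := (X in (_ < mu X + _)%E); suff -> : mu A = 0%E by rewrite add0e.
apply/eqP; rewrite /A -measure_le0 -c0; apply: le_measure; rewrite ?inE.
- exact: measurableD.
- exact: measurableC.
- by move=> x [].
Qed.

(** By the tube lemma, F q is uniformly close to F p on the compact set K for q
   near p, and K has finite measure. *)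
Lemma parametric_continuous mu {P : topologicalType} (A : set P) K (F : P -> G -> C) :
  compact_finite mu -> compact K ->
  {within A `*` K, continuous (fun q : P * G => F q.1 q.2)} ->
  {within A, continuous (fun p => cintegral mu K (F p))}.
Proof.
move=> fmu cK cF; apply/subspace_continuousP => p Ap.
have cFp q : A q -> {within K, continuous (F q)}.
  move=> Aq; apply: (@within_comp _ _ _ K (A `*` K) (fun x => (q, x)) (fun r : P * G => F r.1 r.2)) => //.
  by apply: within_pair; [exact: within_cst|exact: within_id].
apply/(@cvgrPdist_lt C C) => e /Cgt0P[r r0 ->].
have m0 : 0 <= fine (mu K) by apply: fine_ge0; exact: measure_ge0.
pose d := r / (2 * (fine (mu K) + 1)).
have d0 : 0 < d by rewrite divr_gt0 // mulr_gt0 // ltr_wpDl.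
have dC0 : 0 < (d%:C)%C :> C by rewrite ltcR.
have tube : \forall q \near within A (nbhs p), K `<=` (fun x => `|F p x - F q x| < (d%:C)%C).
  move: cK => /compact_near_coveringP/near_covering_withinP; apply => x Kx.
  have /subspace_continuousP/(_ (p, x) (conj Ap Kx)) := cF.
  have d2 : 0 < (d%:C)%C / 2 :> C by rewrite divr_gt0.
  move=> /(@cvgrPdist_lt C C)/(_ _ d2)[[U V] /= [pU xV] UV].
  exists (V, U `&` A) => /=.
    split => //; apply: filterI; last exact: withinT.
    exact: (@cvg_within _ (nbhs p) _ A).
  move=> [y q] /= [Vy [Uq Aq]] Ky.
  have h1 := UV (q, y) (conj Uq Vy) (conj Aq Ky).
  have h2 := UV (p, y) (conj (nbhs_singleton pU) Vy) (conj Ap Ky).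
  rewrite /from_subspace /= in h1 h2; rewrite distrC in h2.
  rewrite -[F p y](subrK (F p x)) -addrA; apply: le_lt_trans (ler_normD _ _) _.
  by rewrite [ltRHS]splitr ltrD.
near=> q; have Aq : A q by near: q; exact: withinT.
have cK' : closed K by exact: compact_closed cK.
rewrite /from_subspace -cintegralB //; [|exact: Ccon_compact (cFp _ _)..].
have cFpq : {within K, continuous (fun x => F p x - F q x)}.
  by move=> x; apply: cvgB; [exact: cFp|exact: cFp].
have FKq : K `<=` (fun x => `|F p x - F q x| < (d%:C)%C) by near: q; exact: tube.
apply: le_lt_trans (cintegral_le fmu cK cFpq (fun x Kx => ltW (FKq x Kx))) _.
rewrite ltcR /d mulrA -mulf_div divff ?pnatr_eq0 // mul1r mulrAC ltr_pdivrMr ?ltr_wpDl //.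
by rewrite ltr_pM2l // ltrDl.
Unshelve. all: by end_near. Qed.

End borel_measures.

(** * Iterated integrals *)

Section fubini_borel.
Context {R : realType} {G : topGroupoidType}.
Hypothesis hG : hausdorff_space G.
Hypothesis sG : @second_countable G.
Local Notation C := (cplx R).
Implicit Types (mu : {measure set (borel G) -> \bar R}) (D K : set G).

(** The Borel sets of G x G need not belong to the product of the Borel
   sigma-algebras in general. They do here, since by second countability an open
   set is a countable union of rectangles; this is what makes continuous
   functions on G x G accessible to Fubini. *)
Lemma open_prod_measurable (O : set (G * G)) : open O ->
  measurable (O : set (borel G * borel G)).
Proof.
move=> oO; have [B cB [oB bB]] := sG.
have [f fI] : exists f : set G * set G -> nat, {in B `*` B &, injective f}.
  by apply/countable_injP; exact: countableX.
pose P n : set (set G * set G) :=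
  [set p | [/\ (B `*` B) p, f p = n & p.1 `*` p.2 `<=` O]].
have -> : O = \bigcup_n \bigcup_(p in P n) (p.1 `*` p.2).
  apply/seteqP; split=> [[x y] Oxy|z [n _ [p [_ _ pO]]]]; last exact: pO.
  have [[U V] /= [xU yV] UV] : nbhs (x, y) O by apply: open_nbhs_nbhs; split.
  have [U' [BU' U'x] U'U] := bB x U xU.
  have [V' [BV' V'y] V'V] := bB y V yV.
  exists (f (U', V')) => //; exists (U', V') => //; split => //.
  by move=> [a b] /= [Ua Vb]; apply: UV; split; [exact: U'U|exact: V'V].
apply: bigcupT_measurable => n.
have [[p Pp]|nP] := pselect (exists p, P n p); last first.
  rewrite (_ : \bigcup_(p in P n) _ = set0) //.
  by apply/seteqP; split=> // z [p Pp _]; case: nP; exists p.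
rewrite (_ : \bigcup_(p in P n) _ = p.1 `*` p.2).
  case: Pp => [[B1 B2] _ _].
  by apply: measurableX; apply: open_borel; exact: oB.
apply/seteqP; split=> [z [q [Bq fq _] qz]|z pz]; last by exists p.
case: Pp => Bp fp _; suff -> : p = q by [].
by apply: fI; rewrite ?inE // fp fq.
Qed.

Lemma within_prod_measurable (K1 K2 : set G) (f : G * G -> R) :
  closed K1 -> closed K2 -> {within K1 `*` K2, continuous f} ->
  measurable_fun (K1 `*` K2 : set (borel G * borel G)) (f : borel G * borel G -> R).
Proof.
move=> c1 c2 /continuousP cf; apply: (measurability _ (RGenOpens.measurableE R)).
move=> _ [_ [a [b ->] <-]].
have oI : open (`]a, b[%classic : set R) by exact: interval_open.
have /open_subspaceP[V oV eV] := cf _ oI.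
rewrite setIC -eV; apply: measurableI; first exact: open_prod_measurable.
by apply: measurableX; exact: closed_borel.
Qed.

Lemma integral_mfrestr mu (K : set (borel G)) (mK : measurable K)
    (fK : (mu K < +oo)%E) (f : borel G -> \bar R) :
  (forall x, ~ K x -> f x = 0%E) ->
  (\int[mfrestr mK fK]_x f x = \int[mu]_(x in K) f x)%E.
Proof.
move=> f0; transitivity (\int[mfrestr mK fK]_(x in K) f x)%E.
  rewrite [RHS]integral_mkcond; apply: eq_integral => x _; rewrite patchE.
  by case: ifPn => // /negP xK; apply: f0 => Kx; apply: xK; rewrite inE.
apply: eq_measure_integral => B mB BK /=.
by rewrite /mfrestr /mrestr setIidl.
Qed.

(** Restricting both measures to compact sets makes them finite, and bounded
   measurable functions integrable, so that Fubini applies. *)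
Lemma fubini_compact mu1 mu2 (K1 K2 : set G) (f : G * G -> R) :
  compact_finite mu1 -> compact_finite mu2 -> compact K1 -> compact K2 ->
  {within K1 `*` K2, continuous f} ->
  Rintegral mu1 (K1 : set (borel G)) (fun x => Rintegral mu2 (K2 : set (borel G)) (fun y => f (x, y))) =
  Rintegral mu2 (K2 : set (borel G)) (fun y => Rintegral mu1 (K1 : set (borel G)) (fun x => f (x, y))).
Proof.
move=> fmu1 fmu2 c1 c2 cf.
have cK1 := compact_closed hG c1; have cK2 := compact_closed hG c2.
have m1 := compact_borel hG c1; have m2 := compact_borel hG c2.
have m12 : measurable (K1 `*` K2 : set (borel G * borel G)) by exact: measurableX.
pose n1 : {finite_measure set (borel G) -> \bar R} := mfrestr m1 (fmu1 _ c1).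
pose n2 : {finite_measure set (borel G) -> \bar R} := mfrestr m2 (fmu2 _ c2).
pose g : borel G * borel G -> R := f \_ (K1 `*` K2).
have mg : measurable_fun setT g.
  apply/(measurable_restrictT _ _).1 => //; exact: within_prod_measurable.
have ig : (n1 \x n2)%E.-integrable setT (EFin \o g).
  apply: measurable_bounded_integrable => //.
    have h := product_measure1E n1 n2 measurableT measurableT.
    have : (n1 setT * n2 setT < +oo)%E.
      by rewrite lte_mul_pinfty // ?measure_ge0 ?fin_num_measure // -ge0_fin_numE // fin_num_measure.
    by rewrite -h setXTT.
  have [M M0 hM] := compact_fun_bounded (compact_setX c1 c2) cf.
  exists M; split; first exact: num_real.
  move=> N MN z _; apply: le_trans (ltW MN); rewrite /g patchE.
  by case: ifPn => [/set_mem|_]; [exact: hM|rewrite normr0 ltW].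
have g0 x y : ~ K1 x \/ ~ K2 y -> g (x, y) = 0.
  rewrite /g patchE; case: ifPn => // /set_mem[/= K1x K2y]; case => //.
have gE x y : K1 x -> K2 y -> g (x, y) = f (x, y).
  by move=> K1x K2y; rewrite /g patchE ifT // inE.
have cfx x : K1 x -> {within K2, continuous (fun y => f (x, y))}.
  move=> Kx; apply: (@within_comp _ _ _ K2 (K1 `*` K2) (fun y => (x, y)) f) => //.
  by apply: within_pair; [exact: within_cst|exact: within_id].
have cfy y : K2 y -> {within K1, continuous (fun x => f (x, y))}.
  move=> Ky; apply: (@within_comp _ _ _ K1 (K1 `*` K2) (fun x => (x, y)) f) => //.
  by apply: within_pair; [exact: within_id|exact: within_cst].
have L : (\int[n1]_x \int[n2]_y (EFin \o g) (x, y) = \int[mu1]_(x in K1) (\int[mu2]_(y in K2) f (x, y))%:E)%E.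
  rewrite /n1 integral_mfrestr.
    apply: eq_integral => x /set_mem Kx; rewrite /n2 integral_mfrestr.
      rewrite /Rintegral fineK; last exact: integrable_fin_num (compact_integrable hG fmu2 c2 (cfx _ Kx)).
      by apply: eq_integral => y /set_mem Ky /=; rewrite gE.
    by move=> y Ky /=; rewrite g0 //; right.
  by move=> x Kx; rewrite integral0_eq // => y _ /=; rewrite g0 //; left.
have L' : (\int[n2]_y \int[n1]_x (EFin \o g) (x, y) = \int[mu2]_(y in K2) (\int[mu1]_(x in K1) f (x, y))%:E)%E.
  rewrite /n2 integral_mfrestr.
    apply: eq_integral => y /set_mem Ky; rewrite /n1 integral_mfrestr.
      rewrite /Rintegral fineK; last exact: integrable_fin_num (compact_integrable hG fmu1 c1 (cfy _ Ky)).
      by apply: eq_integral => x /set_mem Kx /=; rewrite gE.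
    by move=> x Kx /=; rewrite g0 //; left.
  by move=> y Ky; rewrite integral0_eq // => x _ /=; rewrite g0 //; right.
by rewrite {1}/Rintegral -L (Fubini ig) L'.
Qed.

Lemma cintegral_fubini mu1 mu2 (D1 D2 K1 K2 : set G) (F : G -> G -> C) :
  compact_finite mu1 -> compact_finite mu2 ->
  compact K1 -> compact K2 -> K1 `<=` D1 -> K2 `<=` D2 ->
  {within K1 `*` K2, continuous (fun q : G * G => F q.1 q.2)} ->
  (forall x y, D1 x -> D2 y -> ~ K1 x -> F x y = 0) ->
  (forall x y, D1 x -> D2 y -> ~ K2 y -> F x y = 0) ->
  cintegral mu1 D1 (fun x => cintegral mu2 D2 (F x)) =
  cintegral mu2 D2 (fun y => cintegral mu1 D1 (fun x => F x y)).
Proof.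
move=> fmu1 fmu2 c1 c2 KD1 KD2 cF F1 F2.
rewrite (cintegral_support mu1 KD1); last first.
  move=> x Dx Kx; rewrite -[RHS](cintegral0 mu2 D2); apply: cintegral_eq => y Dy; exact: F1.
rewrite (cintegral_support mu2 KD2); last first.
  move=> y Dy Ky; rewrite -[RHS](cintegral0 mu1 D1); apply: cintegral_eq => x Dx; exact: F2.
rewrite (cintegral_eq mu1 (g := fun x => cintegral mu2 K2 (F x))); last first.
  by move=> x Kx; apply: cintegral_support => // y Dy Ky; apply: F2 => //; exact: KD1.
rewrite (cintegral_eq mu2 (g := fun y => cintegral mu1 K1 (fun x => F x y))); last first.
  by move=> y Ky; apply: cintegral_support => // x Dx Kx; apply: F1 => //; exact: KD2.
congr (_ +i* _)%C.
  exact: (fubini_compact fmu1 fmu2 c1 c2 (within_Re cF)).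
exact: (fubini_compact fmu1 fmu2 c1 c2 (within_Im cF)).
Qed.

Lemma integral_pushforward_ginv mu (D : set G) (f : G -> R) : closed D ->
  {within D, continuous f} ->
  (\int[pushforward mu (@ginv G : borel G -> borel G)]_(x in D) (f x)%:E =
   \int[mu]_(x in @ginv G @^-1` D) (f (ginv x))%:E)%E.
Proof.
move=> cD cf; have mD := closed_borel cD.
have mf := (measurable_EFinP _ _).2 (within_measurable cD cf).
have mi := @ginv_measurable G.
rewrite integralE [RHS]integralE; congr (_ - _)%E.
  rewrite (ge0_integral_pushforward mi) //; last exact: measurable_funepos.
  by rewrite -funepos_comp.
rewrite (ge0_integral_pushforward mi) //; last exact: measurable_funeneg.
  by rewrite -funeneg_comp.
Qed.

Lemma preimage_ginv_sfiber (u : G) : @ginv G @^-1` (sfiber [set: G] u) = rfiber [set: G] u.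
Proof.
by apply/seteqP; split=> x /= [_]; [rewrite /= gsrcV|rewrite /= => <-; split => //=; rewrite gsrcV].
Qed.

Lemma cintegral_source (lam : G -> {measure set (borel G) -> \bar R}) u (f : G -> C) :
  {within sfiber setT u, continuous f} ->
  cintegral (source_measure lam u) (sfiber setT u) f =
  cintegral (lam u) (rfiber setT u) (fun x => f (ginv x)).
Proof.
move=> cf; rewrite /cintegral /source_measure.
rewrite !integral_pushforward_ginv ?preimage_ginv_sfiber //; try exact: closed_sfiber.
  exact: within_Im.
exact: within_Re.
Qed.

End fubini_borel.

(** * Haar integrals on the fibers over a unit *)

Section haar_integrals.
Context {R : realType} {G : topGroupoidType}.
Hypothesis hG : hausdorff_space G.
Hypothesis lG : locally_compact [set: G].
Hypothesis sG : @second_countable G.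
Local Notation C := (cplx R).
Variable lam : G -> {measure set (borel G) -> \bar R}.
Hypothesis haar_lam : haar_system setT lam.
Variable u : G.
Hypothesis unit_u : units u.
Variable alpha : {measure set (borel G) -> \bar R}.
Hypothesis haar_alpha : haar_system (stability u) (fun=> alpha).

Local Notation X := (sfiber [set: G] u).
Local Notation Y := (rfiber [set: G] u).
Local Notation S := (stability u).
Implicit Types (f g phi psi : G -> C).

Lemma compact_finite_lam v : units v -> compact_finite (lam v).
Proof. by move=> uv K cK; apply: (haar_compact haar_lam). Qed.

Lemma stability_unit : (S `&` units) u.
Proof. by split => //; split; [exact: unit_src|exact: unit_rng]. Qed.

Lemma compact_finite_alpha : compact_finite alpha.
Proof. by move=> K cK; apply: (haar_compact haar_alpha stability_unit). Qed.

Lemma rfiber_stability v : v = u -> rfiber S v = S.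
Proof. by move=> ->; apply/seteqP; split=> x; [case|move=> Sx; split => //; case: Sx]. Qed.

Lemma stability_ginv t : S t -> S (ginv t).
Proof. by move=> [ts tr]; split; rewrite ?gsrcV ?grngV. Qed.
Lemma stability_gmul t t' : S t -> S t' -> S (gmul t t').
Proof. by move=> [ts tr] [ts' tr']; split; rewrite ?gsrcM ?grngM // ts. Qed.

(** Invariance of the Haar system is stated for functions on all of G, whereas f
   lives on one fiber: extend it to C_c(G) first. *)
Lemma lam_invariant z f : Ccon (rfiber setT (grng z)) f ->
  cintegral (lam (gsrc z)) (rfiber setT (gsrc z)) (fun y => f (gmul z y)) =
  cintegral (lam (grng z)) (rfiber setT (grng z)) f.
Proof.
move=> If; have cl := @closed_rfiber G hG (grng z).
have [g Cg gf] := Ccon_Cc cl If.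
have [k Ck kg] := Cc_extend hG lG cl Cg.
have := haar_invariant haar_lam Ck (I : setT z).
rewrite (cintegral_eq _ (g := fun y => f (gmul z y))); last first.
  by move=> y [_ /= yz]; rewrite kg ?gf //; split => //=; rewrite grngM.
by move=> ->; apply: cintegral_eq => y Yy; rewrite kg // gf.
Qed.

Lemma alpha_invariant t f : S t -> Ccon S f ->
  cintegral alpha S (fun y => f (gmul t y)) = cintegral alpha S f.
Proof.
move=> St If; have cl := @closed_stability G hG u.
have [g Cg gf] := Ccon_Cc cl If.
have := haar_invariant haar_alpha Cg St.
rewrite !rfiber_stability ?(proj1 St) ?(proj2 St) //.
rewrite (cintegral_eq _ (g := fun y => f (gmul t y))); last first.
  by move=> y Sy; rewrite gf //; exact: stability_gmul.
by move=> ->; exact: cintegral_eq.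
Qed.

Lemma sfiber_ginv y : Y y -> X (ginv y).
Proof. by move=> [_ yu]; split => //=; rewrite gsrcV. Qed.
Lemma rfiber_ginv y : X y -> Y (ginv y).
Proof. by move=> [_ yu]; split => //=; rewrite grngV. Qed.
Lemma sfiber_gmul x t : X x -> S t -> X (gmul x t).
Proof. by move=> [_ /= xu] [ts tr]; split => //=; rewrite gsrcM // xu. Qed.

Lemma Ccon_ginv_fiber f : Cc X f -> Ccon Y (fun y => f (ginv y)).
Proof. by apply: Ccon_ginv; [exact: sfiber_ginv|exact: rfiber_ginv]. Qed.

Lemma Ccon_ginv_stability f : Cc S f -> Ccon S (fun y => f (ginv y)).
Proof. by apply: Ccon_ginv; exact: stability_ginv. Qed.

(** Substituting y by z y moves the integral to the fiber over u, which does not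
   depend on z; the dependence on z is then that of the integrand only. *)
Lemma convolution_formula f phi z : Cc setT f -> Cc X phi -> X z ->
  convolution setT lam f phi z =
  cintegral (lam u) Y (fun y => f (gmul z y) * phi (ginv y)).
Proof.
move=> Cf Cphi [_ /= zu].
have cf := Cc_continuous Cf.
have If : Ccon (rfiber setT (grng z)) (fun y => f y * phi (gmul (ginv y) z)).
  have [_ [K [cK _ f0]]] := Cf.
  apply: Ccon_mulr.
    split; first by apply: continuous_subspaceT.
    exists (K `&` rfiber setT (grng z)); split.
    - by apply: compact_closedI => //; exact: closed_rfiber.
    - by move=> x [].
    - by move=> x Yx Kx; apply: f0 => Kx'; apply: Kx.
  apply: (within_Cc_comp Cphi).
    apply: within_gmul; [apply: within_ginv; exact: within_id|exact: within_cst|].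
    by move=> y [_ /= yz]; rewrite gsrcV.
  by move=> y [_ /= yz]; split => //=; rewrite gsrcM // gsrcV.
rewrite /convolution -(lam_invariant If) zu.
apply: cintegral_eq => y [_ /= yu]; congr (_ * phi _).
have zy : gsrc z = grng y by rewrite zu yu.
rewrite ginvM // -gmulA ?gsrcV ?grngV // gmulVg zy -gsrcV; exact: gmulg1.
Qed.

Lemma convolution_off f phi z : Cc X phi -> ~ X z -> convolution setT lam f phi z = 0.
Proof.
move=> Cphi zX; rewrite /convolution -[RHS](cintegral0 (lam (grng z)) (rfiber setT (grng z))).
apply: cintegral_eq => y [_ /= yz]; rewrite (Cc_zero Cphi) ?mulr0 //.
move=> [_ /=]; rewrite gsrcM ?gsrcV // => zu; apply: zX; split => //.
Qed.

Lemma stab_product_formula phi psi h : Cc X phi -> Cc X psi -> S h ->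
  stab_product lam u phi psi h =
  cintegral (lam u) Y (fun y => (phi (ginv y))^* * psi (gmul (ginv y) h)).
Proof.
move=> Cphi Cpsi Sh; rewrite /stab_product patchE ifT ?inE //.
rewrite cintegral_source //; apply: within_mulC.
  apply: within_conj; exact: Cphi.1.
apply: (within_Cc_comp Cpsi); last by move=> y Xy; exact: sfiber_gmul.
apply: within_gmul; [exact: within_id|exact: within_cst|].
by move=> y [_ /= yu]; rewrite yu; case: Sh.
Qed.

Lemma stab_product_off phi psi h : ~ S h -> stab_product lam u phi psi h = 0.
Proof. by move=> Sh; rewrite /stab_product patchE ifF //; apply/negP; rewrite inE. Qed.

Lemma Cc_stab_product phi psi : Cc X phi -> Cc X psi -> Cc S (stab_product lam u phi psi).
Proof.
move=> Cphi Cpsi.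
have [_ [K [cK KX phi0]]] := Cphi; have [_ [L [cL LX psi0]]] := Cpsi.
pose K' := @ginv G @` K.
have cK' : compact K' by exact: compact_ginv.
have KY : K' `<=` Y by move=> _ [x Kx <-]; apply/rfiber_ginv/KX.
split.
  apply: (@within_eq _ _ _ (fun h => cintegral (lam u) K' (fun y => (phi (ginv y))^* * psi (gmul (ginv y) h)))).
    move=> h Sh; rewrite stab_product_formula //.
    apply/esym/cintegral_support => // y Yy Ky; rewrite phi0 ?conjC0 ?mul0r // => Ky'.
    by apply: Ky; exists (ginv y) => //; exact: ginvK.
  apply: (parametric_continuous hG (F := fun h y => (phi (ginv y))^* * psi (gmul (ginv y) h))) => //.
    exact: compact_finite_lam.
  have cy : {within S `*` K', continuous (fun q : G * G => ginv q.2)}.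
    by apply: within_ginv; apply: continuous_subspaceT => q; exact: cvg_snd.
  have cx : {within S `*` K', continuous (fun q : G * G => q.1)}.
    by apply: continuous_subspaceT => q; exact: cvg_fst.
  apply: within_mulC.
    apply: within_conj; apply: (within_Cc_comp Cphi) => // q [_ /KY]; exact: sfiber_ginv.
  apply: (within_Cc_comp Cpsi).
    by apply: within_gmul => // q [[_ q1] /KY[_ /= q2]]; rewrite gsrcV q1.
  by move=> q [q1 /KY/sfiber_ginv q2]; exact: sfiber_gmul.
exists (set_gmul K' L `&` S); split.
- by apply: compact_closedI; [exact: compact_gmul|exact: closed_stability].
- by move=> x [].
move=> h hn; have [Sh|] := pselect (S h); last exact: stab_product_off.
rewrite stab_product_formula // -[RHS](cintegral0 (lam u) Y); apply: cintegral_eq => y [_ /= yu].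
have [Kh|Kh] := pselect (K (ginv y)); last by rewrite phi0 // conjC0 mul0r.
rewrite (psi0 (gmul _ _)) ?mulr0 // => Lh; apply: hn; split => //.
have yh : gsrc (ginv y) = grng h by rewrite gsrcV yu; case: Sh.
rewrite -(gmulKg yh); apply: set_gmul_mem => //; first by exists (ginv y).
by rewrite gsrcV grngM.
Qed.

Lemma Cc_convolution f phi : Cc setT f -> Cc X phi -> Cc X (convolution setT lam f phi).
Proof.
move=> Cf Cphi; have cf := Cc_continuous Cf.
have [_ [K [cK KX phi0]]] := Cphi; have [_ [L [cL _ f0]]] := Cf.
pose K' := @ginv G @` K.
have cK' : compact K' by exact: compact_ginv.
have KY : K' `<=` Y by move=> _ [x Kx <-]; apply/rfiber_ginv/KX.
split.
  apply: (@within_eq _ _ _ (fun z => cintegral (lam u) K' (fun y => f (gmul z y) * phi (ginv y)))).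
    move=> z Xz; rewrite convolution_formula //.
    apply/esym/cintegral_support => // y Yy Ky; rewrite phi0 ?mulr0 // => Ky'.
    by apply: Ky; exists (ginv y) => //; exact: ginvK.
  apply: (parametric_continuous hG (F := fun z y => f (gmul z y) * phi (ginv y))) => //.
    exact: compact_finite_lam.
  have cy : {within X `*` K', continuous (fun q : G * G => q.2)}.
    by apply: continuous_subspaceT => q; exact: cvg_snd.
  have cx : {within X `*` K', continuous (fun q : G * G => q.1)}.
    by apply: continuous_subspaceT => q; exact: cvg_fst.
  apply: within_mulC.
    apply: within_compT cf.
    by apply: within_gmul => // q [[_ q1] /KY[_ /= q2]]; rewrite q1.
  by apply: (within_Cc_comp Cphi); [exact: within_ginv|move=> q [_ /KY]; exact: sfiber_ginv].
exists (set_gmul L K `&` X); split.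
- by apply: compact_closedI; [exact: compact_gmul|exact: closed_sfiber].
- by move=> x [].
move=> z zn; have [Xz|] := pselect (X z); last exact: convolution_off.
rewrite convolution_formula // -[RHS](cintegral0 (lam u) Y); apply: cintegral_eq => y [_ /= yu].
have [Kh|Kh] := pselect (K (ginv y)); last by rewrite phi0 // mulr0.
rewrite f0 ?mul0r // => Lh; apply: zn; split => //.
have zy : gsrc z = grng y by rewrite yu; case: Xz.
rewrite -(gmulgK zy); apply: set_gmul_mem => //.
by rewrite grngV gsrcM.
Qed.

(** * The right action of C_c(G(u)) and the kernel of T_phi T_psi^* *)

(** With T_phi h = phi (x) h, the action satisfies T_phi L(g) = T_(phi . g),
   which is how elements of C*(G(u)) pass through the balanced tensor product.
   *)
Definition right_convolution phi g : G -> C := fun x =>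
  if pselect (X x) then cintegral alpha S (fun t => phi (gmul x t) * g (ginv t)) else 0.

Lemma right_convolutionE phi g x : X x ->
  right_convolution phi g x = cintegral alpha S (fun t => phi (gmul x t) * g (ginv t)).
Proof. by rewrite /right_convolution; case: pselect. Qed.

Lemma Cc_right_convolution phi g : Cc X phi -> Cc S g -> Cc X (right_convolution phi g).
Proof.
move=> Cphi Cg.
have [_ [L [cL LX phi0]]] := Cphi; have [_ [K [cK KS g0]]] := Cg.
pose K' := @ginv G @` K.
have cK' : compact K' by exact: compact_ginv.
have KS' : K' `<=` S by move=> _ [x Kx <-]; apply/stability_ginv/KS.
split.
  apply: (@within_eq _ _ _ (fun x => cintegral alpha K' (fun t => phi (gmul x t) * g (ginv t)))).
    move=> x Xx; rewrite right_convolutionE //.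
    apply/esym/cintegral_support => // y Yy Ky; rewrite g0 ?mulr0 // => Ky'.
    by apply: Ky; exists (ginv y) => //; exact: ginvK.
  apply: (parametric_continuous hG (F := fun x t => phi (gmul x t) * g (ginv t))) => //.
    exact: compact_finite_alpha.
  have cy : {within X `*` K', continuous (fun q : G * G => q.2)}.
    by apply: continuous_subspaceT => q; exact: cvg_snd.
  have cx : {within X `*` K', continuous (fun q : G * G => q.1)}.
    by apply: continuous_subspaceT => q; exact: cvg_fst.
  apply: within_mulC.
    apply: (within_Cc_comp Cphi); last by move=> q [q1 /KS' q2]; exact: sfiber_gmul.
    by apply: within_gmul => // q [[_ q1] /KS'[_ q2]]; rewrite q1.
  by apply: (within_Cc_comp Cg); [exact: within_ginv|move=> q [_ /KS']; exact: stability_ginv].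
exists (set_gmul L K `&` X); split.
- by apply: compact_closedI; [exact: compact_gmul|exact: closed_sfiber].
- by move=> x [].
move=> x xn; rewrite /right_convolution; case: pselect => // Xx.
rewrite -[RHS](cintegral0 alpha S); apply: cintegral_eq => t St.
have [Kh|Kh] := pselect (K (ginv t)); last by rewrite g0 // mulr0.
rewrite phi0 ?mul0r // => Lh; apply: xn; split => //.
have xt : gsrc x = grng t by rewrite (proj2 St); case: Xx.
rewrite -(gmulgK xt); apply: set_gmul_mem => //.
by rewrite grngV gsrcM.
Qed.

(** The kernel on G_u x G_u of zeta |-> phi . <psi, zeta>_*, which represents
   the operator T_phi T_psi^*. *)
Definition fiber_kernel phi psi : G -> G -> C := fun x y =>
  cintegral alpha S (fun t => phi (gmul x t) * (psi (gmul y t))^*).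

Lemma stability_src s : S s -> gsrc s = u. Proof. by case. Qed.
Lemma stability_rng s : S s -> grng s = u. Proof. by case. Qed.
Lemma sfiber_src x : X x -> gsrc x = u. Proof. by case. Qed.
Lemma rfiber_rng x : Y x -> grng x = u. Proof. by case. Qed.

(** The inner product is C_c(G(u))-linear in its second variable: substitute t
   by h t in the integral over G(u) on the right, and exchange the two
   integrals. *)
Lemma stab_product_right_convolution phi psi g : Cc X phi -> Cc X psi -> Cc S g ->
  stab_product lam u psi (right_convolution phi g) =
  convolution S (fun=> alpha) (stab_product lam u psi phi) g.
Proof.
move=> Cphi Cpsi Cg; apply/funext => h.
have Csp := Cc_stab_product Cpsi Cphi.
have fa := compact_finite_alpha; have fl := compact_finite_lam unit_u.
have cS := @closed_stability G hG u; have cY := @closed_rfiber G hG u.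
have [Sh|Sh] := pselect (S h); last first.
  rewrite stab_product_off // /convolution.
  rewrite -[LHS](cintegral0 alpha (rfiber S (grng h))); apply: cintegral_eq => t [St /= th].
  rewrite (Cc_zero Cg) ?mulr0 // => -[]; rewrite gsrcM ?gsrcV // => sh _; apply: Sh.
  by split => //=; rewrite -th (stability_rng St).
rewrite stab_product_formula //; last exact: Cc_right_convolution.
rewrite /convolution rfiber_stability ?(stability_rng Sh) //.
pose F t := stab_product lam u psi phi t * g (gmul (ginv t) h).
have IF : Ccon S F.
  apply: Ccon_mulr; first exact: Cc_Ccon.
  apply: (within_Cc_comp Cg); last by move=> t St; apply: stability_gmul => //; exact: stability_ginv.
  apply: within_gmul; [apply: within_ginv; exact: within_id|exact: within_cst|].
  by move=> t St; rewrite gsrcV (stability_rng St) (stability_rng Sh).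
rewrite -/F -(alpha_invariant Sh IF) /F.
rewrite (cintegral_eq _ (g := fun y => cintegral alpha S (fun t =>
    (psi (ginv y))^* * phi (gmul (ginv y) (gmul h t)) * g (ginv t)))); last first.
  move=> y Yy; have Xy := sfiber_ginv Yy.
  rewrite right_convolutionE; last exact: sfiber_gmul.
  rewrite -cintegralZ //; last first.
    apply: Ccon_mull; last exact: Ccon_ginv_stability.
    apply: (within_Cc_comp Cphi); last by move=> t St; exact: sfiber_gmul (sfiber_gmul Xy Sh) St.
    apply: within_gmul; [exact: within_cst|exact: within_id|].
    by move=> t St; rewrite gsrcM ?(stability_src Sh) ?(stability_rng St) // (sfiber_src Xy) (stability_rng Sh).
  apply: cintegral_eq => t St; rewrite mulrA gmulA ?(sfiber_src Xy) ?(stability_rng Sh) ?(stability_src Sh) ?(stability_rng St) //.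
have [_ [K [cK KX psi0]]] := Ccon_ginv_fiber Cpsi; have [_ [L [cL LS g0]]] := Ccon_ginv_stability Cg.
rewrite (cintegral_fubini hG sG (K1 := K) (K2 := L)) //; first last.
- by move=> y t Yy St Lt; rewrite g0 // mulr0.
- by move=> y t Yy St Ky; rewrite psi0 // conjC0 !mul0r.
- have cy : {within K `*` L, continuous (fun q : G * G => ginv q.1)}.
    by apply: within_ginv; apply: continuous_subspaceT => q; exact: cvg_fst.
  have ct : {within K `*` L, continuous (fun q : G * G => q.2)}.
    by apply: continuous_subspaceT => q; exact: cvg_snd.
  apply: within_mulC; first apply: within_mulC.
  + by apply: within_conj; apply: (within_Cc_comp Cpsi) => // q [/KX q1 _]; exact: sfiber_ginv.
  + apply: (within_Cc_comp Cphi); last by move=> q [/KX/sfiber_ginv q1 /LS q2]; exact: sfiber_gmul q1 (stability_gmul Sh q2).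
    apply: within_gmul => //.
      apply: within_gmul => //; first exact: within_cst.
      by move=> q [_ /LS q2]; rewrite (stability_src Sh) (stability_rng q2).
    by move=> q [/KX/sfiber_ginv q1 /LS q2]; rewrite (sfiber_src q1) (stability_rng (stability_gmul Sh q2)).
  + by apply: (within_Cc_comp Cg); [exact: within_ginv|move=> q [_ /LS]; exact: stability_ginv].
apply: cintegral_eq => t St.
have -> : gmul (ginv (gmul h t)) h = ginv t.
  rewrite ginvM ?(stability_src Sh) ?(stability_rng St) // -gmulA ?gsrcV ?grngV ?(stability_rng St) ?(stability_src Sh) //.
  by rewrite gmulVg (stability_src Sh) -(stability_rng St) -gsrcV gmulg1.
rewrite stab_product_formula //; last exact: stability_gmul.
rewrite mulrC -cintegralZ //; first by apply: cintegral_eq => y _; rewrite mulrC.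
have cg : {within Y, continuous (fun y => phi (gmul (ginv y) (gmul h t)))}.
  apply: (within_Cc_comp Cphi); last by move=> y /sfiber_ginv Xy; apply: sfiber_gmul => //; exact: stability_gmul.
  apply: within_gmul; [apply: within_ginv; exact: within_id|exact: within_cst|].
  by move=> y Yy; rewrite gsrcV (rfiber_rng Yy) (stability_rng (stability_gmul Sh St)).
exact: (Ccon_mulr (Ccon_conj (Ccon_ginv_fiber Cpsi)) cg).
Qed.

(** Substituting y by t y in the integral that defines <psi, zeta>_* (t^-1)
   moves the variable t from zeta to psi; then exchange the two integrals. *)
Lemma right_convolution_stab_product phi psi zeta x :
  Cc X phi -> Cc X psi -> Cc X zeta -> X x ->
  right_convolution phi (stab_product lam u psi zeta) x =
  cintegral (lam u) Y (fun y => fiber_kernel phi psi x (ginv y) * zeta (ginv y)).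
Proof.
move=> Cphi Cpsi Czeta Xx; rewrite right_convolutionE //.
have fa := compact_finite_alpha; have fl := compact_finite_lam unit_u.
have cS := @closed_stability G hG u; have cY := @closed_rfiber G hG u.
have [_ [K [cK KY zeta0]]] := Ccon_ginv_fiber Czeta.
have [_ [L' [cL' LX phi0]]] := Cphi.
pose L := set_gmul [set ginv x] L' `&` S.
have cL : compact L.
  by apply: compact_closedI => //; apply: compact_gmul => //; exact: compact_set1.
have LS : L `<=` S by move=> t [].
have phiL t : S t -> ~ L t -> phi (gmul x t) = 0.
  move=> St Lt; apply: phi0 => Lxt; apply: Lt; split => //.
  have xt : gsrc x = grng t by rewrite (sfiber_src Xx) (stability_rng St).
  by rewrite -(gmulKg xt); apply: set_gmul_mem => //; rewrite gsrcV grngM.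
rewrite (cintegral_eq _ (g := fun t => cintegral (lam u) Y (fun y =>
    phi (gmul x t) * (psi (gmul (ginv y) t))^* * zeta (ginv y)))); last first.
  move=> t St.
  pose F y := (psi (gmul (ginv y) t))^* * zeta (ginv y).
  have IF : Ccon Y F.
    apply: Ccon_mull; last exact: Ccon_ginv_fiber.
    apply: within_conj; apply: (within_Cc_comp Cpsi); last by move=> y /sfiber_ginv Xy; exact: sfiber_gmul.
    apply: within_gmul; [apply: within_ginv; exact: within_id|exact: within_cst|].
    by move=> y Yy; rewrite gsrcV (rfiber_rng Yy) (stability_rng St).
  have IF' : Ccon (rfiber setT (grng t)) F by rewrite (stability_rng St).
  have := lam_invariant IF'; rewrite (stability_rng St) (stability_src St) => e.
  rewrite stab_product_formula //; last exact: stability_ginv.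
  transitivity (phi (gmul x t) * cintegral (lam u) Y F).
    congr (_ * _); rewrite -e; apply: cintegral_eq => y Yy.
    have ty : gsrc t = grng y by rewrite (stability_src St) (rfiber_rng Yy).
    rewrite /F ginvM //; congr (_ * _); congr (_^*); congr psi.
    rewrite -gmulA ?gsrcV ?grngV // gmulVg.
    by rewrite (stability_src St) -(sfiber_src (sfiber_ginv Yy)) gmulg1.
  rewrite -cintegralZ //; apply: cintegral_eq => y _; exact: mulrA.
rewrite (cintegral_fubini hG sG (K1 := L) (K2 := K)) //; first last.
- by move=> t y St Yy Ky; rewrite zeta0 // mulr0.
- by move=> t y St Yy Lt; rewrite phiL // !mul0r.
- have ct : {within L `*` K, continuous (fun q : G * G => q.1)}.
    by apply: continuous_subspaceT => q; exact: cvg_fst.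
  have cy : {within L `*` K, continuous (fun q : G * G => ginv q.2)}.
    by apply: within_ginv; apply: continuous_subspaceT => q; exact: cvg_snd.
  apply: within_mulC; first apply: within_mulC.
  + apply: (within_Cc_comp Cphi); last by move=> q [/LS q1 _]; exact: sfiber_gmul.
    apply: within_gmul => //; first exact: within_cst.
    by move=> q [/LS q1 _]; rewrite (sfiber_src Xx) (stability_rng q1).
  + apply: within_conj; apply: (within_Cc_comp Cpsi); last by move=> q [/LS q1 /KY/sfiber_ginv q2]; exact: sfiber_gmul.
    by apply: within_gmul => // q [/LS q1 /KY/sfiber_ginv q2]; rewrite (sfiber_src q2) (stability_rng q1).
  + by apply: (within_Cc_comp Czeta) => // q [_ /KY/sfiber_ginv].
apply: cintegral_eq => y Yy; rewrite /fiber_kernel mulrC -cintegralZ //.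
  by apply: cintegral_eq => t _; rewrite mulrC.
apply: Ccon_mulr.
  split; last by exists L; split.
  apply: (within_Cc_comp Cphi); last by move=> t St; exact: sfiber_gmul.
  apply: within_gmul; [exact: within_cst|exact: within_id|].
  by move=> t St; rewrite (sfiber_src Xx) (stability_rng St).
have Xy := sfiber_ginv Yy.
apply: within_conj; apply: (within_Cc_comp Cpsi); last by move=> t St; exact: sfiber_gmul.
apply: within_gmul; [exact: within_cst|exact: within_id|].
by move=> t St; rewrite (sfiber_src Xy) (stability_rng St).
Qed.

(** * Invariant functions on G_u *)

Definition stab_invariant (b : G -> R) := forall x t, X x -> S t -> b (gmul x t) = b x.

Definition scaled (b : G -> R) phi : G -> C := fun x => (b x)%:C%C * phi x.

Lemma Cc_scaled (b : G -> R) phi : {within X, continuous b} -> Cc X phi -> Cc X (scaled b phi).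
Proof.
move=> cb [cphi [K [cK KX phi0]]]; split.
  exact: (within_mulC (within_RtoC cb) cphi).
by exists K; split => // x Kx; rewrite /scaled phi0 // mulr0.
Qed.

(** Invariance gives b(y) b(y h) = b(y)^2 under the integral, so that
   multiplication by the functions b and c with b^2 + c^2 = 1 splits the inner
   product. This makes multiplication by b a contraction of the induced space.
   *)
Lemma stab_product_scaled (b c : G -> R) phi psi :
  {within X, continuous b} -> {within X, continuous c} ->
  stab_invariant b -> stab_invariant c ->
  (forall x, X x -> b x ^+ 2 + c x ^+ 2 = 1) -> Cc X phi -> Cc X psi ->
  stab_product lam u phi psi =
  fun h => 1 * stab_product lam u (scaled b phi) (scaled b psi) h +
    stab_product lam u (scaled c phi) (scaled c psi) h.
Proof.
move=> cb cc ib ic bc Cphi Cpsi; apply/funext => h; rewrite mul1r.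
have [Sh|Sh] := pselect (S h); last by rewrite !stab_product_off // addr0.
rewrite !stab_product_formula //; try exact: Cc_scaled.
have fl := compact_finite_lam unit_u; have cY := @closed_rfiber G hG u.
have I phi' psi' : Cc X phi' -> Cc X psi' ->
    Ccon Y (fun y => (phi' (ginv y))^* * psi' (gmul (ginv y) h)).
  move=> Cp Cq; apply: (Ccon_mulr (Ccon_conj (Ccon_ginv_fiber Cp))).
  apply: (within_Cc_comp Cq); last by move=> y /sfiber_ginv Xy; exact: sfiber_gmul.
  apply: within_gmul; [apply: within_ginv; exact: within_id|exact: within_cst|].
  by move=> y Yy; rewrite gsrcV (rfiber_rng Yy) (stability_rng Sh).
rewrite -cintegralD //; [|exact: (I _ _ (Cc_scaled cb Cphi) (Cc_scaled cb Cpsi))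
  |exact: (I _ _ (Cc_scaled cc Cphi) (Cc_scaled cc Cpsi))].
apply: cintegral_eq => y /sfiber_ginv Xy; rewrite /scaled ib // ic //.
have re (r : R) : ((r%:C)%C : C)^* = (r%:C)%C by apply/CrealP; rewrite complex_real.
rewrite !rmorphM /= !re -[LHS]mul1r -(rmorph1 (real_complex R)) -(bc _ Xy).
rewrite rmorphD !rmorphXn /=; ring.
Qed.

Lemma factor_on {T U V : Type} (v0 : V) (K : set T) (p : T -> U) (f : T -> V) :
  (forall x y, K x -> K y -> p x = p y -> f x = f y) ->
  exists g : U -> V, forall x, K x -> g (p x) = f x.
Proof.
move=> h.
exists (fun w => if pselect (exists x, K x /\ p x = w) is left e then f (projT1 (cid e)) else v0).
move=> x Kx; case: pselect => [e|[]]; last by exists x.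
by case: (cid e) => y [Ky yx] /=; exact: h.
Qed.

Lemma same_range x y : X x -> X y -> grng x = grng y ->
  S (gmul (ginv x) y) /\ gmul x (gmul (ginv x) y) = y.
Proof.
move=> Xx Xy xy; split; last exact: gmulVKg.
by split; rewrite ?gsrcM ?grngM ?gsrcV ?grngV ?(sfiber_src Xx) ?(sfiber_src Xy).
Qed.

(** Elements of G_u with the same range differ by an element of G(u), so the
   range map is injective on G_u / G(u). On the compact set Q it is a quotient
   map onto its image, and Tietze extends the resulting function from r(Q) to G.
   *)
Lemma stab_invariant_factor (b : G -> R) (Q : set G) : {within X, continuous b} ->
  stab_invariant b -> (forall x, X x -> 0 <= b x <= 1) -> compact Q -> Q `<=` X ->
  exists b' : G -> R, [/\ continuous b', forall x, 0 <= b' x <= 1 &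
    forall x, Q x -> b' (grng x) = b x].
Proof.
move=> cb ib b01 cQ QX.
have [|b1 hb1] := @factor_on _ _ _ 0 Q (@grng G) b.
  move=> x y Qx Qy xy; have [St <-] := same_range (QX _ Qx) (QX _ Qy) xy.
  by rewrite ib //; exact: QX.
have cr : {within Q, continuous (@grng G)} by apply: continuous_subspaceT; exact: grng_continuous.
have cb1 : {within @grng G @` Q, continuous b1}.
  apply: compact_quotient => //.
  by apply: within_eq (continuous_subspaceW QX cb) => x Qx; rewrite hb1.
have [|f [cf fb f1]] := tietze_compact hG lG (continuous_compact cr cQ) ltr01 cb1.
  move=> _ [x Qx <-]; rewrite hb1 //; have /andP[b0 b1'] := b01 _ (QX _ Qx).
  by rewrite ger0_norm.
exists (fun x => `|f x|); split.
- by move=> x; apply: cvg_norm; exact: cf.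
- by move=> x; rewrite normr_ge0 f1.
- move=> x Qx; have e : f (grng x) = b x by rewrite fb ?hb1 //; exists x.
  by rewrite e ger0_norm //; have /andP[] := b01 _ (QX _ Qx).
Qed.

Lemma alpha_gt0 U : open U -> U u -> (0 < alpha (S `&` U))%E.
Proof.
move=> oU Uu; apply: concentrated_gt0 => //; first exact: closed_stability.
  by rewrite -(rfiber_stability erefl); apply: (haar_concentrated haar_alpha stability_unit).
apply: (haar_full haar_alpha stability_unit) => //; exists u; split => //.
by rewrite rfiber_stability //; exact: (proj1 stability_unit).
Qed.

Lemma lam_gt0 U : open U -> U u -> (0 < lam u (Y `&` U))%E.
Proof.
have uT : ([set: G] `&` units) u by [].
move=> oU Uu; apply: concentrated_gt0 => //; first exact: closed_rfiber.
  exact: (haar_concentrated haar_lam uT).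
apply: (haar_full haar_lam uT) => //; exists u; split => //; split => //=.
exact: unit_rng.
Qed.

(** Averaging a cutoff function over G(u) gives an invariant continuous function
   that is positive on D; scale it and truncate it at 1. Its support modulo G(u)
   is compact, which is expressed by the existence of E. *)
Lemma invariant_bump (D : set G) : compact D -> D `<=` X ->
  exists (b : G -> R) (E : set G), [/\ {within X, continuous b}, stab_invariant b,
    forall x, X x -> 0 <= b x <= 1, forall x, D x -> b x = 1 &
    [/\ compact E, E `<=` X & forall x, X x -> b x != 0 -> exists2 t, S t & E (gmul x t)]].
Proof.
move=> cD DX.
have [theta [ct t01 t1 _ [C0 cC0 t0]]] := @cutoff R _ hG lG D setT cD openT (@subsetT _ _).
pose E := C0 `&` X.
have cX := @closed_sfiber G hG u; have cS := @closed_stability G hG u.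
have cE : compact E by exact: compact_closedI.
have EX : E `<=` X by move=> x [].
have fa := compact_finite_alpha.
have cT (P : topologicalType) (A : set P) (p : P -> G) : {within A, continuous p} ->
    {within A, continuous (fun a => (theta (p a))%:C%C : C)}.
  by move=> cp; exact: (within_RtoC (within_compT cp ct)).
have cm x : X x -> {within S, continuous (fun t => gmul x t)}.
  move=> Xx; apply: within_gmul; [exact: within_cst|exact: within_id|].
  by move=> t St; rewrite (sfiber_src Xx) (stability_rng St).
pose F x t : C := (theta (gmul x t))%:C%C.
pose L (Q : set G) := set_gmul (@ginv G @` Q) E `&` S.
have cL Q : compact Q -> compact (L Q).
  by move=> cQ; apply: compact_closedI => //; apply: compact_gmul => //; exact: compact_ginv.
have LS Q : L Q `<=` S by move=> t [].
have F0 Q x t : Q `<=` X -> Q x -> S t -> ~ L Q t -> F x t = 0.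
  move=> QX Qx St Lt; rewrite /F t0 // => Ct; apply: Lt; split => //.
  have xt : gsrc x = grng t by rewrite (sfiber_src (QX _ Qx)) (stability_rng St).
  rewrite -(gmulKg xt); apply: set_gmul_mem; [by exists x| |by rewrite gsrcV grngM].
  by split => //; apply: sfiber_gmul => //; exact: QX.
have IF x : X x -> Ccon S (F x).
  move=> Xx; split; first exact: (cT _ _ _ (cm x Xx)).
  exists (L [set x]); split => //; first by apply: cL; exact: compact_set1.
  by move=> t St; apply: F0 => // y ->.
pose B x : R := complex.Re (cintegral alpha S (F x)).
have cB0 : {within X, continuous (fun x => cintegral alpha S (F x))}.
  apply: within_closed_of_compact => // Q cQ QX.
  apply: (@within_eq _ _ _ (fun x => cintegral alpha (L Q) (F x))).
    by move=> x Qx; apply/esym/cintegral_support => // t St; exact: F0.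
  apply: parametric_continuous => //; first exact: cL.
  apply: (cT _ _ (fun q => gmul q.1 q.2)); apply: within_gmul.
  - by apply: continuous_subspaceT => q; exact: cvg_fst.
  - by apply: continuous_subspaceT => q; exact: cvg_snd.
  - by move=> q [/QX q1 /LS q2]; rewrite (sfiber_src q1) (stability_rng q2).
have cB : {within X, continuous B} by exact: (within_Re cB0).
have iB : stab_invariant B.
  move=> x t Xx St; rewrite /B -(alpha_invariant St (IF x Xx)); congr complex.Re.
  apply: cintegral_eq => t' St'; rewrite /F gmulA ?(sfiber_src Xx) ?(stability_src St) ?(stability_rng St) ?(stability_rng St') //.
have BD x : D x -> 0 < B x.
  move=> Dx; have Xx := DX _ Dx.
  have [iR _] := Ccon_integrable hG fa cS (IF x Xx).
  apply: (@Rintegral_gt0 R G alpha S _ u) => //.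
  - by apply: within_Re; case: (IF x Xx).
  - by move=> t _ /=; case/andP: (t01 (gmul x t)).
  - exact: (proj1 stability_unit).
  - by rewrite /F /= -(sfiber_src Xx) gmulg1 t1.
  - exact: alpha_gt0.
have cBD : {within D, continuous (fun x => (B x)^-1)}.
  apply/subspace_continuousP => x Dx; apply: cvgV; first by rewrite gt_eqF // BD.
  by have /subspace_continuousP := continuous_subspaceW DX cB; apply.
have [M M0 hM] := compact_fun_bounded cD cBD.
(* M bounds 1 / B on D, so that M * B is at least 1 there. *)
pose b x : R := Num.min 1 (M * B x).
have B0 x : 0 <= B x.
  by apply: Rintegral_ge0 => t _ /=; case/andP: (t01 (gmul x t)).
exists b, E; split.
- move=> x; apply: (@continuous_min R (subspace X) (fun=> 1) (fun x => M * B x)).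
    exact: cvg_cst.
  by apply: cvgM; [exact: cvg_cst|exact: cB].
- by move=> x t Xx St; rewrite /b iB.
- by move=> x _; rewrite /b le_min ler01 ge_min lexx mulr_ge0 // ltW.
- move=> x Dx; apply/eqP; rewrite eq_minl -ler_pdivrMr ?BD // mul1r.
  by apply: le_trans (hM _ Dx); exact: ler_norm.
- split => // x Xx bx; apply: contrapT => hn.
  move: bx; rewrite /b (_ : B x = 0) ?mulr0; last first.
    rewrite /B (cintegral_eq _ (g := fun=> 0)) ?cintegral0 // => t St; rewrite /F t0 // => Ct.
    by apply: hn; exists t => //; split => //; exact: sfiber_gmul.
  by rewrite minEle ler10 eqxx.
Qed.

(** * The kernel as a function on G *)

Lemma kernel_Ccon phi psi x y : Cc X phi -> Cc X psi -> X x -> X y ->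
  Ccon S (fun t => phi (gmul x t) * (psi (gmul y t))^*).
Proof.
move=> Cphi Cpsi Xx Xy.
have cm z : X z -> {within S, continuous (fun t => gmul z t)}.
  move=> Xz; apply: within_gmul; [exact: within_cst|exact: within_id|].
  by move=> t St; rewrite (sfiber_src Xz) (stability_rng St).
have cphi := within_Cc_comp Cphi (cm _ Xx) (fun t => @sfiber_gmul x t Xx).
have cpsi := within_conj (within_Cc_comp Cpsi (cm _ Xy) (fun t => @sfiber_gmul y t Xy)).
suff I : Ccon S (fun t => phi (gmul x t)) by exact: (Ccon_mulr I cpsi).
split; first exact: cphi.
have [_ [K [cK KX phi0]]] := Cphi.
exists (set_gmul [set ginv x] K `&` S); split.
- apply: compact_closedI; last exact: closed_stability.
  by apply: compact_gmul => //; exact: compact_set1.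
- by move=> t [].
move=> t St Lt; apply: phi0 => Kt; apply: Lt; split => //.
have xt : gsrc x = grng t by rewrite (sfiber_src Xx) (stability_rng St).
by rewrite -(gmulKg xt); apply: set_gmul_mem => //; rewrite gsrcV grngM.
Qed.

Lemma kernel_invariant phi psi x y s : Cc X phi -> Cc X psi -> X x -> X y -> S s ->
  fiber_kernel phi psi (gmul x s) (gmul y s) = fiber_kernel phi psi x y.
Proof.
move=> Cphi Cpsi Xx Xy Ss; rewrite /fiber_kernel.
rewrite -(alpha_invariant Ss (kernel_Ccon Cphi Cpsi Xx Xy)).
by apply: cintegral_eq => t St; rewrite !gmulA ?(sfiber_src Xx) ?(sfiber_src Xy) ?(stability_src Ss) ?(stability_rng Ss) ?(stability_rng St).
Qed.

Lemma kernel_neq0 phi psi x y : fiber_kernel phi psi x y != 0 ->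
  exists t, [/\ S t, phi (gmul x t) != 0 & psi (gmul y t) != 0].
Proof.
move=> k0; apply: contrapT => hn; case/negP: k0; apply/eqP.
rewrite /fiber_kernel -[RHS](cintegral0 alpha S); apply: cintegral_eq => t St.
have [->|p0] := eqVneq (phi (gmul x t)) 0; first by rewrite mul0r.
have [->|q0] := eqVneq (psi (gmul y t)) 0; first by rewrite conjC0 mulr0.
by case: hn; exists t.
Qed.

Lemma kernel_continuous phi psi (Q : set G) : Cc X phi -> Cc X psi ->
  compact Q -> Q `<=` X ->
  {within Q `*` Q, continuous (fun q : G * G => fiber_kernel phi psi q.1 q.2)}.
Proof.
move=> Cphi Cpsi cQ QX; have [_ [K [cK KX phi0]]] := Cphi.
pose L := set_gmul (@ginv G @` Q) K `&` S.
have cL : compact L.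
  apply: compact_closedI; last exact: closed_stability.
  by apply: compact_gmul => //; exact: compact_ginv.
have LS : L `<=` S by move=> t [].
apply: (@within_eq _ _ _ (fun q : G * G => cintegral alpha L (fun t => phi (gmul q.1 t) * (psi (gmul q.2 t))^*))).
  move=> [x y] /= [Qx Qy]; apply/esym/cintegral_support => // t St Lt.
  rewrite phi0 ?mul0r // => Kt; apply: Lt; split => //.
  have xt : gsrc x = grng t by rewrite (sfiber_src (QX _ Qx)) (stability_rng St).
  by rewrite -(gmulKg xt); apply: set_gmul_mem => //; rewrite ?gsrcV ?grngM //; exists x.
apply: (parametric_continuous hG (F := fun (q : G * G) t => phi (gmul q.1 t) * (psi (gmul q.2 t))^*)) => //.
  exact: compact_finite_alpha.
have c1 : {within (Q `*` Q) `*` L, continuous (fun p : G * G * G => p.1.1)}.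
  by apply: continuous_subspaceT => p; apply: cvg_comp; [exact: cvg_fst|exact: cvg_fst].
have c2 : {within (Q `*` Q) `*` L, continuous (fun p : G * G * G => p.1.2)}.
  by apply: continuous_subspaceT => p; apply: cvg_comp; [exact: cvg_fst|exact: cvg_snd].
have c3 : {within (Q `*` Q) `*` L, continuous (fun p : G * G * G => p.2)}.
  by apply: continuous_subspaceT => p; exact: cvg_snd.
have m1 : {within (Q `*` Q) `*` L, continuous (fun p : G * G * G => phi (gmul p.1.1 p.2))}.
  apply: (within_Cc_comp Cphi); last by move=> p [[/QX p1 _] /LS p2]; exact: sfiber_gmul.
  by apply: within_gmul => // p [[/QX p1 _] /LS p2]; rewrite (sfiber_src p1) (stability_rng p2).
have m2 : {within (Q `*` Q) `*` L, continuous (fun p : G * G * G => psi (gmul p.1.2 p.2))}.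
  apply: (within_Cc_comp Cpsi); last by move=> p [[_ /QX p1] /LS p2]; exact: sfiber_gmul.
  by apply: within_gmul => // p [[_ /QX p1] /LS p2]; rewrite (sfiber_src p1) (stability_rng p2).
exact: (within_mulC m1 (within_conj m2)).
Qed.

(** If x y^-1 = x' y'^-1 then (x', y') = (x s, y s) for some s in G(u), and the
   kernel is invariant under this diagonal action. On the compact set Q x Q the
   kernel is therefore a continuous function of x y^-1, which Tietze and a
   cutoff function chi extend to f in C_c(G). If b does not vanish at x and y,
   and chi does not vanish at x y^-1, then (x, y) can be translated into Q x Q.
   For all other pairs both sides are 0, which is where the factors b are
   needed: f is not controlled off the image of Q x Q. *)
Lemma kernel_realization phi psi : Cc X phi -> Cc X psi ->
  exists (b : G -> R) (f : G -> C), [/\ {within X, continuous b}, stab_invariant b,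
    forall x, X x -> 0 <= b x <= 1, Cc setT f &
    forall x y, X x -> X y ->
      fiber_kernel phi psi x y = (b x)%:C%C * (f (gmul x (ginv y)) * (b y)%:C%C)].
Proof.
move=> Cphi Cpsi.
have [_ [K1 [cK1 K1X phi0]]] := Cphi; have [_ [K2 [cK2 K2X psi0]]] := Cpsi.
pose D := K1 `|` K2.
have cD : compact D by exact: compactU.
have DX : D `<=` X by move=> x []; [exact: K1X|exact: K2X].
have [b [E [cb ib b01 bD [cE EX bE]]]] := invariant_bump cD DX.
pose P := set_gmul D (@ginv G @` D).
have cP : compact P by apply: compact_gmul => //; exact: compact_ginv.
have [chi [cchi _ chi1 _ [W cW chi0]]] := @cutoff R _ hG lG P setT cP openT (@subsetT _ _).
(* If e1 and e2 are in E and x1 e2^-1 is in W, with e1 and x1 of the same range,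
   then e1^-1 x1 is in T. *)
pose T := set_gmul (set_gmul (@ginv G @` E) W) E `&` S.
have cT : compact T.
  apply: compact_closedI; last exact: closed_stability.
  by do 2!apply: compact_gmul => //; exact: compact_ginv.
pose Q := E `|` set_gmul E T.
have cQ : compact Q by apply: compactU => //; exact: compact_gmul.
have QX : Q `<=` X.
  move=> x [/EX //|[[e t] /= [[Ee [_ St]] _] <-]]; apply: sfiber_gmul => //; exact: EX.
pose p (q : G * G) := gmul q.1 (ginv q.2).
have cp : {within Q `*` Q, continuous p}.
  apply: within_gmul.
  - by apply: continuous_subspaceT => q; exact: cvg_fst.
  - by apply: within_ginv; apply: continuous_subspaceT => q; exact: cvg_snd.
  - by move=> q [/QX q1 /QX q2]; rewrite grngV (sfiber_src q1) (sfiber_src q2).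
have [|k hk] := @factor_on _ _ _ 0 (Q `*` Q) p (fun q : G * G => fiber_kernel phi psi q.1 q.2).
  move=> [x y] [x' y'] [/QX /= Xx /QX /= Xy] [/QX /= Xx' /QX /= Xy'] e.
  rewrite /p /= in e.
  have sxy : gsrc x = grng (ginv y) by rewrite grngV (sfiber_src Xx) (sfiber_src Xy).
  have sxy' : gsrc x' = grng (ginv y') by rewrite grngV (sfiber_src Xx') (sfiber_src Xy').
  have rxx : grng x = grng x' by rewrite -(grngM _ _ sxy) -(grngM _ _ sxy') e.
  have [Ss xs] := same_range Xx Xx' rxx; set s := gmul _ x' in Ss xs.
  have <- : gmul y s = y'.
    have e' : ginv y = gmul s (ginv y').
      rewrite -(gmulKg sxy) e /s gmulA ?gsrcV // .
    rewrite -[y]ginvK e' ginvM ?(stability_src Ss) ?grngV ?(sfiber_src Xy') // ginvK.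
    by apply: gmulgVK; rewrite (sfiber_src Xy') (stability_src Ss).
  by rewrite -xs kernel_invariant.
have ck : {within p @` (Q `*` Q), continuous k}.
  apply: compact_quotient => //; first exact: compact_setX.
  by apply: within_eq (kernel_continuous Cphi Cpsi cQ QX) => q Qq; rewrite hk.
have cpQ : compact (p @` (Q `*` Q)).
  by apply: continuous_compact => //; exact: compact_setX.
have [M1 M10 kM1] := compact_fun_bounded cpQ (within_Re ck).
have [M2 M20 kM2] := compact_fun_bounded cpQ (within_Im ck).
have [g1 [cg1 g1k _]] := tietze_compact hG lG cpQ M10 (within_Re ck) kM1.
have [g2 [cg2 g2k _]] := tietze_compact hG lG cpQ M20 (within_Im ck) kM2.
pose f z : C := (chi z)%:C%C * (g1 z +i* g2 z)%C.
have fk z : (p @` (Q `*` Q)) z -> f z = (chi z)%:C%C * k z.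
  by move=> Qz; rewrite /f g1k // g2k //; case: (k z).
have Cf : Cc setT f.
  apply: CcTP; last by exists W => // z /chi0; rewrite /f => ->; rewrite mul0r.
  apply/continuous_subspace_setT.
  exact: (within_mulC (within_RtoC (continuous_subspaceT cchi))
    (within_ReIm (continuous_subspaceT cg1) (continuous_subspaceT cg2))).
have kD x y : X x -> X y -> fiber_kernel phi psi x y != 0 ->
    [/\ b x = 1, b y = 1 & P (gmul x (ginv y))].
  move=> Xx Xy /kernel_neq0[t [St px qy]].
  have D1 : D (gmul x t) by left; apply: contrapT => /phi0 p0; rewrite p0 eqxx in px.
  have D2 : D (gmul y t) by right; apply: contrapT => /psi0 p0; rewrite p0 eqxx in qy.
  split; [by rewrite -(ib _ _ Xx St) bD|by rewrite -(ib _ _ Xy St) bD|].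
  have xt : gsrc x = grng t by rewrite (sfiber_src Xx) (stability_rng St).
  have yt : gsrc y = grng t by rewrite (sfiber_src Xy) (stability_rng St).
  have -> : gmul x (ginv y) = gmul (gmul x t) (ginv (gmul y t)).
    rewrite ginvM // gmulA ?grngV ?gsrcM ?gsrcV // gmulgK //.
  by apply: set_gmul_mem => //; rewrite grngV !gsrcM.
exists b, f; split => // x y Xx Xy.
have kb : b x = 0 \/ b y = 0 -> fiber_kernel phi psi x y = 0.
  move=> h; apply: contrapT => /eqP /(kD _ _ Xx Xy)[b1 b2 _].
  by move: h; rewrite b1 b2 => -[] /eqP; rewrite oner_eq0.
have [bx|bx] := eqVneq (b x) 0; first by rewrite kb ?bx ?mul0r //; left.
have [by0|by0] := eqVneq (b y) 0; first by rewrite kb ?by0 ?mulr0 //; right.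
have [s1 Ss1 E1] := bE _ Xx bx; have [s2 Ss2 E2] := bE _ Xy by0.
set e1 := gmul x s1 in E1; set e2 := gmul y s2 in E2.
have Xe1 := EX _ E1; have Xe2 := EX _ E2.
(* Translation by s2 moves y into E; x1 then lies in E T as soon as z is in W.
   *)
pose x1 := gmul x s2.
have Xx1 : X x1 by exact: sfiber_gmul.
have xs2 : gsrc x = grng s2 by rewrite (sfiber_src Xx) (stability_rng Ss2).
have ys2 : gsrc y = grng s2 by rewrite (sfiber_src Xy) (stability_rng Ss2).
have xs1 : gsrc x = grng s1 by rewrite (sfiber_src Xx) (stability_rng Ss1).
have exy : gmul x (ginv y) = gmul x1 (ginv e2).
  by rewrite /x1 /e2 ginvM // gmulA ?grngV ?gsrcM ?gsrcV // gmulgK.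
have eK : fiber_kernel phi psi x y = fiber_kernel phi psi x1 e2.
  by rewrite /x1 /e2 kernel_invariant.
have [re1x1 xe] : S (gmul (ginv e1) x1) /\ gmul e1 (gmul (ginv e1) x1) = x1.
  by apply: same_range => //; rewrite /e1 /x1 !grngM.
set t := gmul (ginv e1) x1 in re1x1 xe.
set z := gmul x (ginv y) in exy kD *.
have x1e2 : gsrc x1 = grng (ginv e2) by rewrite grngV (sfiber_src Xx1) (sfiber_src Xe2).
have [Wz|Wz] := pselect (W z).
  have Tt : T t.
    split => //; have -> : t = gmul (gmul (ginv e1) z) e2.
      rewrite exy gmulA ?gsrcV /e1 ?grngM // -/e1 gmulgVK //.
      by rewrite gsrcM ?(sfiber_src Xx1) ?(sfiber_src Xe2) // gsrcV /e1 /x1 !grngM.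
    have e1z : gsrc (ginv e1) = grng z by rewrite gsrcV exy grngM // /e1 /x1 !grngM.
    have ze2 : gsrc z = grng e2 by rewrite exy gsrcM // gsrcV.
    apply: set_gmul_mem => //; last by rewrite gsrcM.
    by apply: set_gmul_mem => //.
  have Qx1 : Q x1.
    right; rewrite -xe; apply: set_gmul_mem => //.
    by rewrite (sfiber_src Xe1) (stability_rng re1x1).
  have Qe2 : Q e2 by left.
  have -> : f z = (chi z)%:C%C * fiber_kernel phi psi x y.
    by rewrite eK -(hk (x1, e2)) // /p /= -exy fk //; exists (x1, e2).
  have [->|k0] := eqVneq (fiber_kernel phi psi x y) 0; first by rewrite mulr0 mul0r mulr0.
  by have [-> -> Pz] := kD _ _ Xx Xy k0; rewrite chi1 // mulr1 !mul1r.
have -> : f z = 0 by rewrite /f chi0 // mul0r.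
rewrite mul0r mulr0; apply: contrapT => /eqP /(kD _ _ Xx Xy)[_ _ Pz].
by have := chi0 _ Wz; rewrite chi1 // => /eqP; rewrite oner_eq0.
Qed.

(** At the level of functions, this is the identity T_phi T_psi^* = M_b Ind(f)
   M_b, where M_b is multiplication by b. *)
Lemma right_convolution_realization phi psi : Cc X phi -> Cc X psi ->
  exists (b : G -> R) (f : G -> C), [/\ {within X, continuous b}, stab_invariant b,
    forall x, X x -> 0 <= b x <= 1, Cc setT f &
    forall zeta, Cc X zeta -> right_convolution phi (stab_product lam u psi zeta) =
      scaled b (convolution setT lam f (scaled b zeta))].
Proof.
move=> Cphi Cpsi; have [b [f [cb ib b01 Cf kE]]] := kernel_realization Cphi Cpsi.
exists b, f; split => // zeta Czeta; apply/funext => x.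
have Cbz := Cc_scaled cb Czeta.
have [Xx|Xx] := pselect (X x); last first.
  rewrite /scaled (convolution_off f Cbz Xx) mulr0.
  by rewrite /right_convolution; case: pselect.
rewrite right_convolution_stab_product // /scaled convolution_formula // -/(scaled _ _).
rewrite -cintegralZ //; first last.
- have cf := Cc_continuous Cf.
  have cz : {within Y, continuous (fun y => f (gmul x y))}.
    apply: within_compT cf; apply: within_gmul; [exact: within_cst|exact: within_id|].
    by move=> y Yy; rewrite (sfiber_src Xx) (rfiber_rng Yy).
  exact: (Ccon_mull cz (Ccon_ginv_fiber Cbz)).
- exact: closed_rfiber.
- exact: compact_finite_lam.
apply: cintegral_eq => y Yy; rewrite kE //; last exact: sfiber_ginv.
by rewrite ginvK !mulrA.
Qed.

(** * Density of the inner products in C_c(G(u)) *)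

Lemma ginv_unit : ginv u = u.
Proof.
apply/esym/ginv_eq; first by rewrite unit_src // unit_rng.
by rewrite -{1}(unit_rng unit_u) gmul1g unit_src.
Qed.

Lemma stability_sub_sfiber : S `<=` X.
Proof. by move=> x []. Qed.

(** Take for phi an extension of g to G_u and for psi a positive function with
   integral 1 concentrated near u: then <psi, phi>_* (h) is an average of phi (y
   h) over y close to u. The supports stay in a fixed compact set, so that
   uniform approximation implies approximation for the I-norm. *)
Lemma stab_product_approx g : Cc S g -> exists K0 : set G,
  [/\ compact K0, K0 `<=` S, forall h, ~ K0 h -> g h = 0 &
  forall e : R, 0 < e -> exists psi phi, [/\ Cc X psi, Cc X phi,
    forall h, ~ K0 h -> stab_product lam u psi phi h = 0 &
    forall h, `|g h - stab_product lam u psi phi h| <= e%:C%C]].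
Proof.
move=> Cg; have cS := @closed_stability G hG u; have cX := @closed_sfiber G hG u.
have cY := @closed_rfiber G hG u; have fl := compact_finite_lam unit_u.
have [g' Cg' g'g] := Cc_extend hG lG cS Cg.
have IX f : Cc setT f -> Ccon X f.
  move=> Cf; have [_ [K [cK _ f0]]] := Cf; split.
    by apply: continuous_subspaceT; exact: Cc_continuous.
  exists (K `&` X); split; [exact: compact_closedI|by move=> x []|].
  by move=> x Xx Kx; apply: f0 => Kx'; apply: Kx.
have [phi Cphi phig'] := Ccon_Cc cX (IX _ Cg').
have phig h : S h -> phi h = g h by move=> Sh; rewrite phig' ?g'g //; exact: stability_sub_sfiber.
have [C0 cC0] := compact_interior_neighborhood lG (@compact_set1 _ u).
move=> /(_ u erefl) C0u.
have [_ [K [cK KX phi0]]] := Cphi.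
pose K0 := (set_gmul (@ginv G @` C0) K `|` K) `&` S.
have cK0 : compact K0.
  apply: compact_closedI => //; apply: compactU => //; apply: compact_gmul => //.
  exact: compact_ginv.
have K0S : K0 `<=` S by move=> x [].
exists K0; split => //.
  move=> h Kh; have [Sh|Sh] := pselect (S h); last exact: Cc_zero Cg Sh.
  by rewrite -phig //; apply: phi0 => Kh'; apply: Kh; split => //; right.
move=> e e0; have e2 : 0 < e / 2 by rewrite divr_gt0.
have eC : 0 < (e / 2)%:C%C :> C by rewrite ltcR.
have su := unit_src unit_u; have ru := unit_rng unit_u.
have Xu : X u by split.
have tube : \forall y \near within X (nbhs u),
    K0 `<=` (fun h => `|phi h - phi (gmul y h)| < (e / 2)%:C%C).
  move: (cK0) => /compact_near_coveringP/near_covering_withinP; apply => h Kh.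
  have cm : {within X `*` K0, continuous (fun q : G * G => phi (gmul q.1 q.2))}.
    apply: (within_Cc_comp Cphi); last by move=> q [q1 /K0S q2]; exact: sfiber_gmul.
    apply: within_gmul.
    - by apply: continuous_subspaceT => q; exact: cvg_fst.
    - by apply: continuous_subspaceT => q; exact: cvg_snd.
    - by move=> q [q1 /K0S q2]; rewrite (sfiber_src q1) (stability_rng q2).
  have eC2 : 0 < (e / 2)%:C%C / 2 :> C by rewrite divr_gt0.
  have /subspace_continuousP/(_ (u, h) (conj Xu Kh)) := cm.
  move=> /(@cvgrPdist_lt C C)/(_ _ eC2)[[U V] /= [uU hV] UV].
  exists (V, U `&` X) => /=.
    split => //; apply: filterI; last exact: withinT.
    exact: (@cvg_within _ (nbhs u) _ X).
  move=> [k y] /= [Vk [Uy Xy]] Kk.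
  have h1 := UV (y, k) (conj Uy Vk) (conj Xy Kk).
  have h2 := UV (u, k) (conj (nbhs_singleton uU) Vk) (conj Xu Kk).
  rewrite /from_subspace /= in h1 h2; rewrite distrC in h2.
  have uk : gmul u k = k by rewrite -(stability_rng (K0S _ Kk)) gmul1g.
  rewrite uk in h2.
  rewrite -[phi k](subrK (phi (gmul u h))) -addrA; apply: le_lt_trans (ler_normD _ _) _.
  by rewrite [ltRHS]splitr ltrD.
(* The integrand below is supported in V, where translation by y hardly changes
   phi on K0. *)
pose V0 : set G := [set y | X y -> K0 `<=` (fun h => `|phi h - phi (gmul y h)| < (e / 2)%:C%C)].
have V0u : nbhs u V0 by exact: tube.
pose V := V0° `&` C0°.
have Vu : V u by split.
have oV : open V by apply: openI; exact: open_interior.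
have [theta [ct t01 t1 tV [W cW t0]]] := @cutoff R _ hG lG [set u] V
  (@compact_set1 _ u) oV (fun x (xu : x = u) => eq_ind_r V Vu xu).
have Ctheta : Cc setT (fun x => (theta x)%:C%C : C).
  apply: CcTP; last by exists W => // x /t0 ->.
  by apply/continuous_subspace_setT; exact: (within_RtoC (continuous_subspaceT ct)).
have [tX CtX tXt] := Ccon_Cc cX (IX _ Ctheta).
have IY : Ccon Y (fun y => (theta (ginv y))%:C%C).
  have [c1 [K1 [cK1 K1Y h1]]] := Ccon_ginv_fiber CtX; split.
    by apply: within_eq c1 => y Yy; rewrite tXt //; exact: sfiber_ginv.
  by exists K1; split => // y Yy Ky; rewrite -tXt ?h1 //; exact: sfiber_ginv.
pose c := Rintegral (lam u) (Y : set (borel G)) (fun y => theta (ginv y)).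
have [iY _] := Ccon_integrable hG fl cY IY.
have c0 : 0 < c.
  apply: (@Rintegral_gt0 R G (lam u) Y _ u) => //.
  - exact: (within_Re IY.1).
  - by move=> y _; case/andP: (t01 (ginv y)).
  - by rewrite ginv_unit t1.
  - exact: lam_gt0.
pose psi x : C := (c^-1)%:C%C * tX x.
have Cpsi : Cc X psi.
  have [c1 [K1 [cK1 K1X h1]]] := CtX; split.
    exact: (within_mulC (@within_cst _ _ X ((c^-1)%:C%C : C)) c1).
  by exists K1; split => // x Kx; rewrite /psi h1 // mulr0.
have psiE y : Y y -> (psi (ginv y))^* = (c^-1)%:C%C * (theta (ginv y))%:C%C.
  move=> Yy; rewrite /psi tXt; last exact: sfiber_ginv.
  by rewrite -rmorphM; apply/CrealP; rewrite complex_real.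
have st0 h : ~ K0 h -> stab_product lam u psi phi h = 0.
  move=> Kh; have [Sh|Sh] := pselect (S h); last exact: stab_product_off.
  rewrite stab_product_formula // -[RHS](cintegral0 (lam u) Y).
  apply: cintegral_eq => y Yy; have [Vy|Vy] := pselect (V (ginv y)); last first.
    by rewrite psiE // tV // mulr0 mul0r.
  rewrite (phi0 (gmul _ _)) ?mulr0 // => Kyh; apply: Kh; split => //; left.
  have yh : gsrc (ginv y) = grng h by rewrite (sfiber_src (sfiber_ginv Yy)) (stability_rng Sh).
  rewrite -(gmulKg yh); apply: set_gmul_mem => //; last by rewrite gsrcV grngM.
  by exists (ginv y) => //; apply: interior_subset; case: Vy.
exists psi, phi; split => // h.
have [Kh|Kh] := pselect (K0 h); last first.
  have [Sh|Sh] := pselect (S h); last first.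
    by rewrite st0 // (Cc_zero Cg Sh) subr0 normr0 lecR ltW.
  have -> : g h = 0 by rewrite -phig //; apply: phi0 => Kh'; apply: Kh; split => //; right.
  by rewrite st0 // subr0 normr0 lecR ltW.
have Sh := K0S _ Kh.
have Iphi : Ccon Y (fun y => (psi (ginv y))^* * phi (gmul (ginv y) h)).
  have cp : {within Y, continuous (fun y => phi (gmul (ginv y) h))}.
    apply: (within_Cc_comp Cphi); last by move=> y /sfiber_ginv Xy; exact: sfiber_gmul.
    apply: within_gmul; [apply: within_ginv; exact: within_id|exact: within_cst|].
    by move=> y Yy; rewrite gsrcV (rfiber_rng Yy) (stability_rng Sh).
  exact: (Ccon_mulr (Ccon_conj (Ccon_ginv_fiber Cpsi)) cp).
have one : cintegral (lam u) Y (fun y => (psi (ginv y))^*) = 1.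
  rewrite (cintegral_eq _ (g := fun y => (c^-1)%:C%C * (theta (ginv y))%:C%C)); last exact: psiE.
  rewrite cintegralZ //.
  have -> : cintegral (lam u) Y (fun y => (theta (ginv y))%:C%C) = c%:C%C.
    by rewrite /cintegral /c /Rintegral /=; congr (_ +i* _)%C; rewrite integral0.
  by rewrite -rmorphM mulVf ?gt_eqF.
have Ipsi := Ccon_conj (Ccon_ginv_fiber Cpsi).
have -> : g h - stab_product lam u psi phi h =
    cintegral (lam u) Y (fun y => phi h * (psi (ginv y))^* - (psi (ginv y))^* * phi (gmul (ginv y) h)).
  rewrite cintegralB //; last exact: (Ccon_mull (@within_cst _ _ Y (phi h)) Ipsi).
  by rewrite cintegralZ // one mulr1 phig // stab_product_formula.
have IF : Ccon Y (fun y => phi h * (psi (ginv y))^* - (psi (ginv y))^* * phi (gmul (ginv y) h)).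
  have := Ccon_linear (-1) Iphi (Ccon_mull (@within_cst _ _ Y (phi h)) Ipsi).
  move=> [a1 a2]; split.
    by apply: within_eq a1 => y _; rewrite mulN1r addrC.
  by case: a2 => K2 [b1 b2 b3]; exists K2; split => // y Yy Ky; rewrite -[RHS](b3 y) // mulN1r addrC.
apply: le_trans (@cintegral_le_weight R G hG _ _ _ (fun y => theta (ginv y)) (e / 2 * c^-1) fl cY IF IY _) _.
  move=> y Yy; rewrite psiE //; set w := _%:C%C * _%:C%C.
  have -> : phi h * w - w * phi (gmul (ginv y) h) = w * (phi h - phi (gmul (ginv y) h)) by ring.
  rewrite normrM.
  have w0 : 0 <= c^-1 * theta (ginv y).
    by apply: mulr_ge0; [rewrite invr_ge0 ltW|case/andP: (t01 (ginv y))].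
  have -> : `|w| = (c^-1 * theta (ginv y))%:C%C.
    by rewrite /w -rmorphM normc_real ger0_norm.
  have [Vy|Vy] := pselect (V (ginv y)); last by rewrite tV // !mulr0 mul0r.
  have -> : (e / 2 / c * theta (ginv y))%:C%C =
      (c^-1 * theta (ginv y))%:C%C * (e / 2)%:C%C :> C.
    by rewrite -rmorphM; congr (_%:C%C); rewrite -mulrA mulrC.
  apply: ler_wpM2l; first by rewrite lecR.
  apply: ltW; apply: (@interior_subset _ V0 _ Vy.1 (sfiber_ginv Yy)) Kh.
by rewrite lecR -/c divfK ?gt_eqF // mulrC divfK.
Qed.

Lemma preimage_ginv_stability : @ginv G @^-1` S = S.
Proof.
by apply/seteqP; split=> x; [move=> /stability_ginv; rewrite /= ginvK|exact: stability_ginv].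
Qed.

Lemma Inorm_le f (K : set G) (M : R) : compact K -> K `<=` S -> Cc S f ->
  (forall h, ~ K h -> f h = 0) -> (forall h, `|f h| <= M%:C%C) -> 0 <= M ->
  fine (Inorm S (fun=> alpha) f) <=
    M * (fine (alpha K) + fine (alpha (@ginv G @` K))).
Proof.
move=> cK KS Cf f0 fM M0.
have fa := compact_finite_alpha; have cS := @closed_stability G hG u.
pose N h := complex.Re `|f h|.
have NC h : (N h)%:C%C = `|f h| by apply: RRe_real; rewrite ger0_real.
have N0 h : 0 <= N h by rewrite -lecR NC; exact: normr_ge0.
have NM h : N h <= M by rewrite -lecR NC.
have NK h : ~ K h -> N h = 0 by move=> Kh; rewrite /N f0 // normr0.
have cN : {within S, continuous N}.
  by apply: within_Re => x; apply: cvg_norm; exact: (proj1 Cf).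
have cK' : compact (@ginv G @` K) by exact: compact_ginv.
have KS' : @ginv G @` K `<=` S by move=> _ [x Kx <-]; apply/stability_ginv/KS.
have bnd (h : G -> R) (Q : set G) : compact Q -> Q `<=` S ->
    {within S, continuous h} -> (forall x, 0 <= h x <= M) -> (forall x, S x -> ~ Q x -> h x = 0) ->
    (\int[alpha]_(x in (S : set (borel G))) (h x)%:E <= (M * fine (alpha Q))%:E)%E.
  move=> cQ QS ch hM h0; rewrite (integral_support _ QS) //.
  have mQ : measurable (Q : set (borel G)) by exact: compact_borel.
  apply: (@le_trans _ _ (\int[alpha]_(x in (Q : set (borel G))) M%:E)%E).
    apply: ge0_le_integral => //.
    - by move=> x _; rewrite lee_fin; case/andP: (hM x).
    - apply/measurable_EFinP; apply: within_measurable; first exact: compact_closed cQ.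
      exact: continuous_subspaceW ch.
    - by move=> x _; rewrite lee_fin; case/andP: (hM x).
  rewrite integral_cst // EFinM fineK // ge0_fin_numE ?measure_ge0 //; exact: fa.
set B := M * _.
have B1 : M * fine (alpha K) <= B by rewrite /B ler_wpM2l // lerDl fine_ge0.
have B2 : M * fine (alpha (@ginv G @` K)) <= B by rewrite /B ler_wpM2l // lerDr fine_ge0.
have I1 : (\int[alpha]_(x in (S : set (borel G))) (N x)%:E <= B%:E)%E.
  apply: le_trans (bnd N K cK KS cN _ _) _; last by rewrite lee_fin.
    by move=> x; rewrite N0 NM.
  by move=> x _; exact: NK.
have I2 : (\int[source_measure (fun=> alpha) u]_(x in (S : set (borel G))) (N x)%:E <= B%:E)%E.
  rewrite /source_measure integral_pushforward_ginv // preimage_ginv_stability.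
  apply: le_trans (bnd (fun x => N (ginv x)) _ cK' KS' _ _ _) _; last by rewrite lee_fin.
  - by apply: within_comp cN => //; [apply: within_ginv; exact: within_id|exact: stability_ginv].
  - by move=> x; rewrite N0 NM.
  - by move=> x _ Kx; apply: NK => Kx'; apply: Kx; exists (ginv x) => //; exact: ginvK.
have vu v : (S `&` units) v -> v = u.
  by move=> [[_ vu] uv]; rewrite -(unit_rng uv).
have sS : sfiber S u = S by apply/seteqP; split=> x; [case|move=> Sx; split => //; case: Sx].
have sup : (Inorm S (fun=> alpha) f <= B%:E)%E.
  apply: ge_ereal_sup => _ [[v /vu -> <-]|[v /vu -> <-]]; last by rewrite sS.
  by rewrite rfiber_stability.
have sup0 : (0 <= Inorm S (fun=> alpha) f)%E.
  apply: le_trans (ereal_sup_ubound _); last by left; exists u => //; exact: stability_unit.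
  by apply: integral_ge0 => x _; rewrite lee_fin; exact: N0.
rewrite -lee_fin fineK // ge0_fin_numE //.
by apply: le_lt_trans sup _; rewrite ltry.
Qed.
End haar_integrals.

(** * The induced representation *)

Lemma mul_div_succ_le (F : numFieldType) (m e : F) :
  0 <= m -> 0 <= e -> m * (e / (m + 1)) <= e.
Proof.
by move=> m0 e0; rewrite mulrA ler_pdivrMr ?ltr_wpDl // mulrDr mulr1 mulrC lerDl.
Qed.

Section graph_closures.
Context {R : realType}.
Local Notation C := (cplx R).
Context {V W : completeNormedModType C}.
Variables (Gam : set (V * W)) (c : C).
Hypotheses (c0 : 0 <= c) (sG : linear_subspace Gam).
Hypothesis bG : forall p, Gam p -> `|p.2| <= c * `|p.1|.

Definition graph_closure (x : V) (y : W) := forall e : C, 0 < e ->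
  exists2 p, Gam p & `|x - p.1| < e /\ `|y - p.2| < e.

(** For p and q in the graph, the bound applies to their difference; let q tend
   to (x, y). *)
Lemma graph_closure_bound x y p : graph_closure x y -> Gam p ->
  `|y - p.2| <= c * `|x - p.1|.
Proof.
move=> xy Gp; have c1 : 0 < 1 + c by rewrite ltr_pwDl.
apply/ler_addgt0Pr => e e0.
have [|q Gq [xq yq]] := xy (e / (1 + c)); first by rewrite divr_gt0.
have qp := bG (subspaceB sG Gq Gp); rewrite /= in qp.
rewrite -[y - p.2](subrKA q.2); apply: le_trans (ler_normD _ _) _.
have h : `|q.1 - p.1| <= `|x - p.1| + e / (1 + c).
  rewrite -[q.1 - p.1](subrKA x) addrC; apply: le_trans (ler_normD _ _) _.
  by rewrite lerD2l distrC ltW.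
have h2 : c * `|q.1 - p.1| <= c * (`|x - p.1| + e / (1 + c)) by rewrite ler_wpM2l.
apply: le_trans (lerD (ltW yq) (le_trans qp h2)) _.
rewrite mulrDr addrCA lerD2l -[X in X + _]mul1r -mulrDl mulrCA divff ?mulr1 //.
by rewrite gt_eqF.
Qed.

End graph_closures.

Section induced.
Context {R : realType} {G : topGroupoidType}.
Hypothesis hG : hausdorff_space G.
Hypothesis lG : locally_compact [set: G].
Hypothesis sG : @second_countable G.
Local Notation C := (cplx R).
Variable lam : G -> {measure set (borel G) -> \bar R}.
Hypothesis haar_lam : haar_system setT lam.
Variable u : G.
Hypothesis unit_u : units u.
Variable alpha : {measure set (borel G) -> \bar R}.
Hypothesis haar_alpha : haar_system (stability u) (fun=> alpha).
Variables (A : cstarAlgType C) (iota : (G -> C) -> A).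
Hypothesis A_cstar : groupoid_cstar_algebra setT lam iota.
Variables (B : cstarAlgType C) (iota_u : (G -> C) -> B).
Hypothesis B_cstar : groupoid_cstar_algebra (stability u) (fun=> alpha) iota_u.
Variables (HL : hilbertType C) (L : B -> {linear HL -> HL}).
Hypothesis rep_L : representation L.
Variables (H : hilbertType C) (tensor : (G -> C) -> HL -> H).
Variable Ind : A -> {linear H -> H}.
Hypothesis ind : induced_representation lam u iota iota_u L tensor Ind.

Local Notation X := (sfiber [set: G] u).
Local Notation S := (stability u).
Local Notation stab := (stab_product lam u).

Let rep_Ind : representation Ind := ind_representation ind.

Definition tensors : set H := [set tensor phi h | phi in Cc X & h in setT].

Lemma tensors_dense : dense (linear_span tensors).
Proof. exact: (ind_dense ind). Qed.

Lemma tensor_dot phi psi h k : Cc X phi -> Cc X psi ->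
  hdot (tensor phi h) (tensor psi k) = hdot (L (iota_u (stab psi phi)) h) k.
Proof. exact: (ind_dot ind). Qed.

Lemma tensorB phi h k : Cc X phi -> tensor phi (h - k) = tensor phi h - tensor phi k.
Proof.
move=> Cphi; rewrite addrC -scaleN1r (ind_tensor_linearr ind) // scaleN1r.
by rewrite addrC.
Qed.

Lemma tensor_bounded phi : Cc X phi -> exists2 c : C, 0 <= c &
  forall h, `|tensor phi h| <= c * `|h|.
Proof.
move=> Cphi; set a := `|iota_u (stab phi phi)|.
have a0 : 0 <= a by exact: normr_ge0.
exists (1 + 2 * a); first by rewrite addr_ge0 // mulr_ge0.
move=> h; rewrite -(@ler_pXn2r _ 2) ?nnegrE ?mulr_ge0 ?addr_ge0 ?mulr_ge0 //.
rewrite -hdot_norm tensor_dot // -[leLHS]ger0_norm; last first.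
  by rewrite -tensor_dot // hdot_norm exprn_ge0.
apply: le_trans (hdot_cauchy_schwarz _ _) _.
apply: le_trans (ler_wpM2r _ (rep_norm_le rep_L _ _)) _ => //.
rewrite -/a; set t : C := `|h|; have t0 : 0 <= t by exact: normr_ge0.
have -> : 2 * a * t * t = 2 * a * t ^+ 2 by rewrite expr2 !mulrA.
rewrite exprMn ler_wpM2r ?exprn_ge0 //.
have a2 : 0 <= 2 * a by rewrite mulr_ge0.
have -> : (1 + 2 * a) ^+ 2 = 2 * a + (1 + 2 * a + (2 * a) ^+ 2) by ring.
by rewrite lerDl !addr_ge0 // exprn_ge0.
Qed.

(** Both sides have the same inner products with all tensors, because the inner
   product is C_c(G(u))-linear. *)
Lemma tensor_balanced phi g h : Cc X phi -> Cc S g ->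
  tensor phi (L (iota_u g) h) = tensor (right_convolution u alpha phi g) h.
Proof.
move=> Cphi Cg; have Crc := Cc_right_convolution hG unit_u haar_alpha Cphi Cg.
apply/eqP; rewrite -subr_eq0; apply/eqP; apply: (dense_orthogonal tensors_dense).
move=> _ [psi Cpsi [k _ <-]]; rewrite hdotBl !tensor_dot // -(rep_mul rep_L).
rewrite (stab_product_right_convolution hG sG haar_lam unit_u haar_alpha) //.
have Cs := Cc_stab_product hG haar_lam unit_u Cpsi Cphi.
by rewrite -(gca_mul B_cstar) // subrr.
Qed.

(** Multiplication by b, phi (x) h |-> b phi (x) h, is a relation until it is
   known to respect the null vectors of the tensor product; mult_graph_bounded
   is this fact. The operator M_b is the closure of this graph. *)
Definition mult_graph (b : G -> R) : set (H * H) := linear_span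
  [set p | exists phi h, Cc X phi /\ p = (tensor phi h, tensor (scaled b phi) h)].

Definition multiplier (b : G -> R) := [/\ {within X, continuous b},
  stab_invariant u b & forall x, X x -> 0 <= b x <= 1].

Lemma mult_graph_subspace b : linear_subspace (mult_graph b).
Proof. exact: linear_span_subspace. Qed.

Lemma tensors_approx (P : set H) : linear_subspace P ->
  (forall phi h, Cc X phi -> P (tensor phi h)) ->
  forall (x : H) (e : C), 0 < e -> exists2 y, P y & `|x - y| < e.
Proof.
move=> sP hP x e e0; have [y ty xy] := dense_approx tensors_dense x e0.
exists y => //; apply: linear_span_ind ty => // _ [phi Cphi [h _ <-]]; exact: hP.
Qed.

Lemma mult_graph_dense b (x : H) (e : C) : 0 < e ->
  exists2 p, mult_graph b p & `|x - p.1| < e.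
Proof.
move=> e0; have [||y [z yz] xy] := @tensors_approx [set x | exists y, mult_graph b (x, y)] _ _ x e e0.
- have [g0 gl] := mult_graph_subspace b.
  split; first by exists 0.
  by move=> k y z [y' yy] [z' zz]; exists (k *: y' + z'); exact: (gl k _ _ yy zz).
- move=> phi h Cphi; exists (tensor (scaled b phi) h); apply: sub_linear_span.
  by exists phi, h.
by exists (y, z).
Qed.

(** With c^2 = 1 - b^2, splitting of the inner product gives |b x|^2 + |c x|^2 =
   |x|^2, first for inner products of two tensors and then on their span. The
   three vectors x, b x and c x are carried along together, because b x and c x
   are not yet known to be functions of x. *)
Lemma mult_graph_bounded b p : multiplier b -> mult_graph b p -> `|p.2| <= 1 * `|p.1|.
Proof.
move=> [cb ib b01] bp; rewrite mul1r.
pose c x := Num.sqrt (1 - b x ^+ 2).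
have cc : {within X, continuous c}.
  apply: within_compT (@sqrt_continuous R) => x.
  by apply: cvgB; [exact: cvg_cst|apply: cvgM; exact: cb].
have ic : stab_invariant u c by move=> x t Xx St; rewrite /c ib.
have bc x : X x -> b x ^+ 2 + c x ^+ 2 = 1.
  move=> Xx; have /andP[b0 b1] := b01 _ Xx.
  by rewrite /c sqr_sqrtr ?subrKC // subr_ge0 expr_le1.
pose gen : set (H * H * H) := [set t | exists phi h, Cc X phi /\
  t = (tensor phi h, tensor (scaled b phi) h, tensor (scaled c phi) h)].
pose rel (t t' : H * H * H) := hdot t.1.1 t'.1.1 = hdot t.1.2 t'.1.2 + hdot t.2 t'.2.
have rel_gen t t' : gen t -> gen t' -> rel t t'.
  move=> [phi [h [Cphi ->]]] [psi [k [Cpsi ->]]]; rewrite /rel /=.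
  have Cbphi := Cc_scaled cb Cphi; have Ccphi := Cc_scaled cc Cphi.
  have Cbpsi := Cc_scaled cb Cpsi; have Ccpsi := Cc_scaled cc Cpsi.
  rewrite !tensor_dot // (stab_product_scaled hG haar_lam unit_u cb cc ib ic bc Cpsi Cphi).
  rewrite (gca_linear B_cstar) //; try exact: (Cc_stab_product hG haar_lam unit_u).
  by rewrite (rep_linear rep_L) scale1r hdotDl.
have rel_span t t' : linear_span gen t -> linear_span gen t' -> rel t t'.
  move=> gt gt'; apply: (@linear_span_ind _ _ gen [set t' | rel t t'] _ _ t' gt') => [|s' gs' /=].
    split; first by rewrite /rel /= !hdot0r addr0.
    by move=> k x y; rewrite /rel /= !hdotDr !hdotZr => -> ->; ring.
  apply: (@linear_span_ind _ _ gen [set t | rel t s'] _ _ t gt) => [|s gs /=]; last exact: rel_gen.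
  split; first by rewrite /rel /= !hdot0l addr0.
  by move=> k x y; rewrite /rel /= !hdotDl !hdotZl => -> ->; ring.
have [z gz] : exists z, linear_span gen (p, z).
  apply: (@linear_span_ind _ _ _ [set q | exists z, linear_span gen (q, z)] _ _ p bp) => [|_ [phi [h [Cphi ->]]]]; last first.
    by exists (tensor (scaled c phi) h); apply: sub_linear_span; exists phi, h.
  have [g0 gl] := linear_span_subspace gen.
  split; first by exists 0.
  by move=> k y y' [z yz] [z' yz']; exists (k *: z + z'); exact: (gl k _ _ yz yz').
have := rel_span _ _ gz gz; rewrite /rel /= !hdot_norm => e.
by rewrite -(@ler_pXn2r _ 2) ?nnegrE // e lerDl exprn_ge0.
Qed.

Lemma mult_closure_ex b (x : H) : multiplier b ->
  exists y, graph_closure (mult_graph b) x y.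
Proof.
move=> mb; apply: (@bounded_graph_extension _ H H (mult_graph b) 1) => //.
- exact: mult_graph_subspace.
- by move=> p; exact: mult_graph_bounded.
- by move=> z e; exact: mult_graph_dense.
Qed.

Lemma mult_closure_bound b x y p : multiplier b -> graph_closure (mult_graph b) x y ->
  mult_graph b p -> `|y - p.2| <= `|x - p.1|.
Proof.
move=> mb xy bp; rewrite -[leRHS]mul1r.
apply: graph_closure_bound xy bp => //; first exact: mult_graph_subspace.
by move=> q; exact: mult_graph_bounded.
Qed.

Variable M : set H.
Hypotheses (sM : linear_subspace M) (cM : closed M).
Hypothesis iM : forall a x, M x -> M (Ind a x).

(** A continuous function b on the unit space is a multiplier of C*(G): it can
   be moved to the source side of f, so that Ind(f) M_(b o r) = Ind(f (b o s)).
   Thus Ind(f) maps M_(b o r) x into M for all f, and nondegeneracy finishes the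
   proof. *)
Lemma mult_range_invariant (b : G -> R) x y : continuous b ->
  (forall v, 0 <= b v <= 1) ->
  graph_closure (mult_graph (fun z => b (grng z))) x y -> M x -> M y.
Proof.
move=> cb b01 xy Mx; set br := fun z => _ in xy.
apply: (rep_nondegenerate_mem rep_Ind sM cM iM).
apply: (rep_dense_invariant rep_Ind (gca_dense A_cstar) cM) => _ [f Cf <-].
pose f' z : C := f z * (b (gsrc z))%:C%C.
have Cf' : Cc setT f'.
  have [_ [K [cK _ f0]]] := Cf.
  apply: CcTP; last by exists K => // z Kz; rewrite /f' f0 // mul0r.
  apply/continuous_subspace_setT.
  have cs : continuous (fun z : G => b (gsrc z)).
    by move=> z; apply: continuous_comp; [exact: gsrc_continuous|exact: cb].
  exact: (within_mulC (proj1 Cf) (within_RtoC (continuous_subspaceT cs))).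
have key p : mult_graph br p -> Ind (iota f) p.2 = Ind (iota f') p.1.
  move=> Gp; apply: (@linear_span_ind _ _ _
    [set q | Ind (iota f) q.2 = Ind (iota f') q.1] _ _ p Gp) => [|_ [phi [h [Cphi ->]]]] /=.
    split; first by rewrite /= !linear0.
    by move=> k q q' /= hq hq'; rewrite !linearP hq hq'.
  have Cb : Cc X (scaled br phi).
    apply: Cc_scaled => //; apply: continuous_subspaceT => z.
    by apply: continuous_comp; [exact: grng_continuous|exact: cb].
  rewrite !(ind_action ind) //; congr tensor; apply/funext => z.
  apply: cintegral_eq => w [_ /= wz].
  by rewrite /scaled /br /f' grngM ?gsrcV // grngV mulrA.
suff -> : Ind (iota f) y = Ind (iota f') x by exact: iM.
apply/eqP; rewrite -subr_eq0 -normr_le0; apply/ler_addgt0Pr => e e0; rewrite add0r.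
set n := 2 * `|iota f| + 2 * `|iota f'| + 1.
have n0 : 0 < n by rewrite ltr_wpDl // addr_ge0 // mulr_ge0.
have [|p Gp [xp yp]] := xy (e / n); first by rewrite divr_gt0.
have -> : Ind (iota f) y - Ind (iota f') x = Ind (iota f) (y - p.2) + Ind (iota f') (p.1 - x).
  by rewrite !linearB key // addrA subrK.
apply: le_trans (ler_normD _ _) _.
apply: le_trans (lerD (rep_norm_le rep_Ind _ _) (rep_norm_le rep_Ind _ _)) _.
rewrite distrC in xp.
apply: (@le_trans _ _ ((2 * `|iota f| + 2 * `|iota f'|) * (e / n))).
  by rewrite [leRHS]mulrDl lerD // ler_wpM2l ?mulr_ge0 // ltW.
by apply: mul_div_succ_le; [rewrite addr_ge0 ?mulr_ge0|exact: ltW].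
Qed.

(** A given vector of the span involves finitely many functions phi, whose
   supports lie in one compact set. There b coincides with a function of the
   range, so M_b x is a limit of vectors M_(b' o r) x with b' depending on the
   vector. *)
Lemma mult_invariant (b : G -> R) x y : multiplier b ->
  graph_closure (mult_graph b) x y -> M x -> M y.
Proof.
move=> mb xy Mx; have [cb ib b01] := mb; apply: (approx_closed cM) => e e0.
have e2 : 0 < e / 2 by rewrite divr_gt0.
have [p Gp [xp yp]] := xy _ e2.
have [K [cK KX hK]] : exists K, [/\ compact K, K `<=` X &
    forall b' : G -> R, (forall z, K z -> b' z = b z) -> mult_graph b' p].
  apply: (@linear_span_ind _ _ _ [set q | exists K, [/\ compact K, K `<=` X &
    forall b' : G -> R, (forall z, K z -> b' z = b z) -> mult_graph b' q]] _ _ p Gp)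
    => [|_ [phi [h [Cphi ->]]]]; last first.
    have [_ [K [cK KX phi0]]] := Cphi; exists K; split => // b' bb'.
    apply: sub_linear_span; exists phi, h; split => //; congr (_, tensor _ _).
    apply/funext => z; rewrite /scaled; have [Kz|Kz] := pselect (K z).
      by rewrite bb'.
    by rewrite phi0 // !mulr0.
  split.
    exists set0; split => //; first exact: compact0.
    by move=> b' _; exact: (mult_graph_subspace b').1.
  move=> k q q' [K [cK KX hK]] [K' [cK' KX' hK']]; exists (K `|` K'); split.
  - exact: compactU.
  - by move=> z []; [exact: KX|exact: KX'].
  - move=> b' bb'; apply: (mult_graph_subspace b').2.
      by apply: hK => z Kz; apply: bb'; left.
    by apply: hK' => z Kz; apply: bb'; right.
have [b' [cb' b'01 b'b]] := stab_invariant_factor hG lG cb ib b01 cK KX.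
have mb' : multiplier (fun z => b' (grng z)).
  split => //; first apply: continuous_subspaceT => z.
    by apply: continuous_comp; [exact: grng_continuous|exact: cb'].
  by move=> z t [_ /= zu] [_ tu]; rewrite grngM // zu.
have [y' xy'] := mult_closure_ex x mb'.
exists y'; first exact: mult_range_invariant xy' Mx.
have h := mult_closure_bound mb' xy' (hK _ b'b).
rewrite -[y - y'](subrKA p.2); apply: le_lt_trans (ler_normD _ _) _.
by rewrite [ltRHS]splitr ltrD // distrC; apply: le_lt_trans h _.
Qed.

(** The graph of T_psi^*, which maps zeta (x) h to L(g) h with g = <psi, zeta>_*
   in C_c(G(u)). *)
Definition adj_graph psi : set (H * HL) := linear_span
  [set p | exists zeta h, Cc X zeta /\ p = (tensor zeta h, L (iota_u (stab psi zeta)) h)].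

Lemma adj_graph_subspace psi : linear_subspace (adj_graph psi).
Proof. exact: linear_span_subspace. Qed.

Lemma adj_graph_dot psi p k : Cc X psi -> adj_graph psi p ->
  hdot p.2 k = hdot p.1 (tensor psi k).
Proof.
move=> Cpsi Gp; apply: (@linear_span_ind _ _ _
  [set q | hdot q.2 k = hdot q.1 (tensor psi k)] _ _ p Gp) => [|_ [zeta [h [Czeta ->]]]] /=; last first.
  by rewrite tensor_dot.
split; first by rewrite /= !hdot0l.
by move=> a q q' /= hq hq'; rewrite !hdotDl !hdotZl hq hq'.
Qed.

Lemma adj_graph_bounded psi c p : Cc X psi -> 0 <= c ->
  (forall h, `|tensor psi h| <= c * `|h|) -> adj_graph psi p ->
  `|p.2| <= c * `|p.1|.
Proof.
move=> Cpsi c0 hc Gp; have [->|p0] := eqVneq p.2 0.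
  by rewrite normr0 mulr_ge0.
rewrite -(@ler_pM2r _ `|p.2|) ?normr_gt0 // -expr2 -hdot_norm (adj_graph_dot _ Cpsi Gp).
rewrite -[leLHS]ger0_norm; last first.
  by rewrite -(adj_graph_dot _ Cpsi Gp) hdot_norm exprn_ge0.
apply: le_trans (hdot_cauchy_schwarz _ _) _.
rewrite mulrAC mulrC ler_wpM2r //; exact: hc.
Qed.

Lemma adj_exists psi (x : H) : Cc X psi ->
  exists2 y, graph_closure (adj_graph psi) x y & forall k, hdot y k = hdot x (tensor psi k).
Proof.
move=> Cpsi; have [c c0 hc] := tensor_bounded Cpsi.
have sA := adj_graph_subspace psi.
have [||y xy] := @bounded_graph_extension _ H HL (adj_graph psi) c c0 sA _ _ x.
- by move=> p; exact: adj_graph_bounded.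
- move=> z e e0.
  have [||w [v wv] zw] := @tensors_approx [set x | exists y, adj_graph psi (x, y)] _ _ z e e0.
  + split; first by exists 0; exact: sA.1.
    by move=> k w w' [v wv] [v' wv']; exists (k *: v + v'); exact: (sA.2 k _ _ wv wv').
  + move=> phi h Cphi; exists (L (iota_u (stab psi phi)) h); apply: sub_linear_span.
    by exists phi, h.
  by exists (w, v).
exists y => // k; apply/eqP; rewrite -subr_eq0 -normr_le0.
apply/ler_addgt0Pr => e e0; rewrite add0r.
set n := `|k| + `|tensor psi k| + 1.
have n0 : 0 < n by rewrite ltr_wpDl // addr_ge0.
have [|p Gp [xp yp]] := xy (e / n); first by rewrite divr_gt0.
have -> : hdot y k - hdot x (tensor psi k) = hdot (y - p.2) k - hdot (x - p.1) (tensor psi k).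
  by rewrite !hdotBl (adj_graph_dot k Cpsi Gp) opprB addrA subrK.
apply: le_trans (ler_normB _ _) _.
apply: le_trans (lerD (hdot_cauchy_schwarz _ _) (hdot_cauchy_schwarz _ _)) _.
apply: (@le_trans _ _ ((`|k| + `|tensor psi k|) * (e / n))).
  by rewrite [leRHS]mulrDl; apply: lerD; [rewrite mulrC|rewrite mulrC]; apply: ler_wpM2l => //; exact: ltW.
by apply: mul_div_succ_le; [rewrite addr_ge0 ?mulr_ge0|exact: ltW].
Qed.

(** On tensors, T_phi T_psi^* = M_b Ind(f) M_b with b invariant and f in C_c(G).
   Both sides are bounded, so that they agree at x, and the right hand side maps
   M into M. *)
Lemma theta_invariant phi psi x y : Cc X phi -> Cc X psi -> M x ->
  graph_closure (adj_graph psi) x y -> M (tensor phi y).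
Proof.
move=> Cphi Cpsi Mx xy.
have [b [f [cb ib b01 Cf bf]]] :=
  right_convolution_realization hG lG sG haar_lam unit_u haar_alpha Cphi Cpsi.
have mb : multiplier b by [].
have [x1 xx1] := mult_closure_ex x mb.
have Mx1 := mult_invariant mb xx1 Mx.
have [x3 xx3] := mult_closure_ex (Ind (iota f) x1) mb.
have Mx3 := mult_invariant mb xx3 (iM (iota f) Mx1).
suff -> : tensor phi y = x3 by [].
(* The vectors at which both sides of the identity can be computed in the
   graphs. *)
pose P : set H := [set z | exists w z1 z3, [/\ adj_graph psi (z, w), mult_graph b (z, z1),
  mult_graph b (Ind (iota f) z1, z3) & tensor phi w = z3]].
have sP : linear_subspace P.
  have [m0 ml] := mult_graph_subspace b.
  have [a0 al] := adj_graph_subspace psi.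
  split.
    exists 0, 0, 0; split => //; first by rewrite linear0.
    by rewrite -(subrr (0 : HL)) tensorB // subrr.
  move=> k z z' [w [z1 [z3 [h1 h2 h3 h4]]]] [w' [z1' [z3' [h1' h2' h3' h4']]]].
  exists (k *: w + w'), (k *: z1 + z1'), (k *: z3 + z3'); split.
  - exact: (al k _ _ h1 h1').
  - exact: (ml k _ _ h2 h2').
  - by rewrite linearP; exact: (ml k _ _ h3 h3').
  - by rewrite (ind_tensor_linearr ind) // h4 h4'.
have tP zeta h : Cc X zeta -> P (tensor zeta h).
  move=> Czeta; exists (L (iota_u (stab psi zeta)) h), (tensor (scaled b zeta) h).
  have Cb := Cc_scaled cb Czeta.
  have Cc1 := Cc_convolution hG lG haar_lam unit_u Cf Cb.
  exists (tensor (scaled b (convolution setT lam f (scaled b zeta))) h); split.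
  - by apply: sub_linear_span; exists zeta, h.
  - by apply: sub_linear_span; exists zeta, h.
  - apply: sub_linear_span; exists (convolution setT lam f (scaled b zeta)), h.
    by rewrite (ind_action ind).
  - by rewrite tensor_balanced ?bf //; exact: Cc_stab_product.
have [c c0 hc] := tensor_bounded Cphi; have [d d0 hd] := tensor_bounded Cpsi.
apply/eqP; rewrite -subr_eq0 -normr_le0; apply/ler_addgt0Pr => e e0; rewrite add0r.
pose n := c * d + 2 * `|iota f|.
have n0 : 0 <= n by rewrite addr_ge0 ?mulr_ge0.
have [|z [w [z1 [z3 [h1 h2 h3 h4]]]] xz] := tensors_approx sP tP x (e := e / (n + 1)).
  by rewrite divr_gt0 // ltr_wpDl.
have -> : tensor phi y - x3 = tensor phi (y - w) - (x3 - z3).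
  by rewrite tensorB // h4 opprB addrA subrK.
apply: le_trans (ler_normB _ _) _.
have b1 : `|y - w| <= d * `|x - z|.
  apply: (graph_closure_bound d0 _ _ xy h1); first exact: linear_span_subspace.
  by move=> p; exact: adj_graph_bounded.
have b2 := mult_closure_bound mb xx1 h2; rewrite /= in b2.
have b3 := mult_closure_bound mb xx3 h3; rewrite /= -linearB in b3.
have t1 : `|tensor phi (y - w)| <= c * (d * `|x - z|).
  by apply: le_trans (hc _) _; rewrite ler_wpM2l.
have t2 : `|x3 - z3| <= 2 * `|iota f| * `|x - z|.
  apply: le_trans b3 _; apply: le_trans (rep_norm_le rep_Ind _ _) _.
  by rewrite ler_wpM2l // mulr_ge0.
apply: le_trans (lerD t1 t2) _.
have -> : c * (d * `|x - z|) + 2 * `|iota f| * `|x - z| = n * `|x - z|.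
  by rewrite /n mulrA -mulrDl.
by apply: le_trans (mul_div_succ_le n0 (ltW e0)); rewrite ler_wpM2l // ltW.
Qed.

(** The largest subspace of the space of L that induces into M. It contains
   T_psi^* M for every psi, by theta_invariant. *)
Definition fiber_subspace : set HL := [set k | forall phi, Cc X phi -> M (tensor phi k)].

Lemma fiber_subspace_subspace : linear_subspace fiber_subspace.
Proof.
split=> [phi Cphi|k x y Nx Ny phi Cphi].
  by rewrite -(subrr (0 : HL)) tensorB // subrr; exact: sM.1.
by rewrite (ind_tensor_linearr ind) //; apply: sM.2; [exact: Nx|exact: Ny].
Qed.

Lemma fiber_subspace_closed : closed fiber_subspace.
Proof.
move=> k hk phi Cphi; apply: (approx_closed cM) => e e0.
have [c c0 hc] := tensor_bounded Cphi.
have ce : 0 < e / (c + 1) by rewrite divr_gt0 // ltr_wpDl.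
have [y [Ny ky]] := hk _ (nbhsx_ballx k _ ce).
exists (tensor phi y); first exact: Ny.
rewrite -tensorB //; apply: le_lt_trans (hc _) _.
rewrite -ball_normE /= in ky.
have [->|c1] := eqVneq c 0; first by rewrite mul0r.
have cgt : 0 < c by rewrite lt0r c1.
apply: lt_le_trans (mul_div_succ_le c0 (ltW e0)).
by rewrite ltr_pM2l.
Qed.

(** By balancing, phi (x) L(g) k = (phi . g) (x) k. *)
Lemma fiber_subspace_invariant a k : fiber_subspace k -> fiber_subspace (L a k).
Proof.
move=> Nk; move: a; apply: (rep_dense_invariant rep_L (gca_dense B_cstar) fiber_subspace_closed).
move=> _ [g Cg <-] phi Cphi; rewrite tensor_balanced //; apply: Nk.
exact: Cc_right_convolution.
Qed.

(** Irreducibility of L leaves two cases. If fiber_subspace is 0 then so is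
   T_psi^* M for all psi, hence M is orthogonal to all tensors; if it is
   everything then M contains all tensors. *)
Lemma invariant_subspace_trivial : irreducible L -> M = [set 0] \/ M = setT.
Proof.
move=> [_ _ irr].
have [N0|NT] := irr _ fiber_subspace_subspace fiber_subspace_closed fiber_subspace_invariant.
- left; apply/seteqP; split=> [x Mx|_ ->]; last exact: sM.1.
  apply: (dense_orthogonal tensors_dense) => _ [psi Cpsi [k _ <-]].
  have [y xy <-] := adj_exists x Cpsi.
  have : fiber_subspace y by move=> phi Cphi; exact: theta_invariant xy.
  by rewrite N0 => ->; rewrite hdot0l.
- right; apply/seteqP; split=> // x _; apply: (approx_closed cM).
  apply: tensors_approx => // phi h Cphi.
  have Nh : fiber_subspace h by rewrite NT.
  exact: Nh.
Qed.

End induced.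

Section induced_nontrivial.
Context {R : realType} {G : topGroupoidType}.
Hypothesis hG : hausdorff_space G.
Hypothesis lG : locally_compact [set: G].
Local Notation C := (cplx R).
Variable lam : G -> {measure set (borel G) -> \bar R}.
Hypothesis haar_lam : haar_system setT lam.
Variable u : G.
Hypothesis unit_u : units u.
Variable alpha : {measure set (borel G) -> \bar R}.
Hypothesis haar_alpha : haar_system (stability u) (fun=> alpha).
Variables (A : cstarAlgType C) (iota : (G -> C) -> A).
Variables (B : cstarAlgType C) (iota_u : (G -> C) -> B).
Hypothesis B_cstar : groupoid_cstar_algebra (stability u) (fun=> alpha) iota_u.
Variables (HL : hilbertType C) (L : B -> {linear HL -> HL}).
Hypothesis rep_L : representation L.
Variables (H : hilbertType C) (tensor : (G -> C) -> HL -> H).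
Variable Ind : A -> {linear H -> H}.
Hypothesis ind : induced_representation lam u iota iota_u L tensor Ind.

Local Notation X := (sfiber [set: G] u).
Local Notation S := (stability u).
Local Notation stab := (stab_product lam u).

Lemma universal_norm_le (D : set G) (mu : G -> {measure set (borel G) -> \bar R}) f (r : R) :
  Cc D f -> 0 <= r -> fine (Inorm D mu f) <= r -> universal_norm D mu f <= r.
Proof.
move=> Cf r0 fr; rewrite /universal_norm; set E := [set t | _].
have [->|/set0P E0] := eqVneq E set0; first by rewrite sup0.
apply: ge_sup => // t [K [pi [x [rp x1 tx]]]].
rewrite -lecR tx; apply: le_trans (Cc_rep_Inorm rp x Cf) _.
apply: (@le_trans _ _ (r%:C%C * `|x|)).
  by rewrite ler_wpM2r // lecR.
by rewrite ler_piMr // lecR.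
Qed.

Lemma Cc_sub (D : set G) (f g : G -> C) : Cc D f -> Cc D g -> Cc D (fun x => (-1) * f x + g x).
Proof.
move=> [cf [K [cK KD f0]]] [cg [K' [cK' KD' g0]]]; split.
  exact: (within_addC (within_mulC (@within_cst _ _ D (-1 : C)) cf) cg).
exists (K `|` K'); split; [exact: compactU|by move=> x []; [exact: KD|exact: KD']|].
by move=> x /not_orP[Kx Kx']; rewrite f0 // g0 // mulr0 addr0.
Qed.

(** If the induced space were 0, then L would vanish on all inner products <psi,
   phi>_*, hence on C*(G(u)) by density, against nondegeneracy. *)
Lemma induced_nontrivial : (exists h : HL, h != 0) -> exists x : H, x != 0.
Proof.
move=> [h h0]; apply: contrapT => hn.
have H0 (x : H) : x = 0 by apply/eqP/negPn/negP => x0; apply: hn; exists x.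
have st0 psi phi k : Cc X psi -> Cc X phi -> L (iota_u (stab psi phi)) k = 0.
  move=> Cpsi Cphi; apply/eqP; rewrite -normr_eq0 -sqrf_eq0 -hdot_norm.
  by rewrite -(ind_dot ind) // (H0 (tensor _ _)) hdot0l.
suff L0 a k : L a k = 0.
  case/eqP: h0; apply: (dense_orthogonal (rep_nondegenerate rep_L)).
  by move=> _ [a _ [k _ <-]]; rewrite L0 hdot0r.
have cl0 : closed [set 0 : HL].
  by apply: accessible_closed_set1; apply: hausdorff_accessible; exact: norm_hausdorff.
apply: (rep_dense_invariant rep_L (gca_dense B_cstar) cl0) => _ [g Cg <-] /=.
apply/eqP; rewrite -normr_le0; apply/ler_addgt0Pr => e e0; rewrite add0r.
have [K [cK KS g0 hK]] := stab_product_approx hG lG haar_lam unit_u Cg.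
pose kap : R := fine (alpha K) + fine (alpha (@ginv G @` K)).
have kap0 : 0 <= kap by rewrite addr_ge0 ?fine_ge0.
pose m : C := 2 * kap%:C%C * `|k|.
have m0 : 0 <= m by rewrite !mulr_ge0 // lecR.
have [|r r0 er] := @Cgt0P R (e / (m + 1)); first by rewrite divr_gt0 // ltr_wpDl.
have [psi [phi [Cpsi Cphi sK gs]]] := hK _ r0.
have Cs := Cc_stab_product hG haar_lam unit_u Cpsi Cphi.
pose d x : C := (-1) * stab psi phi x + g x.
have Cd : Cc S d by exact: Cc_sub.
have dE x : d x = g x - stab psi phi x by rewrite /d mulN1r addrC.
have nd : fine (Inorm S (fun=> alpha) d) <= r * kap.
  apply: (Inorm_le hG unit_u haar_alpha) => //; last exact: ltW.
  - by move=> x Kx; rewrite dE g0 // sK // subr0.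
  - by move=> x; rewrite dE.
have rk : 0 <= r * kap by rewrite mulr_ge0 // ltW.
have nid : `|iota_u d| <= (r * kap)%:C%C.
  by rewrite (gca_norm B_cstar) // lecR; exact: (universal_norm_le Cd).
have -> : L (iota_u g) k = L (iota_u d) k.
  by rewrite /d (gca_linear B_cstar) // (rep_linear rep_L) st0 // scaler0 add0r.
apply: le_trans (rep_norm_le rep_L _ _) _.
apply: (@le_trans _ _ (m * r%:C%C)).
  have -> : m * r%:C%C = 2 * (r * kap)%:C%C * `|k| by rewrite /m rmorphM /=; ring.
  by rewrite ler_wpM2r // ler_wpM2l.
by rewrite -er; apply: mul_div_succ_le => //; exact: ltW.
Qed.

End induced_nontrivial.

Theorem theorem5 (R : realType) (G : topGroupoidType)
  (hausdorffG : hausdorff_space G)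
  (locally_compactG : locally_compact [set: G])
  (second_countableG : @second_countable G)
  (lam : G -> {measure set (borel G) -> \bar R})
  (haar_lam : haar_system setT lam)
  (u : G) (unit_u : units u)
  (alpha : {measure set (borel G) -> \bar R})
  (haar_alpha : haar_system (stability u) (fun=> alpha))
  (A : cstarAlgType (cplx R)) (iota : (G -> cplx R) -> A)
  (A_cstar : groupoid_cstar_algebra setT lam iota)
  (B : cstarAlgType (cplx R)) (iota_u : (G -> cplx R) -> B)
  (B_cstar : groupoid_cstar_algebra (stability u) (fun=> alpha) iota_u)
  (HL : hilbertType (cplx R)) (L : B -> {linear HL -> HL})
  (irreducible_L : irreducible L)
  (H : hilbertType (cplx R)) (tensor : (G -> cplx R) -> HL -> H)
  (Ind : A -> {linear H -> H})
  (induced_Ind : induced_representation lam u iota iota_u L tensor Ind) :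
  irreducible Ind.
Proof.
have [rep_L nz_L _] := irreducible_L; split.
- exact: ind_representation induced_Ind.
- exact: (induced_nontrivial hausdorffG locally_compactG haar_lam unit_u haar_alpha
    B_cstar rep_L induced_Ind nz_L).
- move=> M sM cM iM.
  exact: (invariant_subspace_trivial hausdorffG locally_compactG second_countableG
    haar_lam unit_u haar_alpha A_cstar B_cstar rep_L induced_Ind sM cM iM irreducible_L).
Qed.
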